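(* For each $n\in\mathbb{N}$, $n\ge 2$, there exist a closed set $\mathcal{E}\subset\mathbb{C}^n$ which contains no analytic variety of positive dimension and a plurisubharmonic function $\varphi:\mathbb{C}^n\to[-\infty,+\infty)$ such that (1) $\mathcal{E}=\{z\in\mathbb{C}^n:\varphi(z)=-\infty\}$; (2) the function $\varphi$ is pluriharmonic on $\mathbb{C}^n\setminus\mathcal{E}$; (3) the domain $\mathbb{C}^n\setminus\mathcal{E}$ is pseudoconvex; (4) for every $R>0$ one has $\widehat{\partial B^n(0,R)\cap\mathcal{E}}=\overline{B}^n(0,R)\cap\mathcal{E}$.
   Context: $B^n(0,R)\subset\mathbb{C}^n$ is the open Euclidean ball of radius $R$ centered at the origin, $\overline{B}^n(0,R)$ its closure and $\partial B^n(0,R)$ its boundary. For a compact set $K\subset\mathbb{C}^n$, $\widehat{K}$ denotes its polynomial hull $\{x\in\mathbb{C}^n: |p(x)|\le\sup_K|p| \text{ for all holomorphic polynomials } p\}$ (with $\widehat{\varnothing}=\varnothing$). ''$\mathcal{E}$ contains no analytic variety of positive dimension'' means that there is no analytic subset $A$ of positive dimension of an open subset of $\mathbb{C}^n$ with $A\subset\mathcal{E}$; equivalently, there is no nonconstant holomorphic map from the unit disc to $\mathbb{C}^n$ with image contained in $\mathcal{E}$. *)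

(* Defs.v *)
From HB Require Import structures.
From mathcomp Require Import all_boot all_order all_algebra.
From mathcomp Require Import all_classical all_reals all_analysis.
From mathcomp Require Import complex.
(* mpoly is not imported: its notations clash with those of all_analysis. *)
From mathcomp Require mpoly.

Set Implicit Arguments.
Unset Strict Implicit.
Unset Printing Implicit Defensive.

Import Order.TTheory GRing.Theory Num.Theory.
Import numFieldNormedType.Exports.

Local Open Scope classical_set_scope.
Local Open Scope ring_scope.

(* R[i]^o is R[i] with its topology and its structure of normed module over
   itself; the topology of Cn R n is the product, hence the Euclidean, one. *)
Notation Cx R := (complex R)^o.
Notation Cn R n := 'rV[Cx R]_n.

Definition ofreal (R : realType) (t : R) : Cx R := Complex t 0.

Definition cmod (R : realType) (z : Cx R) : R := complex.Re `|z : complex R|.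

Definition enorm (R : realType) (n : nat) (z : Cn R n) : R :=
  Num.sqrt (\sum_(i < n) cmod (z 0 i) ^+ 2).

Definition eball (R : realType) (n : nat) (r : R) : set (Cn R n) :=
  [set z | enorm z < r].

Definition boundary (T : topologicalType) (A : set T) : set T :=
  closure A `\` interior A.

Definition poly_mod (R : realType) (n : nat) (p : mpoly.mpoly n (complex R))
    (z : Cn R n) : \bar R :=
  (cmod (mpoly.meval (fun i => z 0 i : complex R) p))%:E.

(* The supremum of the empty set is -oo, so the hull of set0 is set0. *)
Definition polynomial_hull (R : realType) (n : nat) (K : set (Cn R n)) :
    set (Cn R n) :=
  [set x | forall p : mpoly.mpoly n (complex R),
     (poly_mod p x <= ereal_sup (poly_mod p @` K))%E].

(* On an open U, Frechet differentiability over R[i] is holomorphy. *)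
Definition holomorphic_on (R : realType) (V W : normedModType (complex R))
    (U : set V) (f : V -> W) : Prop :=
  forall z, U z -> differentiable f z.

Definition analytic_subset (R : realType) (n : nat) (U A : set (Cn R n)) :
    Prop :=
  A `<=` U /\
  forall a, U a -> exists (V : set (Cn R n)) (k : nat) (f : Cn R n -> Cn R k),
    [/\ open V, V a, V `<=` U, holomorphic_on V f &
        A `&` V = [set z | V z /\ f z = 0]].

(* A is, near a, a complex submanifold of dimension d: a biholomorphic map F
   of a neighbourhood V of a onto an open set W takes A `&` V to
   W `&` (C^d x {0}). *)
Definition regular_point (R : realType) (n d : nat) (A : set (Cn R n))
    (a : Cn R n) : Prop :=
  A a /\ (d <= n)%N /\
  exists (V W : set (Cn R n)) (F G : Cn R n -> Cn R n),
    [/\ open V, V a & open W] /\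
    [/\ holomorphic_on V F, holomorphic_on W G, F @` V = W,
        (forall z, V z -> G (F z) = z) &
        F @` (A `&` V) =
        W `&` [set w | forall i : 'I_n, (d <= i)%N -> w 0 i = 0]].

(* The dimension of an analytic set is the largest of its dimensions at its
   regular points. *)
Definition positive_dimensional (R : realType) (n : nat) (A : set (Cn R n)) :
    Prop :=
  exists (d : nat) (a : Cn R n), (0 < d)%N /\ regular_point d A a.

Definition contains_positive_dim_variety (R : realType) (n : nat)
    (E : set (Cn R n)) : Prop :=
  exists U A : set (Cn R n),
    [/\ open U, analytic_subset U A, positive_dimensional A & A `<=` E].

Definition usc_on (R : realType) (T : topologicalType) (D : set T)
    (u : T -> \bar R) : Prop :=
  forall z, D z -> forall c : R, (u z < c%:E)%E ->
    \forall w \near z, (u w < c%:E)%E.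

Definition circle_point (R : realType) (c : Cx R) (r t : R) : Cx R :=
  c + Complex (r * cos t) (r * sin t).

Definition circle_mean (R : realType) (u : Cx R -> \bar R) (c : Cx R) (r : R) :
    \bar R :=
  (((2 * pi)^-1)%R%:E *
   \int[@lebesgue_measure R]_(t in `[0%R, (2 * pi)%R]) u (circle_point c r t))%E.

(* The function identically -oo is allowed. *)
Definition subharmonic (R : realType) (D : set (Cx R)) (u : Cx R -> \bar R) :
    Prop :=
  [/\ forall z, D z -> (u z < +oo)%E,
      usc_on D u &
      forall (c : Cx R) (r : R), 0 < r ->
        [set z | cmod (z - c) <= r] `<=` D -> (u c <= circle_mean u c r)%E].

Definition line (R : realType) (n : nat) (a b : Cn R n) (zeta : Cx R) : Cn R n :=
  a + zeta *: b.

Definition plurisubharmonic (R : realType) (n : nat) (D : set (Cn R n))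
    (u : Cn R n -> \bar R) : Prop :=
  [/\ forall z, D z -> (u z < +oo)%E,
      usc_on D u &
      forall a b : Cn R n, subharmonic (line a b @^-1` D) (u \o line a b)].

(* Derivative along v with respect to a real parameter. *)
Definition rderivable (R : realType) (V : normedModType (complex R))
    (u : V -> R) (v z : V) : Prop :=
  derivable (fun t : R => u (z + (ofreal t : complex R) *: v)) 0 1.

Definition rderive (R : realType) (V : normedModType (complex R))
    (u : V -> R) (v z : V) : R :=
  derive1 (fun t : R => u (z + (ofreal t : complex R) *: v)) 0.

(* C^1 and C^2 in the real sense, on an open subset D of a finite dimensional
   space. *)
Definition C1_on (R : realType) (V : normedModType (complex R))
    (D : set V) (u : V -> R) : Prop :=
  forall v z, D z -> rderivable u v z /\ {for z, continuous (rderive u v)}.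

Definition C2_on (R : realType) (V : normedModType (complex R))
    (D : set V) (u : V -> R) : Prop :=
  C1_on D u /\ forall v, C1_on D (rderive u v).

Definition harmonic (R : realType) (D : set (Cx R)) (h : Cx R -> R) : Prop :=
  let ex : Cx R := Complex 1 0 in
  let ey : Cx R := Complex 0 1 in
  C2_on D h /\
  forall z, D z ->
    rderive (rderive h ex) ex z + rderive (rderive h ey) ey z = 0.

Definition pluriharmonic (R : realType) (n : nat) (D : set (Cn R n))
    (u : Cn R n -> R) : Prop :=
  C2_on D u /\
  forall a b : Cn R n, harmonic (line a b @^-1` D) (u \o line a b).

(* A domain with a continuous plurisubharmonic exhaustion function. *)
Definition pseudoconvex_domain (R : realType) (n : nat) (D : set (Cn R n)) :
    Prop :=
  [/\ open D, connected D &
      exists u : Cn R n -> R,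
        [/\ {within D, continuous u},
            plurisubharmonic D (EFin \o u) &
            forall c : R, let S := [set z | D z /\ u z < c] in
              compact (closure S) /\ closure S `<=` D]].

(* Main.v *)
From HB Require Import structures.
Require Import Defs.
From mathcomp Require Import all_boot all_order all_algebra.
From mathcomp Require Import all_classical all_reals all_analysis.
From mathcomp Require Import measurable_realfun.
From mathcomp Require Import complex.
From mathcomp Require Import ring lra.
From mathcomp Require mpoly.

Set Implicit Arguments.
Unset Strict Implicit.
Unset Printing Implicit Defensive.

Import Order.TTheory GRing.Theory Num.Theory.
Import numFieldNormedType.Exports.

Local Open Scope classical_set_scope.
Local Open Scope ring_scope.

(** The set is a limit of algebraic hypersurfaces. Start from a coordinate function
    [P_ 0] and put [P_ k.+1 = P_ k ^+ 2 - eps_ k * q_ k], where the [q_ k] run through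
    the polynomials [z_i * (z_j - a)], [a] a complex number with rational real and
    imaginary parts, each of them infinitely often, and the [eps_ k] decrease very
    fast. Once the modulus of [P_ k] exceeds a threshold [eta_ k], the perturbation is
    negligible from then on: such points escape, they form the open sets [O_ k], and
    the set [wset] consists of the points that never escape.

    The potential [phi] is the limit of the decreasing functions [u_ k], the
    [2 ^- k * ln (cmod (P_ k) + eta_ k)], whose sub-mean value property follows from
    Jensen's inequality ([phi_psh]). On [wset] it is at most the limit of
    [2 ^- k * ln (2 * eta_ k)], that is [-oo]. On [O_ k] it is the limit, with a
    geometric rate that extends to the first two derivatives, of the pluriharmonic
    functions [l_ j], the [2 ^- j * ln (cmod (P_ j))] with [k <= j]; so it is finite
    and pluriharmonic there ([wset_phi], [phi_pluriharmonic]).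

    The maximum of [- phi] and [ln (1 + enorm z)] exhausts the complement. The
    complement is connected because, in a complex line, [P_ k] is a polynomial of
    degree at most [2 ^ k], which on the set is tiny compared with its value at a
    given point off the set: this happens only near its roots, which a broken line
    can avoid ([good_height], [compl_pseudoconvex]).

    On the set, [P_ k ^+ 2] is close to [eps_ k * q_ k], relatively to [eps_ k]. So
    [q_ k] has an approximate continuous square root along any curve in the set. But
    along a nonconstant holomorphic curve some [q_ k] winds once around zero on
    a small circle, and this is impossible ([no_circle_sqrt], [wset_no_curve],
    [no_variety]).

    As for the hulls, [P_ k] separates a point off the set from the set
    ([hull_sub_ball]). Conversely, a polynomial that is larger at a point of the set
    in the ball than on the trace of the sphere gives a point [x0] near which a real
    quadratic polynomial vanishing at [x0] is, on the set, at most minus a multiple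
    of the squared distance to [x0]. Then
    holomorphic discs outside the set shrink towards [x0] from the other side, while
    their boundaries keep away from the set, and the minimum principle bounds [phi]
    from below along them, although [phi] is [-oo] at [x0] and upper semicontinuous
    ([touch], [wset_no_max], [ball_sub_hull]). *)

(** * Moduli and norms *)

Section Modulus.
Variable R : realType.
Implicit Types (x y z w : Cx R) (t : R).

Lemma cmodE z :
  cmod z = Num.sqrt (complex.Re z ^+ 2 + complex.Im z ^+ 2).
Proof. by rewrite /cmod normc_def. Qed.

Lemma normc_cmod z : `|z : complex R| = ofreal (cmod z).
Proof. by rewrite cmodE normc_def. Qed.

Lemma cmod_ge0 z : 0 <= cmod z.
Proof. by rewrite cmodE sqrtr_ge0. Qed.

Lemma cmod0 : cmod (0 : Cx R) = 0.
Proof. by rewrite /cmod normr0. Qed.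

Lemma cmod1 : cmod (1 : Cx R) = 1.
Proof. by rewrite /cmod normr1. Qed.

Lemma cmod0_eq0 z : cmod z = 0 -> z = 0.
Proof. by move=> z0; apply/(@normr0_eq0 (complex R)); rewrite normc_cmod z0. Qed.

Lemma cmod_gt0 z : (0 < cmod z) = (z != 0).
Proof.
rewrite lt_neqAle cmod_ge0 andbT eq_sym; congr negb; apply/eqP/eqP => [|->].
  exact: cmod0_eq0.
exact: cmod0.
Qed.

Lemma cmodM z w : cmod (z * w) = cmod z * cmod w.
Proof.
by rewrite /cmod normrM !normc_cmod /= mulr0 subr0.
Qed.

Lemma cmodN z : cmod (- z) = cmod z.
Proof. by rewrite /cmod normrN. Qed.

Lemma cmod_sub_sym z w : cmod (z - w) = cmod (w - z).
Proof. by rewrite -cmodN opprB. Qed.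

Lemma cmodD z w : cmod (z + w) <= cmod z + cmod w.
Proof.
have := ler_normD (z : complex R) w.
by rewrite !normc_cmod lecE => /andP[_].
Qed.

Lemma cmodB_ge z w : cmod z - cmod w <= cmod (z - w).
Proof. by rewrite lerBlDr -[X in cmod X <= _](subrK w); exact: cmodD. Qed.

Lemma cmodB_le z w : cmod (z - w) <= cmod z + cmod w.
Proof. by rewrite -(cmodN w); exact: cmodD. Qed.

Lemma cmodX z k : cmod (z ^+ k) = cmod z ^+ k.
Proof. by elim: k => [|k IH]; rewrite ?expr0 ?cmod1 // !exprS cmodM IH. Qed.

Lemma cmodV z : cmod (z^-1) = (cmod z)^-1.
Proof.
have [->|z0] := eqVneq z 0; first by rewrite invr0 cmod0 invr0.
apply: (mulfI (x := cmod z)); first by rewrite gt_eqF ?cmod_gt0.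
by rewrite -cmodM divff// cmod1 divff// gt_eqF ?cmod_gt0.
Qed.

Lemma cmod_ofreal t : cmod (ofreal t) = `|t|.
Proof. by rewrite cmodE /= expr0n addr0 sqrtr_sqr. Qed.

Lemma cmod_Re z : `|complex.Re z| <= cmod z.
Proof.
rewrite cmodE -sqrtr_sqr ler_wsqrtr// lerDl; exact: sqr_ge0.
Qed.

Lemma cmod_Im z : `|complex.Im z| <= cmod z.
Proof.
rewrite cmodE -[X in X <= _]sqrtr_sqr ler_wsqrtr// lerDr; exact: sqr_ge0.
Qed.

Lemma cmod_le_ReIm z : cmod z <= `|complex.Re z| + `|complex.Im z|.
Proof.
rewrite cmodE -ler_sqr ?nnegrE ?sqrtr_ge0 ?addr_ge0//.
rewrite sqr_sqrtr ?addr_ge0 ?sqr_ge0// sqrrD !real_normK ?num_real//.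
by rewrite lerD2r lerDl mulrn_wge0// mulr_ge0.
Qed.

Lemma cmod_sqr z : cmod z ^+ 2 = complex.Re z ^+ 2 + complex.Im z ^+ 2.
Proof. by rewrite cmodE sqr_sqrtr// addr_ge0// sqr_ge0. Qed.

Lemma cmod_conj z : cmod (conjc z) = cmod z.
Proof. by rewrite !cmodE; case: z => a b /=; rewrite sqrrN. Qed.

Lemma ReD z w : complex.Re (z + w) = complex.Re z + complex.Re w.
Proof. by case: z; case: w. Qed.

Lemma ReB z w : complex.Re (z - w) = complex.Re z - complex.Re w.
Proof. by case: z; case: w. Qed.

Lemma Re_le_cmod z : complex.Re z <= cmod z.
Proof. exact: le_trans (ler_norm _) (cmod_Re _). Qed.

Lemma Re_geN_cmod z : - cmod z <= complex.Re z.
Proof. by rewrite lerNl; apply: le_trans (cmod_Re z); rewrite -normrN ler_norm. Qed.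

Lemma nbhs_Cx z (A : set (Cx R)) :
  nbhs z A <-> exists2 e : R, 0 < e & forall w, cmod (w - z) < e -> A w.
Proof.
rewrite nbhs_ballP; split.
  move=> [e /= e0 he]; move: e0; rewrite ltcE /= => /andP[/eqP ime e0].
  exists (complex.Re e) => // w wz; apply: he.
  rewrite -ball_normE /= distrC normc_cmod.
  by rewrite ltcE /= ime eqxx.
move=> [e e0 he]; exists (ofreal e) => /=; first by rewrite ltcE /= eqxx.
move=> w; rewrite -ball_normE /= distrC normc_cmod ltcE /= eqxx /=.
exact: he.
Qed.

End Modulus.

Section Norm.
Variables (R : realType) (n : nat).
Implicit Types (z w v : Cn R n).

Lemma enorm_ge0 z : 0 <= enorm z.
Proof. exact: sqrtr_ge0. Qed.

Lemma enorm_sqr z : enorm z ^+ 2 = \sum_i cmod (z 0 i) ^+ 2.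
Proof. by rewrite sqr_sqrtr// sumr_ge0// => i _; exact: sqr_ge0. Qed.

Lemma cmod_enorm z i : cmod (z 0 i) <= enorm z.
Proof.
rewrite -[leLHS]ger0_norm ?cmod_ge0// -sqrtr_sqr ler_wsqrtr//.
by rewrite (bigD1 i)//= lerDl sumr_ge0// => j _; exact: sqr_ge0.
Qed.

(** Lagrange's identity: twice the defect is a sum of squares. *)
Lemma CauchySchwarz (a b : 'I_n -> R) :
  (\sum_i a i * b i) ^+ 2 <= (\sum_i a i ^+ 2) * (\sum_i b i ^+ 2).
Proof.
rewrite -subr_ge0 -(pmulr_rge0 _ (ltr0n R 2)).
have -> : 2 * ((\sum_i a i ^+ 2) * (\sum_i b i ^+ 2) - (\sum_i a i * b i) ^+ 2)
    = \sum_i \sum_j (a i * b j - a j * b i) ^+ 2.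
  rewrite expr2 mulrBr [2 * _]mulr_natl mulr2n {2}[_ * \sum_i b i ^+ 2]mulrC.
  rewrite !big_distrlr /= [2 * _]mulr_sumr -big_split -sumrB /=.
  apply: eq_bigr => i _; rewrite [2 * _]mulr_sumr -big_split -sumrB /=.
  by apply: eq_bigr => j _; ring.
by apply: sumr_ge0 => i _; apply: sumr_ge0 => j _; exact: sqr_ge0.
Qed.

Lemma sum_cmod_enorm z w : \sum_i cmod (z 0 i) * cmod (w 0 i) <= enorm z * enorm w.
Proof.
rewrite -[leLHS]ger0_norm; last first.
  by apply: sumr_ge0 => i _; rewrite mulr_ge0 ?cmod_ge0.
rewrite -sqrtr_sqr -sqrtrM; last by apply: sumr_ge0 => i _; exact: sqr_ge0.
rewrite ler_wsqrtr//; exact: CauchySchwarz.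
Qed.

Lemma cmod_sum (f : 'I_n -> Cx R) : cmod (\sum_i f i) <= \sum_i cmod (f i).
Proof.
elim/big_ind2 : _ => [||//]; first by rewrite cmod0.
by move=> x a y b ha hb; apply: le_trans (cmodD _ _) _; exact: lerD.
Qed.

Lemma enormD z w : enorm (z + w) <= enorm z + enorm w.
Proof.
rewrite -ler_sqr ?nnegrE ?addr_ge0 ?enorm_ge0// sqrrD !enorm_sqr.
have h : \sum_i cmod ((z + w) 0 i) ^+ 2 <=
    \sum_i (cmod (z 0 i) ^+ 2 + (cmod (z 0 i) * cmod (w 0 i)) *+ 2 +
            cmod (w 0 i) ^+ 2).
  apply: ler_sum => i _; rewrite mxE.
  rewrite -sqrrD.
  by rewrite ler_sqr ?nnegrE ?addr_ge0 ?cmod_ge0// cmodD.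
apply: le_trans h _; rewrite big_split /= lerD2r big_split /= lerD2l sumrMnl.
by rewrite lerMn2r sum_cmod_enorm.
Qed.

Lemma enormZ (c : Cx R) z : enorm (c *: z) = cmod c * enorm z.
Proof.
rewrite /enorm -[cmod c]ger0_norm ?cmod_ge0// -sqrtr_sqr -sqrtrM ?sqr_ge0//.
congr Num.sqrt; rewrite mulr_sumr; apply: eq_bigr => i _.
by rewrite mxE cmodM exprMn.
Qed.

Lemma enormN z : enorm (- z) = enorm z.
Proof. by rewrite /enorm; congr Num.sqrt; apply: eq_bigr => i _; rewrite mxE cmodN. Qed.

Lemma enorm0 : enorm (0 : Cn R n) = 0.
Proof.
rewrite /enorm big1 ?sqrtr0// => i _; by rewrite mxE cmod0 expr0n.
Qed.

Lemma enorm0_eq0 z : enorm z = 0 -> z = 0.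
Proof.
move=> z0; apply/rowP => i; rewrite mxE; apply: cmod0_eq0.
by apply/eqP; rewrite eq_le cmod_ge0 andbT -z0 cmod_enorm.
Qed.

Lemma enorm_gt0 z : (0 < enorm z) = (z != 0).
Proof.
rewrite lt_neqAle enorm_ge0 andbT eq_sym; congr negb; apply/eqP/eqP => [|->].
  exact: enorm0_eq0.
exact: enorm0.
Qed.

Lemma enormB_ge z w : enorm z - enorm w <= enorm (z - w).
Proof. by rewrite lerBlDr -[X in enorm X <= _](subrK w); exact: enormD. Qed.

Lemma enorm_sub_sym z w : enorm (z - w) = enorm (w - z).
Proof. by rewrite -enormN opprB. Qed.

Lemma enorm_le_sum z : enorm z <= \sum_i cmod (z 0 i).
Proof.
rewrite -ler_sqr ?nnegrE ?enorm_ge0 ?sumr_ge0// => [|i _]; last exact: cmod_ge0.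
rewrite enorm_sqr expr2 mulr_sumr; apply: ler_sum => i _.
rewrite expr2 ler_wpM2r ?cmod_ge0// (bigD1 i)//= lerDl.
by apply: sumr_ge0 => j _; exact: cmod_ge0.
Qed.

Lemma enorm_delta (i : 'I_n) : enorm (delta_mx 0 i : Cn R n) = 1.
Proof.
rewrite /enorm (bigD1 i)//= big1 ?addr0 => [|j ji].
  by rewrite mxE !eqxx cmod1 expr1n sqrtr1.
by rewrite mxE (negbTE ji) andbF cmod0 expr0n.
Qed.

Lemma nbhs_Cn z (A : set (Cn R n)) :
  nbhs z A <-> exists2 e : R, 0 < e & forall w, enorm (w - z) < e -> A w.
Proof.
rewrite nbhs_ballP; split.
  move=> [e /= e0 he]; move: e0; rewrite ltcE /= => /andP[/eqP ime e0].
  exists (complex.Re e) => // w wz; apply: he; split=> [|i j]; first by rewrite ltcE /= ime eqxx.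
  rewrite (ord1 i) -ball_normE /= distrC normc_cmod ltcE /= ime eqxx /=.
  apply: le_lt_trans wz; have := cmod_enorm (w - z) j.
  by rewrite !mxE.
move=> [e e0 he]; pose d := e / n.+1%:R.
have d0 : 0 < d by rewrite divr_gt0.
exists (ofreal d) => /=; first by rewrite ltcE /= eqxx.
move=> w bw; apply: he; apply: le_lt_trans (enorm_le_sum _) _.
apply: (@le_lt_trans _ _ (\sum_(i < n) d)).
  apply: ler_sum => i _; move: (bw.2 0 i).
  rewrite -ball_normE /= distrC normc_cmod ltcE /= eqxx /= => /ltW.
  by rewrite !mxE.
rewrite sumr_const card_ord -mulr_natl /d mulrCA gtr_pMr//.
by rewrite ltr_pdivrMr ?mul1r ?ltr_nat.
Qed.

End Norm.

(** * Continuity and balls *)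

Section Topology.
Variable R : realType.

Lemma continuous_CxP (f : Cx R -> R) z :
  (forall e, 0 < e -> exists2 d, 0 < d &
     forall w, cmod (w - z) < d -> `|f z - f w| < e) -> {for z, continuous f}.
Proof.
move=> hf A /nbhs_ballP[e /= e0 he]; have [d d0 hd] := hf e e0.
apply/nbhs_Cx; exists d => // w /hd fw; apply: he.
by rewrite -ball_normE.
Qed.

Lemma continuous_CnP n (f : Cn R n -> R) z :
  (forall e, 0 < e -> exists2 d, 0 < d &
     forall w, enorm (w - z) < d -> `|f z - f w| < e) -> {for z, continuous f}.
Proof.
move=> hf A /nbhs_ballP[e /= e0 he]; have [d d0 hd] := hf e e0.
apply/nbhs_Cn; exists d => // w /hd fw; apply: he.
by rewrite -ball_normE.
Qed.

Lemma cmod_continuous : continuous (@cmod R).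
Proof.
move=> z; apply: continuous_CxP => e e0; exists e => // w wz.
have := cmodB_ge w z; have := cmodB_ge z w; rewrite (cmod_sub_sym z w) => h1 h2.
by rewrite ltr_norml; apply/andP; split; lra.
Qed.

Lemma Re_continuous : continuous (fun z : Cx R => complex.Re z).
Proof.
move=> z; apply: continuous_CxP => e e0; exists e => // w wz.
by rewrite -ReB; apply: le_lt_trans (cmod_Re _) _; rewrite cmod_sub_sym.
Qed.

Lemma Complex_continuous : continuous (fun p : R * R => Complex p.1 p.2 : Cx R).
Proof.
move=> [a b] A /nbhs_Cx[e e0 he].
exists (ball a (e / 2), ball b (e / 2)) => /=.
  by split; apply: nbhsx_ballx; rewrite divr_gt0.
move=> [x y] [/= xa yb]; apply: he.
apply: le_lt_trans (cmod_le_ReIm _) _ => /=.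
move: xa yb; rewrite -!ball_normE /= => xa yb.
by rewrite (distrC x) (distrC y); lra.
Qed.

Lemma continuous_Complex (T : topologicalType) (f g : T -> R) x :
  {for x, continuous f} -> {for x, continuous g} ->
  {for x, continuous (fun t => Complex (f t) (g t) : Cx R)}.
Proof.
move=> cf cg; apply: (@continuous_comp _ _ _ (fun t => (f t, g t))
  (fun p : R * R => Complex p.1 p.2 : Cx R)).
  exact: (cvg_pair cf cg).
exact: Complex_continuous.
Qed.

Lemma compact_disc (r : R) : compact [set z : Cx R | cmod z <= r].
Proof.
pose Q := [set z : Cx R | `|complex.Re z| <= r /\ `|complex.Im z| <= r].
apply: (@subclosed_compact _ _ Q).
- apply: (@preimage_closed _ _ (@cmod R) [set x | x <= r]).
    by move=> x _; exact: cmod_continuous.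
  exact: closed_le.
- have -> : Q = (fun p : R * R => Complex p.1 p.2 : Cx R) @`
      (`[- r, r] `*` `[- r, r]).
    apply/seteqP; split => [[a b] [/= ha hb]|_ [[a b] /= [ha hb] <-]].
      by exists (a, b) => //=; rewrite !in_itv /= -!ler_norml.
    by move: ha hb; rewrite /= !in_itv /= -!ler_norml.
  apply: continuous_compact; last first.
    by apply: compact_setX; exact: segment_compact.
  by apply: continuous_subspaceT => x; exact: Complex_continuous.
- move=> z /= zr; split; apply: le_trans zr; [exact: cmod_Re|exact: cmod_Im].
Qed.

Variable n : nat.

Lemma enorm_continuous : continuous (@enorm R n).
Proof.
move=> z; apply: continuous_CnP => e e0; exists e => // w wz.
have := enormB_ge w z; have := enormB_ge z w; rewrite (enorm_sub_sym z w) => h1 h2.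
by rewrite ltr_norml; apply/andP; split; lra.
Qed.

Lemma closed_cball (r : R) : closed [set z : Cn R n | enorm z <= r].
Proof.
apply: (@preimage_closed _ _ (@enorm R n) [set x | x <= r]).
  by move=> x _; exact: enorm_continuous.
exact: closed_le.
Qed.

Lemma open_eball (r : R) : open (@eball R n r).
Proof.
rewrite /eball; apply: (@open_comp _ _ (@enorm R n) [set x | x < r]).
  by move=> x _; exact: enorm_continuous.
exact: open_lt.
Qed.

Lemma compact_cball (r : R) : compact [set z : Cn R n | enorm z <= r].
Proof.
apply: (@subclosed_compact _ _
  [set v : Cn R n | forall i : 'I_n, [set z : Cx R | cmod z <= r] (v ord0 i)]).
- exact: (@closed_cball r).
- apply: (@rV_compact (Cx R) n (fun _ => [set z : Cx R | cmod z <= r])) => i.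
  exact: compact_disc.
- by move=> z /= zr i; exact: le_trans (cmod_enorm _ _) zr.
Qed.

Lemma closure_eball (r : R) : 0 < r ->
  closure (@eball R n r) = [set z | enorm z <= r].
Proof.
move=> r0; apply/seteqP; split.
  rewrite closureE => z; apply; split; first exact: closed_cball.
  by move=> w /= /ltW.
move=> z /= zr B /nbhs_Cn[e e0 he].
pose d := Num.min (2^-1 : R) (e / (2 * (r + 1))).
have d0 : 0 < d by rewrite lt_min invr_gt0 ltr0n divr_gt0//; lra.
have d1 : d < 1 by rewrite gt_min invf_lt1// ltr1n.
have de : d * (r + 1) < e.
  have : d <= e / (2 * (r + 1)) by rewrite ge_min lexx orbT.
  by rewrite ler_pdivlMr; lra.
have dd : enorm (ofreal (1 - d) *: z) = (1 - d) * enorm z.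
  by rewrite enormZ cmod_ofreal ger0_norm//; lra.
exists (ofreal (1 - d) *: z); split.
  rewrite /eball /= dd; have := enorm_ge0 z; nra.
apply: he.
have -> : ofreal (1 - d) *: z - z = ofreal (- d) *: z.
  apply/rowP => i; rewrite !mxE; case: (z 0 i) => a b.
  by apply/eqP; rewrite eq_complex /=; apply/andP; split; apply/eqP; ring.
rewrite enormZ cmod_ofreal normrN gtr0_norm//.
have := enorm_ge0 z; nra.
Qed.

Lemma boundary_eball (r : R) : 0 < r ->
  boundary (@eball R n r) = [set z | enorm z = r].
Proof.
move=> r0; rewrite /boundary closure_eball//.
have /interior_id -> := @open_eball r.
apply/seteqP; split=> z; rewrite /eball /=.
  by move=> [zr /negP]; rewrite -leNgt => rz; apply/eqP; rewrite eq_le zr rz.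
by move=> ->; split=> //; rewrite ltxx.
Qed.

End Topology.

(** * The bilinear pairing *)

Section Dot.
Variables (R : realType) (n : nat).
Implicit Types (a b h k : Cn R n).

(** Without conjugation: [dot a] is the general complex linear form. *)
Definition dot a h : Cx R := \sum_i a 0 i * h 0 i.

Definition cconj h : Cn R n := \row_i (conjc (h 0 i) : Cx R).

Lemma dotC a h : dot a h = dot h a.
Proof. by apply: eq_bigr => i _; rewrite mulrC. Qed.

Lemma dotDr a h k : dot a (h + k) = dot a h + dot a k.
Proof. by rewrite -big_split; apply: eq_bigr => i _; rewrite mxE mulrDr. Qed.

Lemma dotDl a b h : dot (a + b) h = dot a h + dot b h.
Proof. by rewrite !(dotC _ h) dotDr. Qed.

Lemma dotZr a (c : Cx R) h : dot a (c *: h) = c * dot a h.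
Proof. by rewrite mulr_sumr; apply: eq_bigr => i _; rewrite mxE mulrCA. Qed.

Lemma dotZl a (c : Cx R) h : dot (c *: a) h = c * dot a h.
Proof. by rewrite !(dotC _ h) dotZr. Qed.

Lemma dotNr a h : dot a (- h) = - dot a h.
Proof. by rewrite -scaleN1r dotZr mulN1r. Qed.

Lemma dotNl a h : dot (- a) h = - dot a h.
Proof. by rewrite !(dotC _ h) dotNr. Qed.

Lemma dot0r a : dot a 0 = 0.
Proof. by rewrite /dot big1// => i _; rewrite mxE mulr0. Qed.

Lemma dot0l a : dot 0 a = 0.
Proof. by rewrite dotC dot0r. Qed.

Lemma cmod_dot a h : cmod (dot a h) <= enorm a * enorm h.
Proof.
apply: le_trans (cmod_sum _) _; apply: le_trans (sum_cmod_enorm _ _).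
by apply: ler_sum => i _; rewrite cmodM.
Qed.

Lemma dot_cconj h : dot (cconj h) h = ofreal (enorm h ^+ 2).
Proof.
rewrite enorm_sqr -[ofreal _]/((real_complex R) _) raddf_sum /=.
apply: eq_bigr => i _; rewrite mxE cmod_sqr; case: (h 0 i) => x y /=.
by apply/eqP; rewrite eq_complex /=; apply/andP; split; apply/eqP; ring.
Qed.

Lemma enorm_cconj h : enorm (cconj h) = enorm h.
Proof.
by congr Num.sqrt; apply: eq_bigr => i _; rewrite mxE cmod_conj.
Qed.

Lemma enorm_sqrD h k : enorm (h + k) ^+ 2 =
  enorm h ^+ 2 + 2 * complex.Re (dot (cconj h) k) + enorm k ^+ 2.
Proof.
rewrite !enorm_sqr.
have -> : complex.Re (dot (cconj h) k) =
    \sum_i complex.Re (conjc (h 0 i) * (k 0 i) : Cx R).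
  rewrite /dot; elim/big_ind2 : _ => [//|x a y b <- <-|i _]; first exact: ReD.
  by rewrite mxE.
rewrite mulr_sumr -!big_split /=; apply: eq_bigr => i _.
rewrite mxE !cmod_sqr; case: (h 0 i) => x y; case: (k 0 i) => z w /=; ring.
Qed.

Lemma bilinear_bound (S : 'M[Cx R]_n) : exists2 K : R, 0 <= K &
  forall h, enorm (h *m S) <= K * enorm h.
Proof.
exists (\sum_j \sum_i cmod (S i j)).
  by apply: sumr_ge0 => j _; apply: sumr_ge0 => i _; exact: cmod_ge0.
move=> h; apply: le_trans (enorm_le_sum _) _; rewrite mulr_suml.
apply: ler_sum => j _; rewrite mxE mulr_suml; apply: le_trans (cmod_sum _) _.
apply: ler_sum => i _; rewrite cmodM mulrC; apply: ler_wpM2l; first exact: cmod_ge0.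
exact: cmod_enorm.
Qed.

End Dot.

(** * Polynomials *)

Import (canonicals, coercions) mpoly.

(** Polynomials are handled as syntactic expressions: evaluation, directional
    derivatives, restriction to polynomial discs and degree bounds are then all
    defined by structural recursion and their properties follow by induction. *)
Inductive pexp (R : realType) (n : nat) :=
  | PC of complex R
  | PX of 'I_n
  | PA of pexp R n & pexp R n
  | PM of pexp R n & pexp R n.
Arguments PC {R n}.
Arguments PX {R n}.
Arguments PA {R n}.
Arguments PM {R n}.

Section Expressions.
Variables (R : realType) (n : nat).
Local Notation C := (complex R).
Implicit Types (t : pexp R n) (z v w h : Cn R n) (g : 'I_n -> {poly C}).

Fixpoint pev t z : Cx R :=
  match t with
  | PC c => c
  | PX i => z 0 i
  | PA a b => pev a z + pev b z
  | PM a b => pev a z * pev b z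
  end.

Fixpoint pD v t : pexp R n :=
  match t with
  | PC c => PC 0
  | PX i => PC (v 0 i)
  | PA a b => PA (pD v a) (pD v b)
  | PM a b => PA (PM (pD v a) b) (PM a (pD v b))
  end.

Fixpoint pcomp (g : 'I_n -> {poly C}) t : {poly C} :=
  match t with
  | PC c => c%:P
  | PX i => g i
  | PA a b => pcomp g a + pcomp g b
  | PM a b => pcomp g a * pcomp g b
  end.

Fixpoint pdeg t : nat :=
  match t with
  | PC c => 0
  | PX i => 1
  | PA a b => maxn (pdeg a) (pdeg b)
  | PM a b => pdeg a + pdeg b
  end.

Fixpoint mpoly_of t : mpoly.mpoly n C :=
  match t with
  | PC c => mpoly.mpolyC n c
  | PX i => mpoly.mpolyX C (mpoly.mnm1 i)
  | PA a b => mpoly_of a + mpoly_of b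
  | PM a b => mpoly_of a * mpoly_of b
  end.

Lemma meval_mpoly_of t z :
  mpoly.meval (fun i => z 0 i : C) (mpoly_of t) = pev t z.
Proof.
elim: t => [c|i|a IHa b IHb|a IHa b IHb] /=.
- exact: mpoly.mevalC.
- exact: mpoly.mevalXU.
- by rewrite mpoly.mevalD IHa IHb.
- by rewrite mpoly.mevalM IHa IHb.
Qed.

Lemma pexp_of_mpoly (p : mpoly.mpoly n C) :
  exists t, forall z, pev t z = mpoly.meval (fun i => z 0 i : C) p.
Proof.
have hX (m : mpoly.multinom n) : exists t, forall z,
    pev t z = mpoly.meval (fun i => z 0 i : C) (mpoly.mpolyX C m).
  suff [t ht] : exists t, forall z, pev t z = \prod_(i < n) (z 0 i) ^+ m i.
    by exists t => z; rewrite ht mpoly.mevalX.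
  elim: (index_enum _) => [|i s [t ht]].
    by exists (PC 1) => z; rewrite big_nil.
  have [u hu] : exists u, forall z, pev u z = (z 0 i) ^+ m i.
    elim: (m i) => [|k [u hu]]; first by exists (PC 1).
    by exists (PM (PX i) u) => z /=; rewrite hu exprS.
  by exists (PM u t) => z /=; rewrite big_cons hu ht.
elim/mpoly.mpolyind : p => [|c m p _ _ [t ht]].
  by exists (PC 0) => z /=; rewrite mpoly.meval0.
have [u hu] := hX m.
exists (PA (PM (PC c) u) t) => z /=.
by rewrite mpoly.mevalD mpoly.mevalZ hu ht.
Qed.

Lemma horner_pcomp g t (x : C) :
  (pcomp g t).[x] = pev t (\row_i ((g i).[x] : Cx R)).
Proof.
elim: t => [c|i|a IHa b IHb|a IHa b IHb] /=.
- by rewrite hornerC.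
- by rewrite mxE.
- by rewrite hornerD IHa IHb.
- by rewrite hornerM IHa IHb.
Qed.

Lemma size_pcomp g t : (forall i, size (g i) <= 2)%N ->
  (size (pcomp g t) <= (pdeg t).+1)%N.
Proof.
move=> hg; elim: t => [c|i|a IHa b IHb|a IHa b IHb] //=.
- by rewrite size_polyC leq_b1.
- apply: leq_trans (size_polyD _ _) _; rewrite geq_max.
  by rewrite (leq_trans IHa) ?(leq_trans IHb)// ltnS ?leq_maxl ?leq_maxr.
- apply: leq_trans (size_polyMleq _ _) _.
  rewrite -ltnS; apply: (@leq_ltn_trans (size (pcomp g a) + size (pcomp g b)).-1) => //.
  have := leq_add IHa IHb; rewrite addSn addnS.
  by case: (_ + _)%N => //= m; rewrite !ltnS.
Qed.

Lemma pev_continuous t : continuous (pev t).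
Proof.
elim: t => [c|i|a IHa b IHb|a IHa b IHb] /= z.
- exact: (@cst_continuous _ _ (c : Cx R)).
- exact: coord_continuous.
- exact: (cvgD (IHa z) (IHb z)).
- exact: (cvgM (IHa z) (IHb z)).
Qed.

(** These bounds let a perturbation be chosen small uniformly in the point and in
    the directions of differentiation. *)
Lemma pev_bound t (r : R) : exists2 M : R, 0 <= M & forall z, enorm z <= r ->
  [/\ cmod (pev t z) <= M,
      forall v, cmod (pev (pD v t) z) <= M * enorm v &
      forall v w, cmod (pev (pD w (pD v t)) z) <= M * (enorm v * enorm w)].
Proof.
elim: t => [c|i|a [A A0 IHa] b [B B0 IHb]|a [A A0 IHa] b [B B0 IHb]] /=.
- exists (cmod (c : Cx R)) => [|z _]; first exact: cmod_ge0.
  by split=> // [v|v w]; rewrite cmod0 !mulr_ge0 ?cmod_ge0 ?enorm_ge0.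
- exists (Num.max r 1) => [|z zr]; first by rewrite le_max ler01 orbT.
  have m1 : 1 <= Num.max r 1 by rewrite le_max lexx orbT.
  split=> [|v|v w].
  + by rewrite le_max (le_trans (cmod_enorm _ _) zr).
  + by rewrite (le_trans (cmod_enorm v i))// ler_peMl// enorm_ge0.
  + by rewrite cmod0 !mulr_ge0 ?enorm_ge0// le_max ler01 orbT.
- exists (A + B) => [|z zr]; first exact: addr_ge0.
  have [a0 a1 a2] := IHa z zr; have [b0 b1 b2] := IHb z zr.
  split=> [|v|v w]; apply: le_trans (cmodD _ _) _; rewrite ?mulrDl; exact: lerD.
- exists (4 * (A * B)) => [|z zr]; first by rewrite !mulr_ge0.
  have [a0 a1 a2] := IHa z zr; have [b0 b1 b2] := IHb z zr.
  have AB0 : 0 <= A * B by rewrite mulr_ge0.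
  split=> [|v|v w].
  + rewrite cmodM; have := ler_pM (cmod_ge0 _) (cmod_ge0 _) a0 b0; lra.
  + apply: le_trans (cmodD _ _) _; rewrite !cmodM.
    have h1 := ler_pM (cmod_ge0 _) (cmod_ge0 _) (a1 v) b0.
    have h2 := ler_pM (cmod_ge0 _) (cmod_ge0 _) a0 (b1 v).
    have : 0 <= A * B * enorm v by rewrite mulr_ge0// enorm_ge0.
    lra.
  + have h1 := ler_pM (cmod_ge0 _) (cmod_ge0 _) (a2 v w) b0.
    have h2 := ler_pM (cmod_ge0 _) (cmod_ge0 _) (a1 v) (b1 w).
    have h3 := ler_pM (cmod_ge0 _) (cmod_ge0 _) (a1 w) (b1 v).
    have h4 := ler_pM (cmod_ge0 _) (cmod_ge0 _) a0 (b2 v w).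
    have := cmodD (pev (pD w (pD v a)) z * pev b z + pev (pD v a) z * pev (pD w b) z)
      (pev (pD w a) z * pev (pD v b) z + pev a z * pev (pD w (pD v b)) z).
    have := cmodD (pev (pD w (pD v a)) z * pev b z) (pev (pD v a) z * pev (pD w b) z).
    have := cmodD (pev (pD w a) z * pev (pD v b) z) (pev a z * pev (pD w (pD v b)) z).
    rewrite !cmodM; lra.
Qed.

(** By induction on the expression. A product contributes the rank one matrix
    [a^T *m b], so that [S] need not be symmetric. *)
Lemma pev_taylor t z : exists (a : Cn R n) (S : 'M[Cx R]_n) (M : R),
  0 <= M /\ forall h, enorm h <= 1 ->
  cmod (pev t (z + h) - (pev t z + dot a h + dot (h *m S) h)) <= M * enorm h ^+ 3.
Proof.
have bb (a : Cn R n) (S : 'M[Cx R]_n) : exists2 K : R, 0 <= K &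
    forall h, cmod (dot a h) <= K * enorm h /\
      cmod (dot (h *m S) h) <= K * enorm h ^+ 2.
  have [K K0 hK] := bilinear_bound S; have a0 := enorm_ge0 a.
  exists (enorm a + K) => [|h]; first exact: addr_ge0.
  have h0 := enorm_ge0 h; split; apply: le_trans (cmod_dot _ _) _.
    by rewrite ler_wpM2r// lerDl.
  rewrite expr2 mulrA ler_wpM2r//; apply: le_trans (hK h) _.
  by rewrite ler_wpM2r// lerDr.
elim: t => [c|i|p [a [S [A [A0 IHa]]]] q [b [T [B [B0 IHb]]]]
               |p [a [S [A [A0 IHa]]]] q [b [T [B [B0 IHb]]]]] /=.
- exists 0, 0, 0; split=> // h _.
  by rewrite mulmx0 !dot0l !addr0 subrr cmod0 mul0r.
- exists (delta_mx 0 i), 0, 0; split=> // h _.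
  rewrite mulmx0 dot0l addr0 mxE mul0r.
  rewrite /dot (bigD1 i)//= big1 ?addr0 => [|j ji].
    by rewrite mxE !eqxx mul1r subrr cmod0.
  by rewrite mxE (negbTE ji) andbF mul0r.
- exists (a + b), (S + T), (A + B); split=> [|h h1]; first exact: addr_ge0.
  rewrite mulmxDr !dotDl mulrDl.
  apply: le_trans (lerD (IHa h h1) (IHb h h1)); apply: le_trans (cmodD _ _).
  rewrite le_eqVlt; apply/orP; left; apply/eqP; congr cmod.
  ring.
- have [K K0 hK] := bb a S; have [L L0 hL] := bb b T.
  pose p0 := pev p z; pose q0 := pev q z.
  pose P0 := cmod p0; pose Q0 := cmod q0.
  have P00 : 0 <= P0 by exact: cmod_ge0.
  have Q00 : 0 <= Q0 by exact: cmod_ge0.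
  exists (q0 *: a + p0 *: b), (q0 *: S + p0 *: T + a^T *m b).
  exists (A * (Q0 + L + L + B) + B * (P0 + K + K) + 3 * (K * L)).
  split; first by rewrite !addr_ge0 ?mulr_ge0 ?addr_ge0.
  move=> h h1; have := IHa h h1; have := IHb h h1.
  set e := pev p (z + h) - _; set f := pev q (z + h) - _ => hf he.
  have [ka ks] := hK h; have [lb lt] := hL h.
  have h0 := enorm_ge0 h; set r := enorm h in h0 h1 he hf ka ks lb lt *.
  have dab : dot (h *m (a^T *m b)) h = dot a h * dot b h.
    rewrite mulmxA [h *m a^T]mx11_scalar mul_scalar_mx dotZl; congr (_ * _).
    by rewrite mxE; apply: eq_bigr => i _; rewrite mxE mulrC.
  have -> : pev p (z + h) * pev q (z + h) - (p0 * q0 +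
     dot (q0 *: a + p0 *: b) h + dot (h *m (q0 *: S + p0 *: T + a^T *m b)) h) =
     e * (q0 + dot b h + dot (h *m T) h + f)
     + f * (p0 + dot a h + dot (h *m S) h)
     + (dot a h * dot (h *m T) h + dot (h *m S) h * dot b h
        + dot (h *m S) h * dot (h *m T) h).
    rewrite !mulmxDr !dotDl dab -!scalemxAr !dotZl /e /f -/p0 -/q0; ring.
  have r2 : r ^+ 2 <= r by rewrite expr2 ler_piMr.
  have r3 : r ^+ 3 <= r by rewrite exprS ler_piMr// exprn_ile1.
  have r30 : 0 <= r ^+ 3 by rewrite exprn_ge0.
  have r43 : r ^+ 4 <= r ^+ 3 by rewrite exprSr ler_piMr.
  have r1 : 0 <= r ^+ 2 by rewrite exprn_ge0.
  have E1 : cmod (e * (q0 + dot b h + dot (h *m T) h + f)) <=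
      (A * r ^+ 3) * (Q0 + L + L + B).
    rewrite cmodM; apply: ler_pM => //; [exact: cmod_ge0|exact: cmod_ge0|].
    have c1 := cmodD (q0 + dot b h + dot (h *m T) h) f.
    have c2 := cmodD (q0 + dot b h) (dot (h *m T) h).
    have c3 := cmodD q0 (dot b h).
    have l1 : L * r <= L by rewrite ler_piMr.
    have l2 : L * r ^+ 2 <= L by rewrite ler_piMr// (le_trans r2).
    have l3 : B * r ^+ 3 <= B by rewrite ler_piMr// (le_trans r3).
    rewrite -/Q0 in c3; lra.
  have E2 : cmod (f * (p0 + dot a h + dot (h *m S) h)) <=
      (B * r ^+ 3) * (P0 + K + K).
    rewrite cmodM; apply: ler_pM => //; [exact: cmod_ge0|exact: cmod_ge0|].
    have c2 := cmodD (p0 + dot a h) (dot (h *m S) h).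
    have c3 := cmodD p0 (dot a h).
    have l1 : K * r <= K by rewrite ler_piMr.
    have l2 : K * r ^+ 2 <= K by rewrite ler_piMr// (le_trans r2).
    rewrite -/P0 in c3; lra.
  have KL : 0 <= K * L by rewrite mulr_ge0.
  have E3 : cmod (dot a h * dot (h *m T) h) <= K * L * r ^+ 3.
    rewrite cmodM; have := ler_pM (cmod_ge0 _) (cmod_ge0 _) ka lt.
    by rewrite (_ : K * r * _ = K * L * r ^+ 3)//; ring.
  have E4 : cmod (dot (h *m S) h * dot b h) <= K * L * r ^+ 3.
    rewrite cmodM; have := ler_pM (cmod_ge0 _) (cmod_ge0 _) ks lb.
    by rewrite (_ : K * r ^+ 2 * _ = K * L * r ^+ 3)//; ring.
  have E5 : cmod (dot (h *m S) h * dot (h *m T) h) <= K * L * r ^+ 3.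
    rewrite cmodM; have := ler_pM (cmod_ge0 _) (cmod_ge0 _) ks lt.
    rewrite (_ : K * r ^+ 2 * _ = K * L * r ^+ 4); last by ring.
    by move=> /le_trans; apply; exact: ler_wpM2l.
  have c1 := cmodD (e * (q0 + dot b h + dot (h *m T) h + f)
     + f * (p0 + dot a h + dot (h *m S) h)) (dot a h * dot (h *m T) h + dot (h *m S) h * dot b h
        + dot (h *m S) h * dot (h *m T) h).
  have c2 := cmodD (e * (q0 + dot b h + dot (h *m T) h + f))
     (f * (p0 + dot a h + dot (h *m S) h)).
  have c3 := cmodD (dot a h * dot (h *m T) h + dot (h *m S) h * dot b h)
     (dot (h *m S) h * dot (h *m T) h).
  have c4 := cmodD (dot a h * dot (h *m T) h) (dot (h *m S) h * dot b h).
  have -> : (A * (Q0 + L + L + B) + B * (P0 + K + K) + 3 * (K * L)) * r ^+ 3 =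
     (A * r ^+ 3) * (Q0 + L + L + B) + (B * r ^+ 3) * (P0 + K + K) +
     (K * L * r ^+ 3 + K * L * r ^+ 3 + K * L * r ^+ 3) by ring.
  lra.
Qed.

End Expressions.

(** * Integrals over circles *)

Section CircleIntegrals.
Variable R : realType.
Local Notation mu := (@lebesgue_measure R).
Implicit Types (f g : R -> R) (a b c : R).

Definition J f a b : R := \int[mu]_(t in `[a, b]) f t.

Lemma continuous_integrable f a b : continuous f ->
  mu.-integrable `[a, b] (EFin \o f).
Proof.
move=> cf; apply: continuous_compact_integrable; first exact: segment_compact.
exact: continuous_subspaceT.
Qed.

Lemma J_split f a b c : continuous f -> a <= b -> b <= c ->
  J f a c = J f a b + J f b c.
Proof.
move=> cf ab bc; have ic := continuous_integrable a c cf.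
have h : J f a c - J f a b = \int[mu]_(t in `]b, c]) f t.
  by rewrite /J Rintegral_itvB ?bnd_simp.
rewrite [J f b c]/J -Rintegral_itv_obnd_cbnd; first by rewrite -h addrC subrK.
by apply: integrableS (continuous_integrable b c cf) => //;
  exact: subset_itv_oc_cc.
Qed.

Lemma J_affine f (k d : R) a b : 0 < k -> a <= b -> continuous f ->
  J f (k * a + d) (k * b + d) = k * J (fun t => f (k * t + d)) a b.
Proof.
move=> k0 ab cf; pose F := fun t : R => k * t + d.
have dF (t : R) : is_derive t 1 F k.
  rewrite /F; by apply: is_derive_eq; rewrite addr0 [LHS]mulr1.
have F'E : derive1 F = cst k by apply/funext => t; rewrite derive1E derive_val.
have cF : continuous F.
  move=> t; apply: cvgD; last exact: cvg_cst.
  by apply: cvgM; [exact: cvg_cst|exact: cvg_id].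
have cfF : continuous (f \o F) by move=> t; apply: continuous_comp; [exact: cF|exact: cf].
rewrite /J /Rintegral -[k * a + d]/(F a) -[k * b + d]/(F b).
rewrite (@integration_by_substitution_increasing _ F f a b)//.
- rewrite -[RHS]/(k * J (f \o F) a b) -RintegralZl//; last exact: continuous_integrable.
  rewrite /Rintegral; congr fine; apply: eq_integral => t _ /=.
  by rewrite F'E fctE mulrC.
- by move=> x y _ _ xy; rewrite /F ltrD2r ltr_pM2l.
- by rewrite F'E => ? _; exact: cvg_cst.
- by rewrite F'E; exact: is_cvg_cst.
- by rewrite F'E; exact: is_cvg_cst.
- split; first by move=> x _; case: (dF x).
  + by apply: cvg_at_right_filter; exact: cF.
  + by apply: cvg_at_left_filter; exact: cF.
- exact: continuous_subspaceT.
Qed.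

Lemma eq_J f g a b : f =1 g -> J f a b = J g a b.
Proof. by move=> fg; apply: eq_Rintegral => t _; exact: fg. Qed.

Lemma JD f g a b : continuous f -> continuous g ->
  J (fun t => f t + g t) a b = J f a b + J g a b.
Proof.
move=> cf cg; rewrite /J RintegralD//; exact: continuous_integrable.
Qed.

Lemma le_J f g a b : continuous f -> continuous g ->
  (forall t, f t <= g t) -> J f a b <= J g a b.
Proof.
move=> cf cg fg; apply: le_Rintegral => //; exact: continuous_integrable.
Qed.

Lemma J_cst (x : R) a b : a <= b -> J (fun=> x) a b = x * (b - a).
Proof.
move=> ab; rewrite /J Rintegral_cst//.
congr (_ * _).
have h : lebesgue_measure (`[a, b]%classic : set R) = (b - a)%:E.
  rewrite lebesgue_measure_itv /= lte_fin; case: ltP => // ba.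
  by have -> : b = a; [apply/eqP; rewrite eq_le ab ba|rewrite subrr].
by rewrite -[RHS]/(fine (b - a)%:E) -h.
Qed.

Local Notation T := (pi *+ 2 : R).

Lemma T_gt0 : 0 < T. Proof. by rewrite pmulrn_lgt0// pi_gt0. Qed.

Lemma J_half_period f : continuous f -> periodic f T ->
  J (fun t => f (t + pi)) 0 T = J f 0 T.
Proof.
move=> cf pf; have pi0 := pi_gt0 R; have T0 := T_gt0.
have piT : pi <= T by rewrite mulr2n lerDl ltW.
have shift d b : 0 <= b -> J f d (b + d) = J (fun t => f (t + d)) 0 b.
  move=> b0; have := @J_affine f 1 d 0 b ltr01 b0 cf.
  by rewrite mulr0 add0r !mul1r => ->; apply: eq_J => t; rewrite mul1r.
have TT : T <= T + pi by rewrite lerDl ltW.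
rewrite -(shift pi T (ltW T0)) (J_split cf piT TT) (J_split cf (ltW pi0) piT) addrC.
congr (_ + _); rewrite [T + pi]addrC (shift T pi (ltW pi0)).
by apply: eq_J => t; rewrite pf.
Qed.

(** Together with [J_half_period], this turns [1 - z ^+ 2 = (1 - z) * (1 + z)] into
    an identity between integrals over circles. *)
Lemma J_double f : continuous f -> periodic f T ->
  J (fun t => f (2 * t)) 0 T = J f 0 T.
Proof.
move=> cf pf; have T0 := ltW T_gt0.
have h : J f (2 * 0 + 0) (2 * T + 0) = 2 * J f 0 T.
  have h := @J_affine f 1 T 0 T ltr01 T0 cf; rewrite mulr0 add0r !mul1r in h.
  rewrite mulr0 !addr0 (@J_split f 0 T (2 * T))//; last by lra.
  rewrite [2 * T]mulr_natl [T *+ 2]mulr2n h mulr_natl mulr2n; congr (_ + _).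
  by apply: eq_J => t; rewrite mul1r pf.
apply: (@mulfI _ (2 : R)); first by rewrite pnatr_eq0.
rewrite -h J_affine//; congr (_ * _); by apply: eq_J => t; rewrite addr0.
Qed.

End CircleIntegrals.

Section Circle.
Variable R : realType.
Implicit Types (t : R) (s c z : Cx R).
Local Notation T := (pi *+ 2 : R).

Definition cis t : Cx R := Complex (cos t) (sin t).

Lemma cmod_cis t : cmod (cis t) = 1.
Proof. by rewrite cmodE /= cos2Dsin2 sqrtr1. Qed.

Lemma cis_add t u : cis (t + u) = cis t * cis u.
Proof.
by rewrite /cis cosD sinD; apply/eqP; rewrite eq_complex /=; apply/andP; split;
  apply/eqP; ring.
Qed.

Lemma cis_pi t : cis (t + pi) = - cis t.
Proof. by rewrite /cis cosDpi sinDpi. Qed.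

Lemma cis_2pi t : cis (t + T) = cis t.
Proof. by rewrite /cis cosD2pi sinD2pi. Qed.

Lemma cis_continuous : continuous cis.
Proof.
move=> t; apply: (@continuous_Complex _ _ cos sin).
  exact: continuous_cos.
exact: continuous_sin.
Qed.

Lemma circle_pointE c (r : R) t : circle_point c r t = c + ofreal r * cis t.
Proof.
rewrite /circle_point /cis; congr (_ + _).
by apply/eqP; rewrite eq_complex /=; apply/andP; split; apply/eqP; ring.
Qed.

Lemma cmod_circle_point c (r : R) t : 0 < r -> cmod (circle_point c r t - c) = r.
Proof.
by move=> r0; rewrite circle_pointE addrAC subrr add0r cmodM cmod_ofreal cmod_cis
  mulr1 gtr0_norm.
Qed.

Lemma circle_point_continuous c (r : R) : continuous (circle_point c r).
Proof.
rewrite (_ : circle_point c r = fun t => c + ofreal r * cis t); last first.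
  by apply/funext => t; rewrite circle_pointE.
move=> t; apply: cvgD; first exact: cvg_cst.
apply: cvgM; [exact: cvg_cst|exact: cis_continuous].
Qed.

Lemma ln_cmod_continuous (X : topologicalType) (f : X -> Cx R) x :
  {for x, continuous f} -> f x != 0 -> {for x, continuous (fun y => ln (cmod (f y)))}.
Proof.
move=> cf f0; apply: (@continuous_comp _ _ _ f (fun z => ln (cmod z))) => //.
apply: (@continuous_comp _ _ _ (@cmod R) (@ln R)).
  exact: cmod_continuous.
by apply: continuous_ln; rewrite cmod_gt0.
Qed.

(** As [(1 - z) * (1 + z) = 1 - z ^+ 2], the integral for [s] is half of the one for
    [s ^+ 2]. Iterating, these integrals would grow like [2 ^+ k], while they are
    bounded: they vanish. *)
Lemma J_ln_one_sub s : cmod s < 1 ->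
  J (fun t => ln (cmod (1 - s * cis t))) 0 T = 0.
Proof.
move=> s1; set L := fun s t => ln (cmod (1 - s * cis t)).
have T0 := T_gt0 R.
have pos u t : cmod u < 1 -> 0 < 1 - cmod u <= cmod (1 - u * cis t).
  move=> u1; rewrite subr_gt0 u1 /=.
  by have := cmodB_ge 1 (u * cis t); rewrite cmod1 cmodM cmod_cis mulr1.
have cL u : cmod u < 1 -> continuous (L u).
  move=> u1 t; apply: (@ln_cmod_continuous _ (fun t => 1 - u * cis t)); last first.
    by rewrite -cmod_gt0; have /andP[] := pos u t u1; exact: lt_le_trans.
  apply: (@cvgB _ (Cx R)); first exact: cvg_cst.
  by apply: (@cvgM (Cx R)); [exact: cvg_cst|exact: cis_continuous].
have pL u : periodic (L u) T by move=> t; rewrite /L cis_2pi.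
have halve u : cmod u < 1 -> 2 * J (L u) 0 T = J (L (u ^+ 2)) 0 T.
  move=> u1; have u2 : cmod (u ^+ 2) < 1.
    by rewrite cmodX exprn_ilt1// cmod_ge0.
  rewrite -(J_double (cL _ u2) (pL _)) [2 * _]mulr_natl mulr2n.
  rewrite -{2}(J_half_period (cL _ u1) (pL _)) -JD; last 2 first.
  - exact: cL.
  - move=> t; apply: (@continuous_comp _ _ _ (fun t => t + pi) (L u)).
      by apply: cvgD; [exact: cvg_id|exact: cvg_cst].
    exact: cL.
  apply: eq_J => t; rewrite /L cis_pi.
  have Nu : cmod (- u) < 1 by rewrite cmodN.
  have /andP[a0 a1] := pos u t u1; have /andP[b0 b1] := pos (- u) t Nu.
  have -> : 1 - u * - cis t = 1 - (- u) * cis t by rewrite mulrN mulNr.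
  have p1 := lt_le_trans a0 a1; have p2 := lt_le_trans b0 b1.
  rewrite -lnM ?posrE//.
  rewrite -cmodM; congr (ln (cmod _)).
  rewrite mulr_natl mulr2n cis_add; ring.
have pow k : cmod (s ^+ (2 ^ k)) <= cmod s /\
    2 ^+ k * J (L s) 0 T = J (L (s ^+ (2 ^ k))) 0 T.
  elim: k => [|k [IH1 IH2]]; first by rewrite expn0 expr1 mul1r.
  have lt1 := le_lt_trans IH1 s1; split.
    rewrite expnSr exprM cmodX; apply: le_trans IH1.
    by rewrite expr2 ler_piMr ?cmod_ge0// ltW.
  by rewrite exprS -mulrA IH2 halve// -exprM expnSr.
pose B : R := 1 - ln (1 - cmod s).
have ub u t : cmod u <= cmod s -> `|L u t| <= B.
  move=> us; have u1 := le_lt_trans us s1.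
  have /andP[a0 a1] := pos u t u1.
  have c0 := lt_le_trans a0 a1.
  have l0 : ln (1 - cmod s) <= 0.
    by rewrite ln_le0// lerBlDr lerDl cmod_ge0.
  rewrite ler_norml; apply/andP; split.
    have : ln (1 - cmod s) <= L u t.
      rewrite /L ler_ln ?posrE ?subr_gt0//.
      by apply: le_trans a1; rewrite lerD2l lerN2.
    by rewrite /B; lra.
  have : L u t <= 1.
    set X := cmod _ in c0 a1; have hX : 1 + (X - 1) = X by ring.
    have := @le_ln1Dx _ (X - 1); rewrite hX => h.
    have XN : -1 < X - 1 by lra.
    rewrite /L -/X; apply: le_trans (h XN) _.
    have := cmodB_le 1 (u * cis t); rewrite -/X.
    by rewrite cmod1 cmodM cmod_cis mulr1; lra.
  by rewrite /B; lra.
have B0 : 0 <= B by apply: le_trans (ub s 0 (lexx _)).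
have bound k : 2 ^+ k * `|J (L s) 0 T| <= B * T.
  have [h1 h2] := pow k; have lt1 := le_lt_trans h1 s1.
  rewrite -[2 ^+ k]ger0_norm ?exprn_ge0// -normrM h2.
  apply: le_trans (le_normr_Rintegral _ _) _ => //.
    exact: continuous_integrable (cL _ lt1).
  rewrite -[leRHS](_ : J (fun=> B) 0 T = _); last by rewrite J_cst ?subr0// ltW.
  apply: (@le_J _ (fun t => `|L (s ^+ (2 ^ k)) t|)).
  - by move=> t; apply: cvg_norm; exact: cL.
  - by move=> t; exact: cvg_cst.
  - by move=> t; exact: ub.
apply/eqP; rewrite -normr_eq0; apply/eqP/le_anti; rewrite normr_ge0 andbT.
rewrite leNgt; apply/negP => j0.
have [k hk] : exists k : nat, B * T / `|J (L s) 0 T| < k%:R.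
  by exists (Num.bound (B * T / `|J (L s) 0 T|)); apply: archi_boundP;
    rewrite divr_ge0// mulr_ge0// ltW.
have := bound k; rewrite leNgt => /negP; apply.
rewrite -ltr_pdivrMr//; apply: lt_trans hk _.
by rewrite -natrX ltr_nat ltn_expl.
Qed.

End Circle.

(** * Logarithms of moduli of polynomials *)

Section Jensen.
Variable R : realType.
Local Notation C := (complex R).
Implicit Types (h g : {poly C}) (c z : C) (r : R).
Local Notation T := (pi *+ 2 : R).

Lemma horner_continuous h : continuous (fun z : Cx R => h.[z] : Cx R).
Proof.
elim/poly_ind: h => [|p x IH] z.
  rewrite (_ : (fun z : Cx R => (0 : {poly C}).[z] : Cx R) = cst 0).
    exact: cst_continuous.
  by apply/funext => w; rewrite horner0.
pose f := fun z : Cx R => (p.[z] : Cx R) * z + (x : Cx R) : Cx R.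
rewrite (_ : (fun z : Cx R => _) = f); last first.
  by apply/funext => w; rewrite hornerMXaddC.
have cp : p.[y] @[y --> z] --> (p.[z] : Cx R) by exact: IH.
have h := @cvgM (Cx R) (Cx R) (nbhs z) (nbhs_filter z) _ _ _ _ cp cvg_id.
exact: (cvgD h (@cst_continuous (Cx R) (Cx R) x z)).
Qed.

Lemma ln_horner_circle_continuous h c r : 0 < r ->
  (forall z, cmod (z - c) = r -> h.[z] != 0) ->
  continuous (fun t => ln (cmod h.[circle_point c r t])).
Proof.
move=> r0 h0 t; apply: (@ln_cmod_continuous _ _ (fun t => h.[circle_point c r t])).
  apply: continuous_comp; first exact: circle_point_continuous.
  exact: horner_continuous.
by apply: h0; exact: cmod_circle_point.
Qed.

Lemma poly_split h : exists (a : C) (s : seq C),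
  h = a *: \prod_(z <- s) ('X - z%:P).
Proof.
have [s hs] := closed_field_poly_normal h.
by exists (lead_coef h), s.
Qed.

(** The polynomial splits into linear factors, and each of them reduces to
    [1 - u * cis t] with [cmod u < 1]. *)
Lemma J_ln_poly h c r : 0 < r -> (forall z, cmod (z - c) <= r -> h.[z] != 0) ->
  J (fun t => ln (cmod h.[circle_point c r t])) 0 T = T * ln (cmod h.[c]).
Proof.
move=> r0; have T0 := T_gt0 R; have [a [s ->]] := poly_split h.
elim: s => [_|x s IH hz].
  rewrite big_nil; under eq_J do rewrite hornerZ hornerC mulr1.
  by rewrite J_cst ?ltW// subr0 hornerZ hornerC mulr1 mulrC.
pose q := a *: \prod_(z <- s) ('X - z%:P).
have E z : (a *: \prod_(z <- x :: s) ('X - z%:P)).[z] = (z - x) * q.[z].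
  by rewrite big_cons scalerAr hornerM !hornerE.
have qz z : cmod (z - c) <= r -> q.[z] != 0.
  by move=> /hz; rewrite E mulf_eq0 negb_or => /andP[].
have xz z : cmod (z - c) <= r -> z - x != 0.
  by move=> /hz; rewrite E mulf_eq0 negb_or => /andP[].
have cr : cmod (c - c) <= r by rewrite subrr cmod0 ltW.
have pr t : cmod (circle_point c r t - c) <= r by rewrite cmod_circle_point.
under eq_J do rewrite E cmodM lnM ?posrE ?cmod_gt0 ?xz ?qz//.
have cq : continuous (fun t => ln (cmod q.[circle_point c r t])).
  by apply: ln_horner_circle_continuous => // z zr; apply: qz; rewrite zr.
have cx : continuous (fun t => ln (cmod (circle_point c r t - x))).
  move=> t; apply: (@ln_cmod_continuous _ _ (fun t => circle_point c r t - x)).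
    by apply: (@cvgB _ (Cx R)); [exact: circle_point_continuous|exact: cvg_cst].
  exact: xz.
rewrite JD//= (IH qz) E cmodM lnM ?posrE ?cmod_gt0 ?xz ?qz// mulrDr.
congr (_ + _).
have c0 : c - x != 0 by exact: xz.
(* dividing by c - x reduces to the unit circle *)
pose u : C := - (ofreal r / (c - x)).
have rc : r < cmod (c - x).
  rewrite ltNge; apply/negP => xr.
  by have := xz x; rewrite subrr eqxx cmod_sub_sym => /(_ xr).
have u1 : cmod u < 1.
  rewrite cmodN cmodM cmodV cmod_ofreal gtr0_norm//.
  by rewrite ltr_pdivrMr ?mul1r// cmod_gt0.
have F t : ln (cmod (circle_point c r t - x)) =
    ln (cmod (c - x)) + ln (cmod (1 - u * cis t)).
  have -> : circle_point c r t - x = (c - x) * (1 - u * cis t).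
    by rewrite circle_pointE /u; field.
  rewrite cmodM lnM ?posrE ?cmod_gt0//.
  rewrite -cmod_gt0; have := cmodB_ge 1 (u * cis t).
  by rewrite cmod1 cmodM cmod_cis mulr1; lra.
have cu : continuous (fun t => ln (cmod (1 - u * cis t))).
  rewrite (_ : (fun t => ln (cmod (1 - u * cis t))) =
    fun t => ln (cmod (circle_point c r t - x)) - ln (cmod (c - x))).
    by move=> t; apply: cvgB; [exact: cx|exact: cvg_cst].
  by apply/funext => v; rewrite F addrAC subrr add0r.
under eq_J do rewrite F.
rewrite JD//; last exact: cst_continuous.
by rewrite J_ln_one_sub// addr0 J_cst ?ltW// subr0 mulrC.
Qed.

(** The zeros in the disc are reflected in the circle: this preserves the modulus on
    the circle and does not decrease it at the center. A zero on the circle is its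
    own reflection, so that the new zeros are pushed slightly outwards, at the price
    of [d]. *)
Lemma zero_free_majorant h c r : 0 < r -> h.[c] != 0 -> forall d : R, 0 < d ->
  exists g, [/\ forall z, cmod (z - c) <= r -> g.[z] != 0,
                cmod h.[c] <= cmod g.[c] &
                forall z, cmod (z - c) = r -> cmod g.[z] <= cmod h.[z] + d].
Proof.
move=> r0; have [a [s ->]] := poly_split h.
move=> hc; have {hc} a0 : a != 0.
  by apply: contraNneq hc => ->; rewrite scale0r horner0.
elim: s => [|x s IH] d d0.
  exists a%:P; split=> [z _|//|z _]; rewrite ?big_nil !hornerE //=.
  by rewrite lerDl ltW.
pose q := a *: \prod_(z <- s) ('X - z%:P).
have E z : (a *: \prod_(z <- x :: s) ('X - z%:P)).[z] = (z - x) * q.[z].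
  by rewrite big_cons scalerAr hornerM !hornerE.
have [M M0 hM] : exists2 M : R, 0 <= M & forall z, cmod (z - c) = r -> cmod q.[z] <= M.
  rewrite /q; elim: {+}s => [|y l [M M0 hM]].
    exists (cmod a) => [|z _]; first exact: cmod_ge0.
    by rewrite big_nil !hornerE.
  exists ((r + cmod (c - y)) * M) => [|z zr].
    by rewrite mulr_ge0// addr_ge0 ?cmod_ge0// ltW.
  rewrite big_cons scalerAr hornerM cmodM ler_pM ?cmod_ge0 ?hM//.
  rewrite !hornerE (_ : z - y = (z - c) + (c - y)); last by ring.
  by rewrite -zr; exact: cmodD.
pose X := r + cmod (c - x).
have X0 : 0 < X by rewrite ltr_wpDr ?cmod_ge0.
pose d2 := d / (2 * X).
have d20 : 0 < d2 by rewrite divr_gt0// mulr_gt0.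
pose d1 := Num.min (d / (2 * (M + d2))) (r / 2).
have Md : 0 < 2 * (M + d2) by lra.
have d10 : 0 < d1 by rewrite lt_min !divr_gt0.
have [g [g1 g2 g3]] := IH d2 d20.
suff [f [f1 f2 f3]] : exists f, [/\ forall z, cmod (z - c) <= r -> f.[z] != 0,
    cmod (c - x) <= cmod f.[c] &
    forall z, cmod (z - c) = r -> cmod f.[z] <= cmod (z - x) + d1].
  exists (f * g); split=> [z zr||z zr].
  - by rewrite hornerM mulf_neq0// ?f1 ?g1.
  - by rewrite E hornerM !cmodM ler_pM ?cmod_ge0.
  rewrite E hornerM !cmodM.
  have := ler_pM (cmod_ge0 _) (cmod_ge0 _) (f3 z zr) (g3 z zr) => /le_trans; apply.
  have zx : cmod (z - x) <= X.
    rewrite (_ : z - x = (z - c) + (c - x)); last by ring.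
    by rewrite /X -zr; exact: cmodD.
  have h1 : cmod (z - x) * d2 <= d / 2.
    apply: (@le_trans _ _ (X * d2)); first by rewrite ler_pM2r.
    by rewrite /d2 le_eqVlt; apply/orP; left; apply/eqP; field; rewrite gt_eqF.
  have h2 : d1 * (cmod q.[z] + d2) <= d / 2.
    apply: (@le_trans _ _ (d1 * (M + d2))).
      by rewrite ler_pM2l// lerD2r hM.
    have : d1 <= d / (2 * (M + d2)) by rewrite ge_min lexx.
    by rewrite ler_pdivlMr//; lra.
  rewrite mulrDl mulrDr -/q; lra.
have [xr|xr] := ltP r (cmod (c - x)).
  exists ('X - x%:P); split=> [z zr||z zr]; rewrite !hornerE //; last by rewrite lerDl ltW.
  rewrite subr_eq0; apply: contraTneq zr => ->.
  by rewrite cmod_sub_sym -ltNge.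
(* the reflected factor, its zero being moved slightly out of the circle *)
pose b : C := conjc (x - c).
have br : cmod b <= r by rewrite cmod_conj cmod_sub_sym.
pose l : R := 1 - d1 / r.
have l01 : 0 < l < 1.
  have h1 : d1 / r <= 1 / 2.
    have : d1 <= r / 2 by rewrite ge_min lexx orbT.
    by rewrite ler_pdivrMr//; lra.
  have h2 : 0 < d1 / r by rewrite divr_gt0.
  by rewrite /l; lra.
have /andP[l0 l1] := l01.
pose k : C := ofreal l * b / ofreal r.
exists ((ofreal r : C)%:P - k *: ('X - c%:P)).
have fE z : ((ofreal r : C)%:P - k *: ('X - c%:P)).[z] = ofreal r - k * (z - c).
  by rewrite !hornerE.
have rn : (ofreal r : Cx R) != 0 by rewrite -cmod_gt0 cmod_ofreal gtr0_norm.
have kn : cmod k <= l.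
  rewrite /k !cmodM cmodV !cmod_ofreal !gtr0_norm//.
  rewrite ler_pdivrMr// ler_pM2l//.
split=> [z zr||z zr]; rewrite fE.
- rewrite -cmod_gt0; have := cmodB_ge (ofreal r) (k * (z - c)).
  rewrite cmod_ofreal gtr0_norm// cmodM.
  have := ler_pM (cmod_ge0 _) (cmod_ge0 _) kn zr.
  have : l * r < r by rewrite gtr_pMl.
  lra.
- by rewrite subrr mulr0 subr0 cmod_ofreal gtr0_norm.
- have -> : ofreal r - k * (z - c) = ofreal l * (ofreal r - b * (z - c) / ofreal r)
      + ofreal (1 - l) * ofreal r.
    rewrite [ofreal (1 - l)](_ : _ = 1 - ofreal l); last first.
      by apply/eqP; rewrite eq_complex /= subr0 !eqxx.
    by rewrite /k; field.
  apply: le_trans (cmodD _ _) _; rewrite !cmodM !cmod_ofreal.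
  have l1' : 0 < 1 - l by rewrite subr_gt0.
  rewrite !gtr0_norm//.
  have -> : (1 - l) * r = d1.
    by rewrite /l; field; rewrite gt_eqF.
  rewrite lerD2r.
  have -> : cmod (ofreal r - b * (z - c) / ofreal r) = cmod (z - x).
    have wr : (z - c) * conjc (z - c) = ofreal r ^+ 2.
      rewrite -zr -(sqr_normc (z - c : C)); congr (_ ^+ 2); exact: normc_cmod.
    have -> : ofreal r - b * (z - c) / ofreal r =
        (z - c) * conjc (z - x) / ofreal r.
      have -> : conjc (z - x) = conjc (z - c) - b.
        by rewrite /b -rmorphB; congr conjc; ring.
      transitivity ((ofreal r ^+ 2 - b * (z - c)) / ofreal r); first by field.
      by congr (_ / _); rewrite -wr; ring.
    rewrite !cmodM cmodV cmod_conj cmod_ofreal zr gtr0_norm//.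
    by field; rewrite gt_eqF.
  by rewrite ler_piMl ?cmod_ge0// ltW.
Qed.

(** The mean value property of a zero-free majorant of [h]; the bound [v], being
    bounded away from zero, absorbs the error [d] of the majorant. *)
Lemma Jensen_le h c r (v : R -> R) : 0 < r -> h.[c] != 0 -> continuous v ->
  (forall t, 0 < v t) -> (forall t, cmod h.[circle_point c r t] <= v t) ->
  T * ln (cmod h.[c]) <= J (fun t => ln (v t)) 0 T.
Proof.
move=> r0 hc cv v0 hv; have T0 := T_gt0 R.
have cl0 : continuous (fun t => ln (v t)).
  move=> t; apply: (@continuous_comp _ _ _ v (@ln R)); first exact: cv.
  exact: continuous_ln.
have [m m0 hm] : exists2 m : R, 0 < m & forall t, 0 <= t <= T -> m <= v t.
  have [t0 _ ht0] : exists2 x, x \in `[0, T] & forall t, t \in `[0, T] -> v x <= v t.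
    by apply: EVT_min; [exact: ltW|exact: continuous_subspaceT].
  exists (v t0) => [|t ht]; first exact: v0.
  by apply: ht0; rewrite in_itv.
apply/ler_addgt0Pr => e e0.
pose d := e * m / T.
have d0 : 0 < d by rewrite divr_gt0// mulr_gt0.
have [g [g1 g2 g3]] := zero_free_majorant r0 hc d0.
have gc : continuous (fun t => ln (cmod g.[circle_point c r t])).
  by apply: ln_horner_circle_continuous => // z zr; apply: g1; rewrite zr.
apply: (@le_trans _ _ (T * ln (cmod g.[c]))).
  rewrite ler_pM2l// ler_ln ?posrE ?cmod_gt0// -?cmod_gt0.
  by apply: lt_le_trans g2; rewrite cmod_gt0.
rewrite -(J_ln_poly r0 g1).
apply: (@le_trans _ _ (J (fun t => ln (v t) + d / m) 0 T)); last first.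
  rewrite JD//; last exact: cst_continuous.
  rewrite lerD2l J_cst; last exact: ltW.
  rewrite subr0 /d.
  rewrite le_eqVlt; apply/orP; left; apply/eqP.
  move: (T) T0 => U U0; field.
  by rewrite !gt_eqF.
apply: le_Rintegral => //.
- exact: continuous_integrable.
- apply: continuous_integrable => t; apply: cvgD; last exact: cvg_cst.
  exact: cl0.
move=> t /=; rewrite in_itv /= => tT.
have gt0 : 0 < cmod g.[circle_point c r t].
  by rewrite cmod_gt0 g1// cmod_circle_point.
apply: (@le_trans _ _ (ln (v t + d))).
  rewrite ler_ln ?posrE//; last by have := v0 t; lra.
  apply: le_trans (g3 _ _) _; first exact: cmod_circle_point.
  by rewrite lerD2r.
have -> : v t + d = v t * (1 + d / v t) by field; rewrite gt_eqF.
have dv : 0 < d / v t by rewrite divr_gt0.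
rewrite lnM ?posrE//; last by lra.
rewrite lerD2l; apply: le_trans (le_ln1Dx _) _; first by lra.
by rewrite ler_pM2l// lef_pV2 ?posrE// hm.
Qed.

(** The minimum principle: without zeros, [ln (cmod h)] is harmonic. *)
Lemma ln_poly_ge h c r (m : R) : 0 < r ->
  (forall z, cmod (z - c) <= r -> h.[z] != 0) ->
  (forall z, cmod (z - c) = r -> m <= ln (cmod h.[z])) -> m <= ln (cmod h.[c]).
Proof.
move=> r0 hz hm; have T0 := T_gt0 R.
rewrite -(ler_pM2l T0) -(J_ln_poly r0 hz).
have -> : T * m = J (fun=> m) 0 T by rewrite J_cst ?ltW// subr0 mulrC.
apply: le_J; first exact: cst_continuous.
  by apply: ln_horner_circle_continuous => // z zr; apply: hz; rewrite zr.
by move=> t; apply: hm; exact: cmod_circle_point.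
Qed.

End Jensen.

(** * One step of the construction *)

Section Step.
Variables (R : realType) (n : nat).
Local Notation C := (complex R).
Implicit Types (P q t : pexp R n) (z v w : Cn R n) (k : nat) (e eta : R).

Definition Pnext P q e : pexp R n := PA (PM P P) (PM (PC (- ofreal e)) q).

(** The first and second derivatives of a branch of [log P]. *)
Definition L1 P v z : Cx R := pev (pD v P) z / pev P z.

Definition L2 P v w z : Cx R :=
  pev (pD w (pD v P)) z / pev P z - pev (pD v P) z * pev (pD w P) z / pev P z ^+ 2.

(** The comparisons with [eta ^+ 2 / 4] keep escaping points escaping, and the
    exponential factor makes the rescaled logarithms of the thresholds tend to [-oo].
    The last clause, for points above the threshold, makes the first two derivatives
    of the rescaled logarithms converge. *)
Definition good_eps k P eta q e : Prop :=
  [/\ 0 < e, e <= eta ^+ 2 / 4, e <= eta ^+ 2 * expR (- 2 ^+ k.+2) &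
   forall z, enorm z <= k%:R -> e * cmod (pev q z) <= eta ^+ 2 / 4 /\
   (eta <= cmod (pev P z) -> forall v w,
      cmod (L1 (Pnext P q e) v z - 2 * L1 P v z) <= 2 ^- k * enorm v /\
      cmod (L2 (Pnext P q e) v w z - 2 * L2 P v w z)
        <= 2 ^- k * (enorm v * enorm w))].

(** In the ball the values and the derivatives of [P] and [q] are at most [M], and
    where [eta <= cmod (pev P z)] the denominators are at least [eta ^+ 3 / 2]: all
    the errors are [e] times a constant. *)
Lemma good_eps_ex k P eta q : 0 < eta <= 1 -> exists e, good_eps k P eta q e.
Proof.
move=> /andP[eta0 eta1].
have [MP MP0 hMP] := pev_bound P k%:R; have [Mq Mq0 hMq] := pev_bound q k%:R.
pose M := 1 + MP + Mq.
have M1 : 1 <= M by rewrite /M; lra.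
have M0 : 0 < M by lra.
pose e1 := eta ^+ 2 * expR (- 2 ^+ k.+2).
pose e2 := eta ^+ 2 / (4 * M).
(* 21 * M ^+ 5 counts the terms of the numerators, and (2 / eta ^+ 3) ^+ 2 bounds
   the inverse of the denominators *)
pose e3 := 2 ^- k * eta ^+ 6 / (84 * M ^+ 5).
have h0 : 0 < eta ^+ 2 by rewrite exprn_gt0.
have p0 : 0 < 2 ^- k :> R by rewrite invr_gt0 exprn_gt0.
have e10 : 0 < e1 by rewrite mulr_gt0// expR_gt0.
have e20 : 0 < e2 by rewrite divr_gt0// mulr_gt0.
have e30 : 0 < e3 by rewrite divr_gt0// mulr_gt0// exprn_gt0.
pose e := Num.min e1 (Num.min e2 e3).
have ele1 : e <= e1 by rewrite ge_min lexx.
have ele2 : e <= e2 by rewrite /e !ge_min lexx orbT.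
have ele3 : e <= e3 by rewrite /e !ge_min lexx !orbT.
have e0 : 0 < e by rewrite !lt_min e10 e20 e30.
have e2M : e * M <= eta ^+ 2 / 4.
  have : e2 * M = eta ^+ 2 / 4 by rewrite /e2; field; rewrite gt_eqF.
  by move=> <-; rewrite ler_pM2r.
have eM : e <= e * M by rewrite ler_peMr// ltW.
have eta21 : eta ^+ 2 <= 1 by rewrite exprn_ile1// ltW.
exists e; split=> //; first by lra.
move=> z zk; have [P0 P1 P2] := hMP z zk; have [q0 q1 q2] := hMq z zk.
have PM_ : MP <= M by rewrite /M; lra.
have qM_ : Mq <= M by rewrite /M; lra.
have eq4 : e * cmod (pev q z) <= eta ^+ 2 / 4.
  apply: le_trans e2M; rewrite ler_pM2l//; exact: le_trans q0 qM_.
split=> // hP v w.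
have v0 := enorm_ge0 v; have w0 := enorm_ge0 w.
have up (x a b : R) : x <= a * b -> 0 <= b -> a <= M -> x <= M * b.
  by move=> xa b0 aM; apply: le_trans xa _; rewrite ler_wpM2r.
have vw0 : 0 <= enorm v * enorm w by rewrite mulr_ge0.
have hp1 := up _ _ _ (P1 v) v0 PM_; have hp2 := up _ _ _ (P1 w) w0 PM_.
have hp12 := up _ _ _ (P2 v w) vw0 PM_.
have hq1 := up _ _ _ (q1 v) v0 qM_; have hq2 := up _ _ _ (q1 w) w0 qM_.
have hq12 := up _ _ _ (q2 v w) vw0 qM_.
have hp := le_trans P0 PM_; have hq := le_trans q0 qM_.
rewrite /L1 /L2 /=.
move: (pev P z) (pev q z) (pev (pD v P) z) (pev (pD w P) z) (pev (pD w (pD v P)) z)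
 (pev (pD v q) z) (pev (pD w q) z) (pev (pD w (pD v q)) z) eq4 hP hp hq hp1 hp2 hp12
  hq1 hq2 hq12 {P0 P1 P2 q0 q1 q2 hMP hMq}.
move=> p x p1 p2 p12 x1 x2 x12 eq4 hP hp hq hp1 hp2 hp12 hq1 hq2 hq12.
pose E : Cx R := ofreal e.
have cE : cmod E = e by rewrite cmod_ofreal gtr0_norm.
pose N := p ^+ 2 - E * x.
have pp : 0 < cmod p by exact: lt_le_trans hP.
have pn0 : p != 0 by rewrite -cmod_gt0.
have hN : eta ^+ 2 / 2 <= cmod N.
  have := cmodB_ge (p ^+ 2) (E * x); rewrite cmodM cE cmodX.
  have : eta ^+ 2 <= cmod p ^+ 2.
    by apply: lerXn2r => //; rewrite nnegrE ?cmod_ge0// ltW.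
  lra.
have Npos : 0 < cmod N by apply: lt_le_trans hN; rewrite divr_gt0.
have N0 : N != 0 by rewrite -cmod_gt0.
pose X := 2 * x * p1 - p * x1.
pose Y := 2 * x2 * p1 + 2 * x * p12 - p2 * x1 - p * x12.
pose N2 := 2 * p * p2 - E * x2.
have c2 : cmod (2 : Cx R) = 2.
  have -> : (2 : Cx R) = ofreal 2 by rewrite -[ofreal 2]/(real_complex R 2) rmorph_nat.
  by rewrite cmod_ofreal ger0_norm.
have hX : cmod X <= 3 * M ^+ 2 * enorm v.
  have := cmodB_le (2 * x * p1) (p * x1); rewrite !cmodM c2.
  have := ler_pM (cmod_ge0 _) (cmod_ge0 _) hq hp1.
  have := ler_pM (cmod_ge0 _) (cmod_ge0 _) hp hq1.
  rewrite -/X expr2; clear; lra.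
have hY : cmod Y <= 6 * M ^+ 2 * (enorm v * enorm w).
  have := cmodB_le (2 * x2 * p1 + 2 * x * p12 - p2 * x1) (p * x12).
  have := cmodB_le (2 * x2 * p1 + 2 * x * p12) (p2 * x1).
  have := cmodD (2 * x2 * p1) (2 * x * p12).
  rewrite !cmodM c2 -/Y expr2.
  have := ler_pM (cmod_ge0 _) (cmod_ge0 _) hq2 hp1.
  have := ler_pM (cmod_ge0 _) (cmod_ge0 _) hq hp12.
  have := ler_pM (cmod_ge0 _) (cmod_ge0 _) hp2 hq1.
  have := ler_pM (cmod_ge0 _) (cmod_ge0 _) hp hq12.
  clear; lra.
have MM : M <= M ^+ 2 by rewrite expr2 ler_peMl// ltW.
have e1' : e <= 1 by move: eM e2M eta21; clear; lra.
have hN2 : cmod N2 <= 3 * M ^+ 2 * enorm w.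
  have := cmodB_le (2 * p * p2) (E * x2); rewrite !cmodM c2 cE -/N2.
  have := ler_pM (cmod_ge0 _) (cmod_ge0 _) hp hp2.
  have : e * cmod x2 <= 1 * (M ^+ 2 * enorm w).
    apply: ler_pM => //; [exact: ltW|exact: cmod_ge0|].
    by apply: le_trans hq2 _; rewrite ler_wpM2r.
  rewrite expr2; clear; lra.
have hNu : cmod N <= 2 * M ^+ 2.
  have := cmodB_le (p ^+ 2) (E * x); rewrite -/N cmodX cmodM cE.
  have : cmod p ^+ 2 <= M ^+ 2.
    by apply: lerXn2r => //; rewrite nnegrE ?cmod_ge0// ltW.
  have : e * cmod x <= 1 * M.
    by apply: ler_pM => //; [exact: ltW|exact: cmod_ge0].
  move: MM; clear; lra.
have hPN : eta ^+ 3 / 2 <= cmod (p * N).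
  rewrite cmodM (_ : eta ^+ 3 / 2 = eta * (eta ^+ 2 / 2)); last by field.
  by apply: ler_pM => //; [exact: ltW|rewrite ltW// divr_gt0].
have h30 : 0 < eta ^+ 3 / 2 by rewrite divr_gt0// exprn_gt0.
have h31 : eta ^+ 3 <= 1 by rewrite exprn_ile1// ltW.
have hi : (cmod (p * N))^-1 <= 2 / eta ^+ 3.
  have -> : 2 / eta ^+ 3 = (eta ^+ 3 / 2)^-1 by rewrite invf_div.
  by rewrite lef_pV2 ?posrE// cmodM mulr_gt0.
pose H := 2 / eta ^+ 3.
have H2 : 2 <= H by rewrite ler_pdivlMr ?exprn_gt0// ler_piMr.
pose Z := p2 * N + p * N2.
have hZ : cmod Z <= 5 * M ^+ 3 * enorm w.
  have := cmodD (p2 * N) (p * N2); rewrite !cmodM -/Z.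
  have := ler_pM (cmod_ge0 _) (cmod_ge0 _) hp2 hNu.
  have := ler_pM (cmod_ge0 _) (cmod_ge0 _) hp hN2.
  have -> : M * enorm w * (2 * M ^+ 2) = 2 * (M ^+ 3 * enorm w) by ring.
  have -> : M * (3 * M ^+ 2 * enorm w) = 3 * (M ^+ 3 * enorm w) by ring.
  clear; lra.
have He : e * (21 * M ^+ 5 * H ^+ 2) <= 2 ^- k.
  have -> : H ^+ 2 = 4 / eta ^+ 6.
    by rewrite /H; field; rewrite gt_eqF.
  have -> : 2 ^- k = e3 * (21 * M ^+ 5 * (4 / eta ^+ 6)).
    rewrite /e3; field; rewrite !gt_eqF//= exprn_gt0//.
  have pos : 0 < 21 * M ^+ 5 * (4 / eta ^+ 6).
    apply: mulr_gt0; first by rewrite mulr_gt0// exprn_gt0.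
    by rewrite divr_gt0// exprn_gt0.
  by rewrite ler_pM2r.
have M35 : M ^+ 2 <= M ^+ 5.
  by rewrite (_ : M ^+ 5 = M ^+ 2 * M ^+ 3); [rewrite ler_peMr ?exprn_ege1// exprn_ge0// ltW|ring].
have H1 : 1 <= H by apply: le_trans H2; rewrite ler1n.
have H0 : 0 <= H by exact: le_trans ler01 H1.
have H12 : H <= H ^+ 2 by rewrite expr2 ler_peMl.
have M2p : 0 < M ^+ 2 by rewrite exprn_gt0.
have M5p : 0 < M ^+ 5 by rewrite exprn_gt0.
have M2H : M ^+ 2 * H <= M ^+ 5 * H ^+ 2.
  by apply: ler_pM => //; exact: ltW.
split.
  have -> : (p1 * p + p * p1 + (0 * x + - E * x1)) / (p * p + - E * x) - 2 * (p1 / p) =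
     E * (X / (p * N)).
    by rewrite /X /N; field; rewrite -/N N0 pn0.
  rewrite [cmod (E * _)]cmodM cE [cmod (X / _)]cmodM cmodV.
  have h1 : cmod X * (cmod (p * N))^-1 <= (3 * M ^+ 2 * enorm v) * H.
    by apply: ler_pM; rewrite ?cmod_ge0 ?invr_ge0 ?cmod_ge0.
  have h2 : (3 * M ^+ 2 * enorm v) * H <= (21 * M ^+ 5 * H ^+ 2) * enorm v.
    have -> : 3 * M ^+ 2 * enorm v * H = 3 * (M ^+ 2 * H) * enorm v by ring.
    apply: ler_wpM2r => //; move: M2H (mulr_ge0 (ltW M2p) H0); clear; lra.
  apply: (@le_trans _ _ (e * (21 * M ^+ 5 * H ^+ 2 * enorm v))).
    rewrite ler_pM2l//; exact: le_trans h1 h2.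
  by rewrite mulrA ler_wpM2r.
have -> : (p12 * p + p1 * p2 + (p2 * p1 + p * p12) +
     (0 * x + 0 * x2 + (0 * x1 + - E * x12))) / (p * p + - E * x) -
    (p1 * p + p * p1 + (0 * x + - E * x1)) * (p2 * p + p * p2 + (0 * x + - E * x2)) /
     (p * p + - E * x) ^+ 2 - 2 * (p12 / p - p1 * p2 / p ^+ 2) =
    E * (Y / (p * N) - X * Z / (p * N) ^+ 2).
  by rewrite /Y /X /Z /N2 /N; field; rewrite -/N N0 pn0.
rewrite cmodM cE; apply: (@le_trans _ _ (e * (21 * M ^+ 5 * H ^+ 2 * (enorm v * enorm w)))).
  rewrite ler_pM2l//; apply: le_trans (cmodB_le _ _) _.
  rewrite [cmod (Y / _)]cmodM cmodV [cmod (X * Z / _)]cmodM cmodV [cmod (X * Z)]cmodM cmodX.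
  have hi0 : 0 <= (cmod (p * N))^-1 by rewrite invr_ge0 cmod_ge0.
  have a1 := ler_pM (cmod_ge0 _) hi0 hY hi.
  have a2 := ler_pM (cmod_ge0 _) (cmod_ge0 _) hX hZ.
  have hi2 : (cmod (p * N) ^+ 2)^-1 <= H ^+ 2.
    by rewrite -exprVn; apply: lerXn2r; rewrite ?nnegrE ?invr_ge0 ?cmod_ge0.
  have hi20 : 0 <= (cmod (p * N) ^+ 2)^-1 by rewrite invr_ge0 exprn_ge0 ?cmod_ge0.
  have a3 := ler_pM (mulr_ge0 (cmod_ge0 X) (cmod_ge0 Z)) hi20 a2 hi2.
  have b1 : 6 * M ^+ 2 * (enorm v * enorm w) * H =
    6 * (M ^+ 2 * H * (enorm v * enorm w)) by ring.
  have b3 : 3 * M ^+ 2 * enorm v * (5 * M ^+ 3 * enorm w) * H ^+ 2 =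
    15 * (M ^+ 5 * H ^+ 2 * (enorm v * enorm w)) by ring.
  have b2 : M ^+ 2 * H * (enorm v * enorm w) <= M ^+ 5 * H ^+ 2 * (enorm v * enorm w).
    exact: ler_wpM2r.
  rewrite -/H b1 in a1; rewrite b3 in a3.
  by move: a1 a3 b2; clear; lra.
rewrite [leLHS](_ : _ = e * (21 * M ^+ 5 * H ^+ 2) * (enorm v * enorm w)); last by ring.
exact: ler_wpM2r.
Qed.

End Step.


(** * The sequence of polynomials and the limit set *)

Section Construction.
Variables (R : realType) (n : nat) (i0 : 'I_n).
Local Notation C := (complex R).
Implicit Types (z v w : Cn R n) (k j m : nat).

Definition cratr (a : rat * rat) : C := Complex (ratr a.1) (ratr a.2).

(** The perturbations are the polynomials [z_i * (z_j - a)]. They vanish at the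
    origin, which therefore stays in the limit set, and on a curve through any other
    point one of them has a simple zero close to that point. *)
Definition qexp (x : 'I_n * 'I_n * (rat * rat)) : pexp R n :=
  PM (PX x.1.1) (PA (PX x.1.2) (PC (- cratr x.2))).

(** The additional natural number, which is forgotten, makes every value occur
    infinitely often. *)
Definition qidx k : 'I_n * 'I_n * (rat * rat) :=
  if @unpickle ('I_n * 'I_n * (rat * rat) * nat)%type k is Some x then x.1
  else (i0, i0, (0, 0)).

Definition q_ k := qexp (qidx k).

Lemma qidx_frequent x m : exists2 k, (m <= k)%N & qidx k = x.
Proof.
pose f (l : nat) := pickle (x, l).
have fi : injective f by move=> a b /(pcan_inj (@pickleK _))[].
have fx l : qidx (f l) = x by rewrite /qidx /f pickleK.
suff [l hl] : exists l, (m <= f l)%N by exists (f l).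
apply: contrapT => H.
have H' l : (f l < m)%N by rewrite ltnNge; apply/negP => h; apply: H; exists l.
pose g (l : 'I_m.+1) := Ordinal (H' l).
have gi : injective g by move=> a b [/fi/val_inj].
by have := leq_card g gi; rewrite !card_ord ltnn.
Qed.

Definition eps_of k (P : pexp R n) (eta : R) : R :=
  xget 1 [set e | good_eps k P eta (q_ k) e].

Fixpoint Peta k : pexp R n * R :=
  if k is k'.+1 then
    let: (P, eta) := Peta k' in
    (Pnext P (q_ k') (eps_of k' P eta), eps_of k' P eta * 2 ^- k')
  else (PX i0, 1).

Definition P_ k := (Peta k).1.
Definition eta_ k := (Peta k).2.
Definition eps_ k := eps_of k (P_ k) (eta_ k).

Lemma P_S k : P_ k.+1 = Pnext (P_ k) (q_ k) (eps_ k).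
Proof. by rewrite /eps_ /P_ /eta_ /=; case: (Peta k). Qed.

Lemma eta_S k : eta_ k.+1 = eps_ k * 2 ^- k.
Proof. by rewrite /eps_ /P_ /eta_ /=; case: (Peta k). Qed.

Lemma eps_good_of k : 0 < eta_ k <= 1 -> good_eps k (P_ k) (eta_ k) (q_ k) (eps_ k).
Proof.
move=> /(good_eps_ex k (P_ k) (q_ k))[e he].
by rewrite /eps_ /eps_of; apply: (@xgetPex _ _ [set e | good_eps k _ _ _ e]); exists e.
Qed.

Lemma eta_itv k : 0 < eta_ k <= 1.
Proof.
elim: k => [|k IH]; first by rewrite ltr01 lexx.
have [e0 e1 _ _] := eps_good_of IH; have /andP[h0 h1] := IH.
have p0 : 0 < 2 ^- k :> R by rewrite invr_gt0 exprn_gt0.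
have p1 : 2 ^- k <= 1 :> R by rewrite invf_le1 ?exprn_gt0// exprn_ege1// ler1n.
have h2 : eta_ k ^+ 2 <= 1 by rewrite exprn_ile1// ltW.
rewrite eta_S mulr_gt0//=; apply: le_trans (ler_piMr (ltW e0) p1) _; lra.
Qed.

Lemma eta_gt0 k : 0 < eta_ k. Proof. by case/andP: (eta_itv k). Qed.

Lemma eps_good k : good_eps k (P_ k) (eta_ k) (q_ k) (eps_ k).
Proof. exact: eps_good_of (eta_itv k). Qed.

Lemma eps_gt0 k : 0 < eps_ k. Proof. by case: (eps_good k). Qed.

Lemma exp2V_gt0 k : 0 < 2 ^- k :> R. Proof. by rewrite invr_gt0 exprn_gt0. Qed.

Lemma exp2V_le1 k : 2 ^- k <= 1 :> R.
Proof. by rewrite invf_le1 ?exprn_gt0// exprn_ege1// ler1n. Qed.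

Lemma exp2VS k : 2 ^- k = 2 ^- k.+1 + 2 ^- k.+1 :> R.
Proof. by rewrite exprS; field. Qed.

Lemma eta_S_le k : eta_ k.+1 <= eps_ k.
Proof. by rewrite eta_S ler_piMr ?exp2V_le1// ltW// eps_gt0. Qed.

Lemma pev_P_S k z : pev (P_ k.+1) z = pev (P_ k) z ^+ 2 - ofreal (eps_ k) * pev (q_ k) z.
Proof. by rewrite P_S /= expr2 mulNr. Qed.

Lemma P_0 k : pev (P_ k) 0 = 0.
Proof.
elim: k => [|k IH]; first by rewrite /= mxE.
by rewrite pev_P_S IH /= mxE mul0r mulr0 expr0n subr0.
Qed.

Lemma pdeg_P k : (pdeg (P_ k) <= 2 ^ k)%N.
Proof.
elim: k => [//|k IH]; rewrite P_S /= geq_max addnn -mul2n expnS.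
rewrite leq_mul2l IH orbT /=.
by rewrite (_ : (0 + (1 + maxn 1 0) = 2 * 1)%N)// leq_mul2l expn_gt0.
Qed.

Lemma pert_le k z : enorm z <= k%:R ->
  eps_ k * cmod (pev (q_ k) z) <= eta_ k ^+ 2 / 4.
Proof. by move=> zk; have [_ _ _ /(_ z zk)[]] := eps_good k. Qed.

(** The points of the ball of radius [k] that have escaped at step [k], and hence at
    all later steps. *)
Definition O_ k := [set z : Cn R n | enorm z < k%:R /\ eta_ k < cmod (pev (P_ k) z)].

Lemma P_lower k z : enorm z <= k%:R -> eta_ k < cmod (pev (P_ k) z) ->
  3 / 4 * cmod (pev (P_ k) z) ^+ 2 <= cmod (pev (P_ k.+1) z).
Proof.
move=> zk hP; have h := pert_le zk; rewrite pev_P_S.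
have := cmodB_ge (pev (P_ k) z ^+ 2) (ofreal (eps_ k) * pev (q_ k) z).
rewrite cmodX cmodM cmod_ofreal gtr0_norm ?eps_gt0//.
have : eta_ k ^+ 2 <= cmod (pev (P_ k) z) ^+ 2.
  by apply: lerXn2r; rewrite ?nnegrE ?cmod_ge0 ?(ltW (eta_gt0 k)) ?(ltW hP).
lra.
Qed.

Lemma P_upper k z : enorm z <= k%:R -> eta_ k < cmod (pev (P_ k) z) ->
  cmod (pev (P_ k.+1) z) <= 5 / 4 * cmod (pev (P_ k) z) ^+ 2.
Proof.
move=> zk hP; have h := pert_le zk; rewrite pev_P_S.
have := cmodB_le (pev (P_ k) z ^+ 2) (ofreal (eps_ k) * pev (q_ k) z).
rewrite cmodX cmodM cmod_ofreal gtr0_norm ?eps_gt0//.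
have : eta_ k ^+ 2 <= cmod (pev (P_ k) z) ^+ 2.
  by apply: lerXn2r; rewrite ?nnegrE ?cmod_ge0 ?(ltW (eta_gt0 k)) ?(ltW hP).
lra.
Qed.

(** Above the threshold, the perturbation is at most a quarter of the square, and
    the next threshold is much smaller. *)
Lemma P_escape k z : enorm z <= k%:R -> eta_ k < cmod (pev (P_ k) z) ->
  eta_ k.+1 < cmod (pev (P_ k.+1) z).
Proof.
move=> zk hP; have := P_lower zk hP; have [_ e1 _ _] := eps_good k.
have := eta_S_le k.
have : eta_ k ^+ 2 <= cmod (pev (P_ k) z) ^+ 2.
  by apply: lerXn2r; rewrite ?nnegrE ?cmod_ge0 ?(ltW (eta_gt0 k)) ?(ltW hP).
have : 0 < eta_ k ^+ 2 by rewrite exprn_gt0// eta_gt0.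
lra.
Qed.

Lemma P_escape_le k m z : enorm z <= k%:R -> (k <= m)%N ->
  eta_ k < cmod (pev (P_ k) z) -> eta_ m < cmod (pev (P_ m) z).
Proof.
move=> zk /subnKC <-; elim: (m - k)%N => [|l IH] hk; first by rewrite addn0.
rewrite addnS; apply: P_escape; last exact: IH.
by apply: le_trans zk _; rewrite ler_nat leq_addr.
Qed.

Lemma O_sub k m : (k <= m)%N -> O_ k `<=` O_ m.
Proof.
move=> km z [zk hz]; split; last by apply: P_escape_le hz => //; exact: ltW.
by apply: lt_le_trans zk _; rewrite ler_nat.
Qed.

Lemma open_O k : open (O_ k).
Proof.
rewrite (_ : O_ k = eball k%:R `&` (@cmod R \o pev (P_ k)) @^-1` [set x | eta_ k < x]) //.
apply: openI; first exact: (@open_eball R n k%:R).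
apply: open_comp; last exact: open_gt.
move=> z _; apply: continuous_comp; first exact: pev_continuous.
exact: cmod_continuous.
Qed.

(** The points that never escape; at step [k], only the ball of radius [k] is
    controlled. *)
Definition wset := [set z : Cn R n |
  forall k, enorm z <= k%:R -> cmod (pev (P_ k) z) <= eta_ k].

Lemma not_wset z : ~ wset z <-> exists k, O_ k z.
Proof.
split=> [h|[k [zk hz]] h].
  have [k [zk hz]] : exists k, enorm z <= k%:R /\ eta_ k < cmod (pev (P_ k) z).
    apply: contrapT => H; apply: h => k zk; rewrite leNgt; apply/negP => hz.
    by apply: H; exists k.
  exists k.+1; split; last exact: P_escape.
  by apply: le_lt_trans zk _; rewrite ltr_nat.
by have := h k (ltW zk); rewrite leNgt hz.
Qed.

Lemma wsetC : ~` wset = \bigcup_k O_ k.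
Proof.
apply/seteqP; split=> z; first by move/not_wset => [k hk]; exists k.
by move=> [k _ hk]; apply/not_wset; exists k.
Qed.

Lemma closed_wset : closed wset.
Proof.
rewrite -openC wsetC; apply: bigcup_open => k _; exact: open_O.
Qed.

Lemma wset_0 : wset 0.
Proof. by move=> k _; rewrite P_0 cmod0 ltW// eta_gt0. Qed.

(** The sets [O_ k] form an increasing open cover of the complement. *)
Lemma compact_O (K : set (Cn R n)) : compact K -> K `<=` ~` wset ->
  exists k, K `<=` O_ k.
Proof.
move=> cK; rewrite wsetC => KO.
move: cK; rewrite compact_cover => /(_ nat setT O_ (fun k _ => @open_O k) KO).
move=> [D _ hD]; pose m := \max_(k <- finmap.enum_fset D) k.
exists m => z /hD[k /= kD hk]; apply: O_sub hk.
by apply: leq_bigmax_seq.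
Qed.

End Construction.

Section RealContinuity.
Variables (R : realType) (X : topologicalType).
Implicit Types (f g : X -> R) (c : R) (x : X).

Lemma continuous_mulc f c x : {for x, continuous f} ->
  {for x, continuous (fun y => c * f y)}.
Proof. by move=> cf; apply: cvgM => //; exact: cvg_cst. Qed.

Lemma continuous_addc f c x : {for x, continuous f} ->
  {for x, continuous (fun y => f y + c)}.
Proof. by move=> cf; apply: cvgD => //; exact: cvg_cst. Qed.

Lemma continuous_ln_comp f x : {for x, continuous f} -> 0 < f x ->
  {for x, continuous (fun y => ln (f y))}.
Proof.
by move=> cf f0; apply: (@continuous_comp _ _ _ f (@ln R)) => //; exact: continuous_ln.
Qed.

Lemma continuous_cmod_comp (h : X -> Cx R) x : {for x, continuous h} ->
  {for x, continuous (fun y => cmod (h y))}.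
Proof.
by move=> cf; apply: (@continuous_comp _ _ _ h (@cmod R)) => //; exact: cmod_continuous.
Qed.

End RealContinuity.

(** * The potential *)

Section Potential.
Variables (R : realType) (n : nat) (i0 : 'I_n).
Local Notation C := (complex R).
Local Notation P_ := (@P_ R n i0).
Local Notation eta_ := (@eta_ R n i0).
Local Notation eps_ := (@eps_ R n i0).
Local Notation O_ := (@O_ R n i0).
Local Notation wset := (@wset R n i0).
Implicit Types (z v w : Cn R n) (k j m : nat).

(** The functions [u_ k] are plurisubharmonic and decrease with [k], where [k] is at
    least the norm; the [l_ k] are pluriharmonic where [P_ k] has no zeros and
    converge fast off the limit set. *)
Definition u_ k z : R := 2 ^- k * ln (cmod (pev (P_ k) z) + eta_ k).

Definition l_ k z : R := 2 ^- k * ln (cmod (pev (P_ k) z)).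

Definition phi z : \bar R :=
  ereal_inf [set (u_ k z)%:E | k in [set k | enorm z <= k%:R]].

Lemma Pe_gt0 k z : 0 < cmod (pev (P_ k) z) + eta_ k.
Proof. by rewrite ltr_wpDl ?cmod_ge0 ?eta_gt0. Qed.

Lemma u_continuous k : continuous (u_ k).
Proof.
move=> z; apply: (@continuous_mulc R _ (fun z => ln (cmod (pev (P_ k) z) + eta_ k))).
apply: continuous_ln_comp; last exact: Pe_gt0.
by apply: continuous_addc; apply: continuous_cmod_comp; exact: pev_continuous.
Qed.

(** As [eta_ k.+1 <= eps_ k] and [eps_ k <= eta_ k ^+ 2 / 4], passing from
    [cmod (P_ k) + eta_ k] to the next step at most squares it. *)
Lemma u_S_le k z : enorm z <= k%:R -> u_ k.+1 z <= u_ k z.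
Proof.
move=> zk; rewrite /u_ [leRHS](_ : _ =
    2 ^- k.+1 * (2 * ln (cmod (pev (P_ k) z) + eta_ k))); last first.
  by rewrite (exp2VS R k); ring.
rewrite ler_pM2l ?exp2V_gt0// mulr_natl.
rewrite -lnXn ?Pe_gt0// ler_ln ?posrE ?exprn_gt0 ?Pe_gt0//.
have h := pert_le i0 zk; have [_ e1 _ _] := eps_good R i0 k.
have e2 := eta_S_le R i0 k.
rewrite pev_P_S.
have := cmodB_le (pev (P_ k) z ^+ 2) (ofreal (eps_ k) * pev (q_ R i0 k) z).
rewrite cmodX cmodM cmod_ofreal gtr0_norm ?eps_gt0//.
have := mulr_ge0 (cmod_ge0 (pev (P_ k) z)) (ltW (eta_gt0 R i0 k)).
have := sqr_ge0 (eta_ k).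
rewrite sqrrD; lra.
Qed.

Lemma u_le k m z : enorm z <= k%:R -> (k <= m)%N -> u_ m z <= u_ k z.
Proof.
move=> zk /subnKC <-; elim: (m - k)%N => [|l IH]; first by rewrite addn0.
rewrite addnS; apply: le_trans IH; apply: u_S_le.
by apply: le_trans zk _; rewrite ler_nat leq_addr.
Qed.

Lemma phi_le_u k z : enorm z <= k%:R -> (phi z <= (u_ k z)%:E)%E.
Proof. by move=> zk; apply: ereal_inf_lbound; exists k. Qed.

Lemma norm_lt_nat z : exists k, enorm z < k%:R.
Proof. by exists (Num.bound (enorm z)); apply: archi_boundP; exact: enorm_ge0. Qed.

Lemma phi_lty z : (phi z < +oo)%E.
Proof.
have [k zk] := norm_lt_nat z.
by apply: le_lt_trans (phi_le_u (ltW zk)) _; rewrite ltry.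
Qed.

Lemma phi_usc : usc_on setT phi.
Proof.
move=> z _ c zc.
have [k zk uc] : exists2 k, enorm z < k%:R & u_ k z < c.
  move: zc => /ereal_inf_lt[_ [k zk <-]]; rewrite lte_fin => uc.
  exists k.+1; last by apply: le_lt_trans uc; exact: u_S_le.
  by apply: le_lt_trans zk _; rewrite ltr_nat.
have h1 : \forall w \near z, u_ k w < c.
  exact: (@u_continuous k z _ (@lt_nbhsl _ _ _ uc)).
have h2 : \forall w \near z, enorm w < k%:R.
  exact: (@enorm_continuous R n z _ (@lt_nbhsl _ _ _ zk)).
apply: filterS2 h1 h2 => w uw wk.
by apply: le_lt_trans (phi_le_u (ltW wk)) _; rewrite lte_fin.
Qed.

(** The factor [expR (- 2 ^+ k.+2)] in the bound on [eps_ k] lowers the left hand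
    side by [4 * 2 ^+ k / 2 ^+ k.+1 = 2] at each step. *)
Lemma ln_eta_le k : 2 ^- k * ln (eta_ k) <= - (2 * k%:R).
Proof.
elim: k => [|k IH]; first by rewrite ln1 mulr0 mulr0 oppr0.
have [_ _ e1 _] := eps_good R i0 k.
have h : eta_ k.+1 <= eta_ k ^+ 2 * expR (- 2 ^+ k.+2).
  exact: le_trans (eta_S_le R i0 k) e1.
have {}h : ln (eta_ k.+1) <= 2 * ln (eta_ k) - 2 ^+ k.+2.
  have -> : 2 * ln (eta_ k) - 2 ^+ k.+2 = ln (eta_ k ^+ 2 * expR (- 2 ^+ k.+2)).
    by rewrite lnM ?posrE ?exprn_gt0 ?eta_gt0 ?expR_gt0// expRK lnXn ?eta_gt0// mulr_natl.
  by rewrite ler_ln ?posrE ?eta_gt0// mulr_gt0 ?exprn_gt0 ?eta_gt0 ?expR_gt0.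
apply: (@le_trans _ _ (2 ^- k.+1 * (2 * ln (eta_ k) - 2 ^+ k.+2))).
  by rewrite ler_pM2l ?exp2V_gt0.
have -> : 2 ^- k.+1 * (2 * ln (eta_ k) - 2 ^+ k.+2) = 2 ^- k * ln (eta_ k) - 2.
  rewrite !exprS; field; by rewrite expf_neq0.
by rewrite -natr1; lra.
Qed.

Lemma ln2_le1 : ln (2 : R) <= 1.
Proof. by have := @le_ln1Dx R 1; rewrite (_ : 1 + 1 = 2)//; apply; lra. Qed.

Lemma phi_wset z : wset z -> phi z = -oo%E.
Proof.
move=> Ez; suff H (y : R) : (phi z <= y%:E)%E.
  move: H (phi_lty z); case: (phi z) => [r H _|_|//]; last by rewrite ltxx.
  by have := H (r - 1)%R; rewrite lee_fin lerBrDr gerDl ler10.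
have [k zk] := norm_lt_nat z.
have [m ym] : exists m : nat, - y + 1 < m%:R.
  exists (Num.bound (`|y| + 1)); apply: le_lt_trans (archi_boundP _) => //.
  by rewrite lerD2r -normrN ler_norm.
have zM : enorm z <= (maxn k m)%:R.
  by rewrite ltW// (lt_le_trans zk)// ler_nat leq_maxl.
apply: le_trans (phi_le_u zM) _; rewrite lee_fin /u_.
set M := maxn k m in zM *.
apply: (@le_trans _ _ (2 ^- M * ln (2 * eta_ M))).
  rewrite ler_pM2l ?exp2V_gt0// ler_ln ?posrE ?Pe_gt0// ?mulr_gt0 ?eta_gt0//.
  by rewrite mulr_natl mulr2n lerD2r; exact: Ez.
rewrite lnM ?posrE ?eta_gt0// mulrDr.
have h1 := ln_eta_le M.
have h2 : 2 ^- M * ln (2 : R) <= 1.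
  have l0 : 0 <= ln (2 : R) by rewrite ln_ge0// ler1n.
  have := ler_pM (ltW (exp2V_gt0 R M)) l0 (exp2V_le1 R M) ln2_le1; lra.
have h3 : m%:R <= M%:R :> R by rewrite ler_nat leq_maxr.
have h4 := ler0n R m; lra.
Qed.

Lemma ln_ge_sub1 (x : R) : 0 < x -> 1 - x^-1 <= ln x.
Proof.
move=> x0; have x1 : 0 < x^-1 by rewrite invr_gt0.
have := @le_ln1Dx R (x^-1 - 1).
rewrite (_ : 1 + (x^-1 - 1) = x^-1); last by ring.
rewrite lnV ?posrE// => h; have {}h := h ltac:(lra); lra.
Qed.

(** Off the set, [cmod (P_ k.+1)] lies between [3 / 4] and [5 / 4] of the square of
    [cmod (P_ k)]. *)
Lemma l_step k z : O_ k z -> `|l_ k.+1 z - l_ k z| <= 2 ^- k.+1.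
Proof.
move=> [/ltW zk hP].
have p0 : 0 < cmod (pev (P_ k) z) by apply: lt_trans hP; exact: eta_gt0.
have p20 : 0 < cmod (pev (P_ k) z) ^+ 2 by rewrite exprn_gt0.
have hl := P_lower zk hP; have hu := P_upper zk hP.
have p1 : 0 < cmod (pev (P_ k.+1) z) by apply: lt_le_trans hl; rewrite mulr_gt0.
have -> : l_ k.+1 z - l_ k z =
    2 ^- k.+1 * (ln (cmod (pev (P_ k.+1) z)) - ln (cmod (pev (P_ k) z) ^+ 2)).
  rewrite /l_ lnXn// exprS mulr2n; field; by rewrite expf_neq0.
rewrite normrM gtr0_norm ?exp2V_gt0// ler_piMr ?(ltW (exp2V_gt0 R _))//.
set a := cmod (pev (P_ k.+1) z) in hl hu p1 *.
set b := cmod _ ^+ 2 in hl hu p20 *.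
have b' : 0 < 3 / 4 * b by rewrite mulr_gt0.
have h1 : ln (3 / 4 * b) <= ln a by rewrite ler_ln.
have h2 : ln a <= ln (5 / 4 * b) by rewrite ler_ln ?posrE// mulr_gt0.
rewrite lnM ?posrE// in h1; rewrite lnM ?posrE// in h2.
have := @ln_ge_sub1 (3 / 4) ltac:(lra); rewrite invf_div => h3.
have h4 : ln (5 / 4 : R) <= 1.
  have := @le_ln1Dx R (1 / 4); rewrite (_ : 1 + 1 / 4 = 5 / 4); last by field.
  by move=> h; have := h ltac:(lra); lra.
by rewrite ler_norml; apply/andP; split; lra.
Qed.

Lemma l_cauchy k m z : O_ k z -> (k <= m)%N -> `|l_ m z - l_ k z| <= 2 ^- k - 2 ^- m.
Proof.
move=> Oz /subnKC <-; elim: (m - k)%N => [|j IH].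
  by rewrite addn0 !subrr normr0.
have Oj : O_ (k + j) z by apply: O_sub Oz; exact: leq_addr.
have := l_step Oj; rewrite -addnS; move: IH; rewrite (exp2VS R (k + j)) -addnS.
set a := l_ (k + j) z; set b := l_ (k + j.+1) z; set c := l_ k z => h1 h2.
have := ler_normD (b - a) (a - c); rewrite addrA subrK; lra.
Qed.

Lemma u_l k z : eta_ k < cmod (pev (P_ k) z) -> l_ k z <= u_ k z <= l_ k z + 2 ^- k.
Proof.
move=> hP; have p0 : 0 < cmod (pev (P_ k) z) by apply: lt_trans hP; exact: eta_gt0.
have e0 := eta_gt0 R i0 k.
apply/andP; split.
  by rewrite /l_ /u_ ler_pM2l ?exp2V_gt0// ler_ln ?posrE ?Pe_gt0// lerDl ltW.
rewrite /l_ /u_ -[X in _ <= _ + X]mulr1 -mulrDr ler_pM2l ?exp2V_gt0//.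
apply: (@le_trans _ _ (ln (cmod (pev (P_ k) z) * 2))).
  rewrite ler_ln ?posrE ?Pe_gt0 ?mulr_gt0// mulr_natr mulr2n lerD2l ltW//.
by rewrite lnM ?posrE// lerD2l ln2_le1.
Qed.

Lemma phi_l_bounds k z : O_ k z ->
  ((l_ k z - 2 ^- k)%:E <= phi z <= (l_ k z + 2 ^- k)%:E)%E.
Proof.
move=> Oz; have [/ltW zk hP] := Oz; apply/andP; split; last first.
  apply: le_trans (phi_le_u zk) _; rewrite lee_fin.
  by have /andP[] := u_l hP.
apply/ereal_infP => _ [m /= zm <-]; rewrite lee_fin.
pose M := maxn k m.
have OM : O_ M z by apply: O_sub Oz; exact: leq_maxl.
have h1 : u_ M z <= u_ m z by apply: u_le => //; exact: leq_maxr.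
have /andP[h2 _] := u_l OM.2.
have := l_cauchy Oz (leq_maxl k m); rewrite -/M ler_norml => /andP[h3 _].
have := exp2V_gt0 R M; lra.
Qed.

Lemma phi_fin k z : O_ k z -> phi z \is a fin_num.
Proof.
move=> /phi_l_bounds/andP[h1 h2]; rewrite fin_numE; apply/andP; split.
  by apply/eqP => h; rewrite h in h1.
by apply/eqP => h; rewrite h in h2.
Qed.

Lemma phi_l k z : O_ k z -> `|fine (phi z) - l_ k z| <= 2 ^- k.
Proof.
move=> Oz; have := phi_l_bounds Oz; rewrite -(fineK (phi_fin Oz)) !lee_fin.
by move=> /andP[h1 h2]; rewrite ler_norml; apply/andP; split; lra.
Qed.

Lemma wset_phi : wset = [set z | phi z = -oo%E].
Proof.
apply/seteqP; split=> z; first exact: phi_wset.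
move=> /= pz; apply: contrapT => /not_wset[k /phi_fin]; by rewrite pz.
Qed.

End Potential.

(** * Plurisubharmonicity *)

Lemma exp2V_small (R : realType) (x e : R) : 0 <= x -> 0 < e ->
  exists j, forall m, (j <= m)%N -> x * 2 ^- m < e.
Proof.
move=> x0 e0; exists (Num.bound (x / e)) => m jm.
have h1 : x / e < (Num.bound (x / e))%:R by apply: archi_boundP; rewrite divr_ge0// ltW.
have h2 : (Num.bound (x / e))%:R <= 2 ^+ m :> R.
  by rewrite -natrX ler_nat (leq_trans jm)// ltnW// ltn_expl.
rewrite ltr_pdivrMr ?exprn_gt0//; rewrite ltr_pdivrMr// in h1.
by apply: lt_le_trans h1 _; rewrite mulrC ler_pM2l.
Qed.

Section DecreasingLimit.
Variable R : realType.
Local Notation mu := (@lebesgue_measure R).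

(** Monotone convergence for the nonnegative functions [g 0 - g k]; the limit may
    take the value [-oo]. *)
Lemma le_integral_decreasing (g : nat -> R -> R) (f : R -> \bar R) (x a b : R) :
  (forall k, continuous (g k)) ->
  (forall t k m, (k <= m)%N -> g m t <= g k t) ->
  (forall t, f t = ereal_inf (range (fun k => (g k t)%:E))) ->
  (forall k, x <= J (g k) a b) ->
  (x%:E <= \int[mu]_(t in `[a, b]) f t)%E.
Proof.
move=> cg dg fE hx.
pose h k t : \bar R := (g 0 t - g k t)%:E.
pose H t := ((g 0 t)%:E - f t)%E.
have cvgf t : (g k t)%:E @[k --> \oo] --> f t.
  rewrite fE; apply: ereal_nonincreasing_cvgn => k m km.
  by rewrite lee_fin dg.
have cvgh t : h k t @[k --> \oo] --> H t.
  rewrite (_ : h^~ t = fun k => ((g 0 t)%:E - (g k t)%:E)%E)//.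
  apply: cvgeB; [exact: fin_num_adde_defr|exact: cvg_cst|exact: cvgf].
have mg k : measurable_fun (`[a, b]%classic : set R) (g k).
  by apply/measurable_EFinP; exact: measurable_int (continuous_integrable a b (cg k)).
have mh k : measurable_fun (`[a, b]%classic : set R) (h k).
  by apply/measurable_EFinP; exact: measurable_funB.
have h0 k t : (0 <= h k t)%E by rewrite lee_fin subr_ge0 dg.
have hnd t : nondecreasing_seq (h^~ t).
  by move=> k m km; rewrite lee_fin lerD2l lerN2 dg.
have HE : (\int[mu]_(t in `[a, b]) H t =
    limn (fun k => \int[mu]_(t in `[a, b]) h k t))%E.
  rewrite -monotone_convergence//.
  by apply: eq_integral => t _; apply/esym/cvg_lim => //; exact: cvgh.
have ih k : (\int[mu]_(t in `[a, b]) h k t = (J (g 0) a b - J (g k) a b)%:E)%E.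
  rewrite EFinB /J /Rintegral !fineK; last 2 first.
  - exact: integrable_fin_num (continuous_integrable a b (cg k)).
  - exact: integrable_fin_num (continuous_integrable a b (cg 0)).
  by rewrite -integralB_EFin//; apply: continuous_integrable.
have HB : (\int[mu]_(t in `[a, b]) H t <= (J (g 0) a b - x)%:E)%E.
  rewrite HE; apply: lime_le.
    apply: ereal_nondecreasing_is_cvgn => k m km.
    apply: ge0_le_integral => //; [exact: mh|exact: mh|].
    by move=> t _; exact: hnd.
  by apply: nearW => k; rewrite ih lee_fin lerD2l lerN2.
have H0 t : (0 <= H t)%E.
  by rewrite -(cvg_lim _ (cvgh t))//; apply: lime_ge; [apply: cvgP (cvgh t)|exact: nearW].
have mH : measurable_fun (`[a, b]%classic : set R) H.
  by apply: (emeasurable_fun_cvg _ _ mh) => t _; exact: cvgh.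
have iH : mu.-integrable `[a, b] H.
  apply/integrableP; split => //.
  under eq_integral do rewrite gee0_abs//.
  by apply: le_lt_trans HB _; rewrite ltry.
have fH t : f t = ((g 0 t)%:E - H t)%E.
  by rewrite /H oppeB ?fin_num_adde_defr// addeA subee// add0e.
under eq_integral do rewrite fH.
have ig : mu.-integrable `[a, b] (EFin \o g 0) by exact: continuous_integrable.
rewrite (@integralB _ _ _ mu `[a, b]%classic _ (EFin \o g 0) H ig iH)//.
have -> : (\int[mu]_(t in `[a, b]) (EFin \o g 0%N) t = (J (g 0%N) a b)%:E)%E.
  by rewrite /J /Rintegral fineK//; exact: integrable_fin_num ig.
rewrite leeBrDr; last exact: integrable_fin_num iH.
by rewrite -leeBrDl// -EFinB.
Qed.

End DecreasingLimit.

Section Psh.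
Variables (R : realType) (n : nat) (i0 : 'I_n).
Local Notation C := (complex R).
Local Notation P_ := (@P_ R n i0).
Local Notation eta_ := (@eta_ R n i0).
Local Notation O_ := (@O_ R n i0).
Local Notation wset := (@wset R n i0).
Local Notation phi := (@phi R n i0).
Local Notation u_ := (@u_ R n i0).
Local Notation l_ := (@l_ R n i0).
Local Notation T := (pi *+ 2 : R).
Local Notation mu := (@lebesgue_measure R).
Implicit Types (z v w : Cn R n) (k j m : nat) (g : 'I_n -> {poly C}) (c : Cx R) (r : R).

(** Polynomial discs rather than lines only: parabolic discs are needed to approach
    a point of the set from outside. *)
Definition pdisc g c : Cn R n := \row_i ((g i).[c] : Cx R).

Lemma pev_pdisc t g c : pev t (pdisc g c) = (pcomp g t).[c].
Proof. by rewrite horner_pcomp. Qed.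

Lemma pdisc_continuous g : continuous (pdisc g).
Proof.
move=> c A /nbhs_Cn[e e0 he].
have n0 : (0 < n)%N by case: (n) i0 => // -[].
pose d := e / (2 * n%:R).
have d0 : 0 < d by rewrite divr_gt0// mulr_gt0// ltr0n.
have H : \forall y \near c, forall i, cmod ((g i).[y] - (g i).[c] : Cx R) < d.
  apply: (@filter_forall _ 'I_n (fun i (y : Cx R) => cmod ((g i).[y] - (g i).[c] : Cx R) < d)
    (nbhs c) (nbhs_filter c)) => i.
  have := @horner_continuous R (g i) c.
  move/(_ [set y | cmod (y - (g i).[c] : Cx R) < d]); apply.
  by apply/nbhs_Cx; exists d.
apply: (@filterS _ (nbhs c) (nbhs_filter c) _ _ _ H) => y hy; apply: he.
apply: le_lt_trans (enorm_le_sum _) _.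
apply: (@le_lt_trans _ _ (\sum_(i < n) d)).
  by apply: ler_sum => i _; rewrite !mxE ltW.
rewrite sumr_const card_ord -mulr_natr /d invfM mulrA -mulrA mulVf ?pnatr_eq0 ?lt0n_neq0//.
by rewrite mulr1; lra.
Qed.

Definition gline (a b : Cn R n) : 'I_n -> {poly C} :=
  fun i => (a 0 i : C)%:P + (b 0 i : C) *: 'X.

Lemma line_pdisc a b : line a b = pdisc (gline a b).
Proof.
apply/funext => c; apply/rowP => i; rewrite !mxE /gline !hornerE.
by rewrite mulrC.
Qed.

Lemma size_gline a b i : (size (gline a b i) <= 2)%N.
Proof.
apply: leq_trans (size_polyD _ _) _; rewrite geq_max.
rewrite (leq_trans (size_polyC_leq1 _))//=.
by apply: leq_trans (size_scale_leq _ _) _; rewrite size_polyX.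
Qed.

Lemma circle_continuous g c r : continuous (fun t => pdisc g (circle_point c r t)).
Proof.
move=> t; apply: (@continuous_comp _ _ _ (circle_point c r) (pdisc g)).
  exact: circle_point_continuous.
exact: pdisc_continuous.
Qed.

(** At a given point, [cmod P + eta] is the modulus of the polynomial [P + eta * s]
    for a suitable constant [s] of modulus one, and it is at least this modulus
    everywhere: Jensen's inequality for [P + eta * s] applies. *)
Lemma u_mean g c r k : 0 < r ->
  T * u_ k (pdisc g c) <= J (fun t => u_ k (pdisc g (circle_point c r t))) 0 T.
Proof.
move=> r0; set p := pcomp g (P_ k).
have [s s1 hs] : exists2 s : Cx R, cmod s = 1 &
    cmod (p.[c] + ofreal (eta_ k) * s) = cmod p.[c] + eta_ k.
  have [p0|p0] := eqVneq (p.[c] : Cx R) 0.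
    exists 1; first exact: cmod1.
    by rewrite p0 add0r cmod0 add0r mulr1 cmod_ofreal gtr0_norm// eta_gt0.
  exists (p.[c] / ofreal (cmod p.[c])).
    by rewrite cmodM cmodV cmod_ofreal gtr0_norm ?cmod_gt0// divff// gt_eqF ?cmod_gt0.
  have pc0 : 0 < cmod p.[c] by rewrite cmod_gt0.
  have q0 : ofreal (cmod p.[c]) != 0.
    by rewrite -cmod_gt0 cmod_ofreal gtr0_norm.
  have -> : p.[c] + ofreal (eta_ k) * (p.[c] / ofreal (cmod p.[c])) =
      p.[c] * ofreal (1 + eta_ k / cmod p.[c]).
    rewrite -[ofreal (1 + _)]/(real_complex R _) rmorphD rmorph1 rmorphM fmorphV /=.
    by rewrite mulrDr mulr1 mulrCA.
  rewrite cmodM cmod_ofreal gtr0_norm.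
    by field; rewrite gt_eqF.
  by rewrite addr_gt0// divr_gt0// eta_gt0.
pose h := p + (ofreal (eta_ k) * s : C)%:P.
have hE x : h.[x] = p.[x] + ofreal (eta_ k) * s by rewrite hornerD hornerC.
have hc0 : 0 < cmod h.[c].
  by rewrite hE hs ltr_wpDl ?cmod_ge0 ?eta_gt0.
pose v t := cmod p.[circle_point c r t] + eta_ k.
have v0 t : 0 < v t by rewrite ltr_wpDl ?cmod_ge0 ?eta_gt0.
have cv : continuous v.
  move=> t; have ch := continuous_comp (@circle_point_continuous R c r t)
    (@horner_continuous R p (circle_point c r t)).
  exact: continuous_addc (continuous_cmod_comp ch).
have hv t : cmod h.[circle_point c r t] <= v t.
  rewrite hE; apply: le_trans (cmodD _ _) _.
  by rewrite cmodM s1 mulr1 cmod_ofreal gtr0_norm ?eta_gt0.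
have hcn : h.[c] != 0 by rewrite -cmod_gt0.
have := Jensen_le r0 hcn cv v0 hv; rewrite hE hs => H.
have -> : J (fun t => u_ k (pdisc g (circle_point c r t))) 0 T =
    2 ^- k * J (fun t => ln (v t)) 0 T.
  rewrite /J -RintegralZl//; last first.
    by apply: continuous_integrable => t; exact: continuous_ln_comp (cv t) (v0 t).
  by apply: eq_Rintegral => t _; rewrite /u_ pev_pdisc.
rewrite /u_ pev_pdisc mulrCA ler_pM2l ?exp2V_gt0//.
Qed.

Lemma bounded_circle g c r : 0 < r -> exists N : nat,
  forall t, enorm (pdisc g (circle_point c r t)) <= N%:R.
Proof.
move=> r0; pose D := [set x : Cx R | cmod x <= r].
have D0 : D !=set0 by exists 0; rewrite /D /= cmod0 ltW.
have [|x _ hx] := @compact_EVT_max _ R (fun x => enorm (pdisc g (x + c))) D D0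
    (@compact_disc R r).
  apply: continuous_subspaceT => x.
  apply: (@continuous_comp _ _ _ (fun x : Cx R => pdisc g (x + c)) (@enorm R n)).
    apply: (@continuous_comp _ _ _ (fun x : Cx R => x + c : Cx R) (pdisc g)).
      exact: (cvgD cvg_id (@cst_continuous (Cx R) (Cx R) c x)).
    exact: pdisc_continuous.
  exact: enorm_continuous.
have [N hN] := norm_lt_nat (pdisc g (x + c)).
exists N => t; apply: le_trans (ltW hN); rewrite -[circle_point c r t](subrK c).
by apply: hx; apply/mem_set; rewrite /D /= cmod_circle_point.
Qed.

(** From some [k] on, the functions [u_ k] decrease to [phi] on the whole circle and
    at its center. *)
Lemma phi_mean g c r : 0 < r ->
  (phi (pdisc g c) <= circle_mean (phi \o pdisc g) c r)%E.
Proof.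
move=> r0; have T0 := T_gt0 R.
have [N hN] := bounded_circle g c r0.
have [N' hN'] := norm_lt_nat (pdisc g c).
pose M := maxn N N'.
have hM t : enorm (pdisc g (circle_point c r t)) <= M%:R.
  by apply: le_trans (hN t) _; rewrite ler_nat leq_maxl.
have [->|] := eqVneq (phi (pdisc g c)) -oo%E; first exact: leNye.
move: (phi_lty i0 (pdisc g c)); case E : (phi (pdisc g c)) => [y||//] // _ _.
have key : ((T * y)%:E <= \int[mu]_(t in `[0%R, T]) phi (pdisc g (circle_point c r t)))%E.
  apply: (@le_integral_decreasing _ (fun k t => u_ (M + k) (pdisc g (circle_point c r t)))).
  - move=> k t; apply: (@continuous_comp _ _ _
      (fun t => pdisc g (circle_point c r t)) (u_ (M + k))).
      exact: circle_continuous.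
    exact: u_continuous.
  - move=> t k m km; apply: u_le; last by rewrite leq_add2l.
    by apply: le_trans (hM t) _; rewrite ler_nat leq_addr.
  - move=> t; apply/le_anti/andP; split.
      apply/ereal_infP => _ [k _ <-]; apply: phi_le_u.
      by apply: le_trans (hM t) _; rewrite ler_nat leq_addr.
    apply/ereal_infP => _ [k /= zk <-].
    apply: (@le_trans _ _ (u_ (M + k) (pdisc g (circle_point c r t)))%:E).
      by apply: ereal_inf_lbound; exists k.
    by rewrite lee_fin u_le// leq_addl.
  - move=> k; apply: le_trans (u_mean _ _ _ r0); rewrite ler_pM2l// -lee_fin -E.
    apply: phi_le_u; apply: (le_trans (ltW hN')).
    by rewrite ler_nat (leq_trans (leq_maxr N N'))// leq_addr.
rewrite /circle_mean.
have E2 : 2 * pi = T :> R by rewrite mulr_natl.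
rewrite E2; have Ti : (0 <= (T^-1)%:E)%E by rewrite lee_fin invr_ge0 ltW.
have := lee_wpmul2l Ti key; rewrite -EFinM mulrA mulVf ?mul1r ?gt_eqF//.
Qed.

Lemma phi_psh : plurisubharmonic setT phi.
Proof.
split=> [z _||a b]; [exact: phi_lty|exact: phi_usc|].
rewrite line_pdisc; split=> [z _|z _ c zc|c r r0 _]; [exact: phi_lty| |].
- have h := phi_usc I zc.
  exact: (@pdisc_continuous (gline a b) z _ h).
- exact: phi_mean.
Qed.

(** As each [O_ j] is open, the convergence is locally uniform off the set. This
    serves for [phi] and for its derivatives. *)
Lemma continuous_rate (F : Cn R n -> R) (f : nat -> Cn R n -> R) (A : R) z :
  0 <= A -> ~ wset z -> (forall j w, O_ j w -> `|F w - f j w| <= A * 2 ^- j) ->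
  (forall j, O_ j z -> {for z, continuous (f j)}) -> {for z, continuous F}.
Proof.
move=> A0 /not_wset[k Oz] hF cf; apply: continuous_CnP => e e0.
have [j hj] := @exp2V_small R (4 * A) e ltac:(lra) e0.
have {}hj : 4 * A * 2 ^- (k + j) < e by apply: hj; exact: leq_addl.
have Oj : O_ (k + j) z by apply: O_sub Oz; exact: leq_addr.
have : \forall w \near z, O_ (k + j) w by exact: (@open_O R n i0 (k + j)).
move=> /nbhs_Cn[d1 d10 hd1].
have : \forall w \near z, `|f (k + j) z - f (k + j) w| < e / 2.
  have h : nbhs (f (k + j) z) (ball (f (k + j) z) (e / 2)).
    by apply: nbhsx_ballx; rewrite divr_gt0.
  by have := cf _ Oj _ h; rewrite -ball_normE.
move=> /nbhs_Cn[d2 d20 hd2].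
exists (Num.min d1 d2); first by rewrite lt_min d10 d20.
move=> w; rewrite lt_min => /andP[/hd1 Ow /hd2 lw] /=.
have h1 := hF _ _ Oj; have h2 := hF _ _ Ow.
have -> : F z - F w = (F z - f (k + j) z) + (f (k + j) z - f (k + j) w)
   - (F w - f (k + j) w) by ring.
apply: le_lt_trans (ler_normB _ _) _.
have := ler_normD (F z - f (k + j) z) (f (k + j) z - f (k + j) w).
lra.
Qed.

Lemma P_neq0 k z : O_ k z -> pev (P_ k) z != 0.
Proof. by move=> [_ h]; rewrite -cmod_gt0; apply: lt_trans h; exact: eta_gt0. Qed.

Lemma phi_continuous z : ~ wset z -> {for z, continuous (fine \o phi)}.
Proof.
move=> Ez; apply: (@continuous_rate _ l_ 1) => // [j w Ow|j Oz].
  by rewrite mul1r; exact: phi_l.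
apply: (@continuous_mulc R _ (fun z => ln (cmod (pev (P_ j) z)))).
apply: continuous_ln_comp; last by rewrite cmod_gt0 P_neq0.
by apply: continuous_cmod_comp; exact: pev_continuous.
Qed.

(** The disc is compact, hence contained in some [O_ k]: there [phi] is the uniform
    limit of the [l_ j], and [P_ j] has no zeros. *)
Lemma phi_mean_eq g c r : 0 < r ->
  (forall x, cmod (x - c) <= r -> ~ wset (pdisc g x)) ->
  J (fun t => fine (phi (pdisc g (circle_point c r t)))) 0 T =
  T * fine (phi (pdisc g c)).
Proof.
move=> r0 hE; have T0 := T_gt0 R.
have cK : compact (pdisc g @` ((fun x : Cx R => x + c) @` [set x | cmod x <= r])).
  apply: continuous_compact; first by apply: continuous_subspaceT; exact: pdisc_continuous.
  apply: continuous_compact; last exact: compact_disc.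
  by apply: continuous_subspaceT => x; exact: (cvgD cvg_id (@cst_continuous (Cx R) (Cx R) c x)).
have [k hk] : exists k, pdisc g @` ((fun x : Cx R => x + c) @` [set x | cmod x <= r]) `<=` O_ k.
  apply: compact_O => // _ [_ [x /= xr <-] <-].
  by apply: hE; rewrite addrK.
have {}hk x : cmod (x - c) <= r -> O_ k (pdisc g x).
  move=> xr; apply: hk; exists x => //; exists (x - c) => //; exact: subrK.
have on_circle t : O_ k (pdisc g (circle_point c r t)).
  by apply: hk; rewrite cmod_circle_point.
have Oc : O_ k (pdisc g c) by apply: hk; rewrite subrr cmod0 ltW.
have cphi : continuous (fun t => fine (phi (pdisc g (circle_point c r t)))).
  move=> t; apply: (@continuous_comp _ _ _
      (fun t => pdisc g (circle_point c r t)) (fine \o phi)).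
    exact: circle_continuous.
  by apply: phi_continuous; apply/not_wset; exists k.
have est j : `|J (fun t => fine (phi (pdisc g (circle_point c r t)))) 0 T -
      T * fine (phi (pdisc g c))| <= 2 * T * 2 ^- (k + j).
  pose m := (k + j)%N.
  have Om z : O_ k z -> O_ m z by apply: O_sub; exact: leq_addr.
  pose p := pcomp g (P_ m).
  have pz x : cmod (x - c) <= r -> p.[x] != 0.
    move=> /hk/Om[_ h]; rewrite -cmod_gt0 -pev_pdisc.
    by apply: lt_trans h; exact: eta_gt0.
  have clp : continuous (fun t => ln (cmod p.[circle_point c r t])).
    by apply: ln_horner_circle_continuous => // x xr; apply: pz; rewrite xr.
  have cl : continuous (fun t => l_ m (pdisc g (circle_point c r t))).
    rewrite (_ : (fun t => l_ m (pdisc g (circle_point c r t))) =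
        fun t => 2 ^- m * ln (cmod p.[circle_point c r t])).
      by move=> t; exact: continuous_mulc (clp t).
    by apply/funext => s; rewrite /l_ pev_pdisc.
  have Jl : J (fun t => l_ m (pdisc g (circle_point c r t))) 0 T = T * l_ m (pdisc g c).
    rewrite /l_ [RHS]mulrCA pev_pdisc -(J_ln_poly r0 pz) /J -RintegralZl//.
      by apply: eq_Rintegral => t _; rewrite pev_pdisc.
    exact: continuous_integrable.
  have hl t := phi_l (Om _ (on_circle t)); have hc := phi_l (Om _ Oc).
  have cs (s : R) : continuous (fun t => l_ m (pdisc g (circle_point c r t)) + s).
    by move=> t; exact: continuous_addc (cl t).
  have JA (s : R) : J (fun t => l_ m (pdisc g (circle_point c r t)) + s) 0 T =
      T * l_ m (pdisc g c) + s * T.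
    by rewrite JD//; [rewrite Jl J_cst ?subr0 ?ltW|exact: cst_continuous].
  have up : J (fun t => fine (phi (pdisc g (circle_point c r t)))) 0 T <=
      T * l_ m (pdisc g c) + 2 ^- m * T.
    rewrite -JA; apply: le_J => // t.
    by have := hl t; rewrite ler_norml => /andP[]; lra.
  have dn : T * l_ m (pdisc g c) + (- 2 ^- m) * T <=
      J (fun t => fine (phi (pdisc g (circle_point c r t)))) 0 T.
    rewrite -JA; apply: le_J => // t.
    by have := hl t; rewrite ler_norml => /andP[]; lra.
  have {}hc : `|T * fine (phi (pdisc g c)) - T * l_ m (pdisc g c)| <= T * 2 ^- m.
    by rewrite -mulrBr normrM gtr0_norm// ler_pM2l.
  move: hc; rewrite !ler_norml => /andP[h1 h2]; apply/andP; split; lra.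
apply/eqP; rewrite -subr_eq0 -normr_eq0; apply/eqP/le_anti; rewrite normr_ge0 andbT.
apply/ler_addgt0Pr => e e0; rewrite add0r.
have [j hj] := @exp2V_small R (2 * T) e ltac:(lra) e0.
by apply: le_trans (est j) _; apply/ltW/hj; exact: leq_addl.
Qed.

End Psh.

(** * Derivatives of limits and of logarithms *)

Section RealDerivative.
Variable R : realType.
Implicit Types (f g h k : R -> R) (s t d e : R).

Lemma is_derive_eps h s d : is_derive s 1 h d <-> (forall e, 0 < e ->
  exists2 r, 0 < r & forall t, `|t| < r -> `|h (s + t) - h s - t * d| <= e * `|t|).
Proof.
split=> [[dh hd] e e0|H].
  have /cvgrPdist_le /(_ e e0) : (fun t => t^-1 *: ((h \o shift s) (t *: 1) - h s)) @ 0^' --> d.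
    by rewrite -hd; exact: dh.
  rewrite /dnbhs /within /= => /nbhs_ballP[r /= r0 hr]; exists r => // t tr.
  have [->|t0] := eqVneq t 0; first by rewrite addr0 subrr mul0r subr0 normr0 mulr0.
  have := hr t; rewrite -ball_normE /= sub0r normrN => /(_ tr t0).
  have e1 : t *: 1 + s = s + t by rewrite [t *: 1]mulr1 addrC.
  rewrite /= e1 distrC => q.
  have -> : h (s + t) - h s - t * d = (t^-1 *: (h (s + t) - h s) - d) * t.
    by rewrite -[t^-1 *: _]/(t^-1 * (h (s + t) - h s)); field.
  by rewrite normrM ler_wpM2r.
have cv : (fun t => t^-1 *: ((h \o shift s) (t *: 1) - h s)) @ 0^' --> d.
  apply/cvgrPdist_le => e e0; have [r r0 hr] := H e e0.
  rewrite /dnbhs /within /=; apply/nbhs_ballP; exists r => //= t.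
  rewrite -ball_normE /= sub0r normrN => tr t0.
  have -> : d - t^-1 *: (h (t *: 1 + s) - h s) = - ((h (s + t) - h s - t * d) / t).
    have e1 : t *: 1 + s = s + t by rewrite [t *: 1]mulr1 addrC.
    by rewrite e1 -[t^-1 *: _]/(t^-1 * (h (s + t) - h s)); field.
  by rewrite normrN normrM normfV ler_pdivrMr ?normr_gt0//; exact: hr.
by split; [exact: (cvgP d cv)|exact: cvg_lim cv].
Qed.

(** The mean value theorem for [h m - h j] bounds the difference of the quotients
    uniformly in [m]. *)
Lemma is_derive_lim (h k : nat -> R -> R) (H K : R -> R) (s r A B : R) :
  0 < r -> 0 <= A ->
  (forall j t, `|t - s| < r -> is_derive t 1 (h j) (k j t)) ->
  (forall j t, `|t - s| < r -> `|K t - k j t| <= A * 2 ^- j) ->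
  (forall j t, `|t - s| < r -> `|H t - h j t| <= B * 2 ^- j) ->
  is_derive s 1 H (K s).
Proof.
move=> r0 A0 hk hK hH; apply/is_derive_eps => e e0.
have [j hj] := @exp2V_small R (4 * A) e ltac:(lra) e0; have {}hj := hj j (leqnn j).
have ss : `|s - s| < r by rewrite subrr normr0.
have [d d0 hd] := (is_derive_eps (h j) s (k j s)).1 (hk j s ss) (e / 4) ltac:(lra).
exists (Num.min d r); first by rewrite lt_min d0 r0.
move=> t; rewrite lt_min => /andP[/hd h1 tr].
have st : `|s + t - s| < r by rewrite addrAC subrr add0r.
have mvt m : `|(h m (s + t) - h j (s + t)) - (h m s - h j s)| <= (A * 2 ^- m + A * 2 ^- j) * `|t|.
  pose D u := h m u - h j u; pose dD u := k m u - k j u.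
  have dDu u : `|u - s| < r -> is_derive u 1 D (dD u).
    by move=> us; apply: is_deriveB; exact: hk.
  have bD u : `|u - s| < r -> `|dD u| <= A * 2 ^- m + A * 2 ^- j.
    move=> us; have h2 := hK m u us; have h3 := hK j u us.
    have -> : dD u = (K u - k j u) - (K u - k m u) by rewrite /dD; ring.
    apply: le_trans (ler_normB _ _) _; lra.
  have cD a b : `|a - s| < r -> `|b - s| < r -> {within `[a, b], continuous D}.
    move=> ha hb; apply: derivable_within_continuous => u; rewrite in_itv /= => /andP[au ub].
    have us : `|u - s| < r.
      by move: ha hb; rewrite !ltr_norml => /andP[? ?] /andP[? ?]; apply/andP; split; lra.
    by have [] := dDu u us.
  have seg a b : a <= b -> `|a - s| < r -> `|b - s| < r ->
      `|D b - D a| <= (A * 2 ^- m + A * 2 ^- j) * `|b - a|.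
    move=> ab ha hb.
    have hin u : u \in `[a, b] -> `|u - s| < r.
      rewrite in_itv /= => /andP[au ub].
      by move: ha hb; rewrite !ltr_norml => /andP[? ?] /andP[? ?]; apply/andP; split; lra.
    have [u|c cab ->] := @MVT_segment R D dD a b ab _ (cD a b ha hb).
      by move=> uab; apply: dDu; apply: hin; move: uab; rewrite !in_itv /= => /andP[/ltW -> /ltW ->].
    by rewrite normrM ler_wpM2r//; apply: bD; exact: hin.
  rewrite -[h m (s + t) - _]/(D (s + t)) -[h m s - _]/(D s).
  have [t0|t0] := leP 0 t.
    by apply: le_trans (seg s (s + t) _ ss st) _; rewrite ?lerDl// addrAC subrr add0r.
  rewrite distrC; apply: le_trans (seg (s + t) s _ st ss) _.
    by rewrite gerDl ltW.
  by rewrite opprD addrA subrr add0r normrN.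
have key : `|(H (s + t) - h j (s + t)) - (H s - h j s)| <= 2 * A * 2 ^- j * `|t|.
  apply/ler_addgt0Pr => e' e'0.
  have [i hi] := @exp2V_small R (2 * `|B|) e' (ltac:(by rewrite mulr_ge0)) e'0.
  pose m := maxn i j.
  have {}hi : 2 * `|B| * 2 ^- m < e' by apply: hi; exact: leq_maxl.
  have B1 (x : R) : x <= B * 2 ^- m -> x <= `|B| * 2 ^- m.
    by move=> /le_trans; apply; rewrite ler_pM2r ?exp2V_gt0// ler_norm.
  have a1 := B1 _ (hH m _ st); have a2 := B1 _ (hH m _ ss); have a3 := mvt m.
  have mj : 2 ^- m <= 2 ^- j :> R.
    by rewrite lef_pV2 ?posrE ?exprn_gt0// ler_eXn2l ?ltr1n// leq_maxr.
  have a4 : (A * 2 ^- m + A * 2 ^- j) * `|t| <= 2 * A * 2 ^- j * `|t|.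
    rewrite ler_wpM2r//; have := ler_wpM2l A0 mj; lra.
  have -> : H (s + t) - h j (s + t) - (H s - h j s) =
     ((h m (s + t) - h j (s + t)) - (h m s - h j s)) + (H (s + t) - h m (s + t))
     - (H s - h m s) by ring.
  apply: le_trans (ler_normB _ _) _.
  have := ler_normD ((h m (s + t) - h j (s + t)) - (h m s - h j s)) (H (s + t) - h m (s + t)).
  lra.
have h2 := hK j s ss.
have h3 : `|t * (K s - k j s)| <= A * 2 ^- j * `|t|.
  by rewrite normrM mulrC ler_wpM2r.
have -> : H (s + t) - H s - t * K s = ((H (s + t) - h j (s + t)) - (H s - h j s))
   + (h j (s + t) - h j s - t * k j s) - t * (K s - k j s) by ring.
apply: le_trans (ler_normB _ _) _.
have h4 := ler_normD ((H (s + t) - h j (s + t)) - (H s - h j s)) (h j (s + t) - h j s - t * k j s).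
have h5 : 3 * (A * 2 ^- j) * `|t| <= 3 / 4 * e * `|t|.
  rewrite ler_wpM2r//; lra.
lra.
Qed.

Definition cderive (f : R -> Cx R) s (d : Cx R) : Prop :=
  is_derive s 1 (fun t => complex.Re (f t)) (complex.Re d) /\
  is_derive s 1 (fun t => complex.Im (f t)) (complex.Im d).

Lemma ReM (a b : Cx R) : complex.Re (a * b) =
  complex.Re a * complex.Re b - complex.Im a * complex.Im b.
Proof. by case: a; case: b. Qed.

Lemma ImM (a b : Cx R) : complex.Im (a * b) =
  complex.Re a * complex.Im b + complex.Im a * complex.Re b.
Proof. by case: a => a1 a2; case: b => b1 b2 /=; rewrite addrC. Qed.

Lemma ImD (a b : Cx R) : complex.Im (a + b) = complex.Im a + complex.Im b.
Proof. by case: a; case: b. Qed.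

Lemma cderive_cst (c : Cx R) s : cderive (fun=> c) s 0.
Proof. by split; exact: is_derive_cst. Qed.

Lemma cderiveD (f g : R -> Cx R) s df dg : cderive f s df -> cderive g s dg ->
  cderive (fun t => f t + g t) s (df + dg).
Proof.
move=> [f1 f2] [g1 g2]; split.
  under eq_fun do rewrite ReD; rewrite ReD; exact: (is_deriveD f1 g1).
under eq_fun do rewrite ImD; rewrite ImD; exact: (is_deriveD f2 g2).
Qed.

Lemma cderiveM (f g : R -> Cx R) s df dg : cderive f s df -> cderive g s dg ->
  cderive (fun t => f t * g t) s (df * g s + f s * dg).
Proof.
move=> [f1 f2] [g1 g2]; split.
  under eq_fun do rewrite ReM; rewrite ReD !ReM.
  refine (is_derive_eq (is_deriveB (is_deriveM f1 g1) (is_deriveM f2 g2)) _).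
  rewrite /GRing.scale /=; ring.
under eq_fun do rewrite ImM; rewrite ImD !ImM.
refine (is_derive_eq (is_deriveD (is_deriveM f1 g2) (is_deriveM f2 g1)) _).
rewrite /GRing.scale /=; ring.
Qed.

Lemma Re_inv (a : Cx R) : complex.Re a^-1 =
  complex.Re a / (complex.Re a ^+ 2 + complex.Im a ^+ 2).
Proof. by case: a. Qed.

Lemma Im_inv (a : Cx R) : complex.Im a^-1 =
  - complex.Im a / (complex.Re a ^+ 2 + complex.Im a ^+ 2).
Proof. by case: a => x y /=; rewrite mulNr. Qed.

Lemma is_deriveV1 f s df : is_derive s 1 f df -> f s != 0 ->
  is_derive s 1 (fun t => (f t)^-1) (- df / f s ^+ 2).
Proof.
move=> [f1 f2] f0; split; first exact: derivableV.
by rewrite deriveV// f2 [LHS]mulNr mulrC mulNr.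
Qed.

Lemma cderiveV (g : R -> Cx R) s dg : cderive g s dg -> g s != 0 ->
  cderive (fun t => (g t)^-1) s (- dg / g s ^+ 2).
Proof.
move=> [g1 g2] g0.
pose N t := complex.Re (g t) ^+ 2 + complex.Im (g t) ^+ 2.
have N0 : N s != 0.
  by rewrite /N -cmod_sqr expf_neq0// gt_eqF// cmod_gt0.
have dN : is_derive s 1 N (2 * (complex.Re (g s) * complex.Re dg + complex.Im (g s) * complex.Im dg)).
  refine (is_derive_eq (is_deriveD (is_deriveM g1 g1) (is_deriveM g2 g2)) _).
  rewrite /GRing.scale /=; ring.
have dNi := is_deriveV1 dN N0.
have e2 : g s ^+ 2 = g s * g s by rewrite expr2.
have sq : (complex.Re (g s) * complex.Re (g s) - complex.Im (g s) * complex.Im (g s)) ^+ 2 +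
 (complex.Re (g s) * complex.Im (g s) + complex.Im (g s) * complex.Re (g s)) ^+ 2 = N s ^+ 2.
  rewrite /N; ring.
split.
  under eq_fun do rewrite Re_inv; rewrite ReM Re_inv Im_inv e2 ReM ImM sq.
  refine (is_derive_eq (is_deriveM g1 dNi) _).
  rewrite -/(N s) /GRing.scale /=; move: N0; rewrite /N; case: (dg) => x y; case: (g s) => a b /=.
  move=> N0; field; by rewrite N0.
under eq_fun do rewrite Im_inv; rewrite ImM Re_inv Im_inv e2 ReM ImM sq.
refine (is_derive_eq (is_deriveM (is_deriveN g2) dNi) _).
rewrite -[(- (fun t => complex.Im (g t))) s]/(- complex.Im (g s)).
rewrite -/(N s) /GRing.scale /=; move: N0; rewrite /N; case: (dg) => x y; case: (g s) => a b /=.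
move=> N0; field; by rewrite N0.
Qed.

(** [ln `|f|] is the real part of a local branch of [log f]. *)
Lemma is_derive_ln_cmod (f : R -> Cx R) s df : cderive f s df -> f s != 0 ->
  is_derive s 1 (fun t => ln (cmod (f t))) (complex.Re (df / f s)).
Proof.
move=> [f1 f2] f0.
pose N t := complex.Re (f t) ^+ 2 + complex.Im (f t) ^+ 2.
have Np : 0 < N s by rewrite /N -cmod_sqr exprn_gt0// cmod_gt0.
have dN : is_derive s 1 N (2 * (complex.Re (f s) * complex.Re df + complex.Im (f s) * complex.Im df)).
  refine (is_derive_eq (is_deriveD (is_deriveM f1 f1) (is_deriveM f2 f2)) _).
  rewrite /GRing.scale /=; ring.
have -> : (fun t => ln (cmod (f t))) = fun t => 2^-1 * ln (N t).
  apply/funext => t; rewrite /N -cmod_sqr.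
  have [c0|c0] := eqVneq (cmod (f t)) 0; first by rewrite c0 expr0n /= ln0// mulr0.
  have cp : 0 < cmod (f t) by rewrite lt_neqAle eq_sym c0 cmod_ge0.
  by rewrite lnXn// mulr2n; field.
have dl := is_derive1_comp (is_derive1_ln Np) dN.
refine (is_derive_eq (is_deriveM (is_derive_cst (2^-1 : R) s 1) dl) _).
rewrite ReM Re_inv Im_inv; move: Np; rewrite /N /GRing.scale /=.
case: (df) => x y; case: (f s) => a b /= Np.
by field; rewrite gt_eqF.
Qed.

End RealDerivative.

Lemma is_derive_near (R : realType) (f g : R -> R) (s d r : R) : 0 < r ->
  (forall t, `|t - s| < r -> f t = g t) -> is_derive s 1 f d -> is_derive s 1 g d.
Proof.
move=> r0 fg /is_derive_eps H; apply/is_derive_eps => e /H[q q0 hq].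
exists (Num.min q r); first by rewrite lt_min q0 r0.
move=> t; rewrite lt_min => /andP[/hq h tr].
rewrite -!fg ?subrr ?normr0//.
by rewrite addrAC subrr add0r.
Qed.

Lemma geometric_limit (R : realType) (a : nat -> R) (A : R) :
  (forall j, `|a j.+1 - a j| <= A * 2 ^- j.+1) ->
  exists L, forall j, `|L - a j| <= A * 2 ^- j.
Proof.
move=> ha.
have A0 : 0 <= A.
  have := le_trans (normr_ge0 _) (ha 0%N).
  by rewrite pmulr_lge0// exp2V_gt0.
have cau j m : (j <= m)%N -> `|a m - a j| <= A * 2 ^- j - A * 2 ^- m.
  move=> /subnKC <-; elim: (m - j)%N => [|i IH]; first by rewrite addn0 !subrr normr0.
  rewrite addnS; have := ha (j + i)%N; move: IH; rewrite (exp2VS R (j + i)).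
  set x := a (j + i)%N; set y := a (j + i).+1 => h1 h2.
  have := ler_normD (y - x) (x - a j); rewrite addrA subrK; lra.
pose S := [set a j + A * 2 ^- j | j in [set: nat]].
have lb j : lbound S (a j - A * 2 ^- j).
  move=> _ [m _ <-].
  have h2 (x : nat) : 0 <= A * 2 ^- x by rewrite mulr_ge0// ltW// exp2V_gt0.
  have := h2 j; have := h2 m.
  have [jm|/ltnW mj] := leqP j m.
    by have := cau _ _ jm; rewrite ler_norml => /andP[]; lra.
  by have := cau _ _ mj; rewrite ler_norml => /andP[]; lra.
have Sn : S !=set0 by exists (a 0%N + A * 2 ^- 0), 0%N.
exists (inf S) => j; rewrite ler_norml; apply/andP; split.
  have : a j - A * 2 ^- j <= inf S by apply: lb_le_inf => //; exact: lb.
  lra.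
have : inf S <= a j + A * 2 ^- j.
  by apply: ge_inf; [exists (a 0%N - A * 2 ^- 0); exact: lb|exists j].
lra.
Qed.

(** * Derivatives of the potential off the set *)

Section Smooth.
Variables (R : realType) (n : nat) (i0 : 'I_n).
Local Notation C := (complex R).
Local Notation P_ := (@P_ R n i0).
Local Notation eta_ := (@eta_ R n i0).
Local Notation eps_ := (@eps_ R n i0).
Local Notation O_ := (@O_ R n i0).
Local Notation wset := (@wset R n i0).
Local Notation phi := (@phi R n i0).
Local Notation l_ := (@l_ R n i0).
Implicit Types (z v w a b : Cn R n) (k j m : nat) (s t r : R).

Definition path z v s : Cn R n := z + (ofreal s : C) *: v.

Lemma path0 z v : path z v 0 = z.
Proof. by rewrite /path scale0r addr0. Qed.

Lemma path_near z v s k : O_ k (path z v s) ->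
  exists2 r, 0 < r & forall t, `|t - s| < r -> O_ k (path z v t).
Proof.
move=> Oz; have : nbhs (path z v s) (O_ k) by exact: open_nbhs_nbhs (conj (@open_O R n i0 k) Oz).
move=> /nbhs_Cn[e e0 he]; exists (e / (enorm v + 1)).
  by rewrite divr_gt0// ltr_wpDl// enorm_ge0.
move=> t ts; apply: he.
have -> : path z v t - path z v s = (ofreal (t - s) : Cx R) *: v.
  rewrite /path opprD addrACA subrr add0r -scalerBl; congr (_ *: _).
  by apply/eqP; rewrite eq_complex /= subr0 !eqxx.
rewrite enormZ cmod_ofreal; have v0 := enorm_ge0 v.
rewrite ltr_pdivlMr in ts; last by lra.
by apply: le_lt_trans ts; rewrite ler_wpM2l//; lra.
Qed.

Lemma cderive_pev (x : pexp R n) z v s :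
  cderive (fun t => pev x (path z v t)) s (pev (pD v x) (path z v s)).
Proof.
elim: x => [c|i|p IHp q IHq|p IHp q IHq] /=.
- exact: cderive_cst.
- have d1 : cderive (@ofreal R) s 1.
    by split; [exact: is_derive_id|exact: is_derive_cst].
  have := cderiveD (cderive_cst (z 0 i) s) (cderiveM d1 (cderive_cst (v 0 i) s)).
  rewrite add0r mul1r mulr0 addr0.
  by under [X in _ -> cderive X _ _]eq_fun do rewrite /path !mxE.
- exact: cderiveD.
- exact: cderiveM.
Qed.

Definition D1 j v z : R := 2 ^- j * complex.Re (L1 (P_ j) v z).
Definition D2 j v w z : R := 2 ^- j * complex.Re (L2 (P_ j) v w z).

Lemma is_derive_l j v z s : O_ j (path z v s) ->
  is_derive s 1 (fun t => l_ j (path z v t)) (D1 j v (path z v s)).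
Proof.
move=> /P_neq0 P0; have h := is_derive_ln_cmod (cderive_pev (P_ j) z v s) P0.
refine (is_derive_eq (is_deriveM (is_derive_cst (2 ^- j : R) s 1) h) _).
by rewrite /GRing.scale /= mulr0 addr0.
Qed.

Lemma is_derive_D1 j v w z s : O_ j (path z w s) ->
  is_derive s 1 (fun t => D1 j v (path z w t)) (D2 j v w (path z w s)).
Proof.
move=> /P_neq0 P0.
have [h _] := cderiveM (cderive_pev (pD v (P_ j)) z w s)
  (cderiveV (cderive_pev (P_ j) z w s) P0).
refine (is_derive_eq (is_deriveM (is_derive_cst (2 ^- j : R) s 1) h) _).
rewrite /GRing.scale /= mulr0 addr0 /D2 /L2; congr (_ * complex.Re _).
by rewrite mulNr mulrN mulrA.
Qed.

Lemma L_continuous j v w z : O_ j z ->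
  {for z, continuous (D1 j v)} /\ {for z, continuous (D2 j v w)}.
Proof.
move=> /P_neq0 P0.
have cp (t : pexp R n) : {for z, continuous (pev t)} by exact: (@pev_continuous R n t z).
have ci : {for z, continuous (fun z => (pev (P_ j) z)^-1 : Cx R)}.
  exact: cvgV P0 (cp (P_ j)).
have cM (f g : Cn R n -> Cx R) : {for z, continuous f} -> {for z, continuous g} ->
    {for z, continuous (fun z => f z * g z)}.
  by move=> cf cg; exact: cvgM cf cg.
have c1 := cM _ _ (cp (pD v (P_ j))) ci.
split.
  apply: (@continuous_mulc R _ (fun z => complex.Re (L1 (P_ j) v z))).
  apply: (@continuous_comp _ _ _ (L1 (P_ j) v) (fun z : Cx R => complex.Re z)).
    exact: c1.
  exact: Re_continuous.
apply: (@continuous_mulc R _ (fun z => complex.Re (L2 (P_ j) v w z))).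
apply: (@continuous_comp _ _ _ (L2 (P_ j) v w) (fun z : Cx R => complex.Re z)).
  rewrite (_ : L2 (P_ j) v w = fun z : Cn R n =>
    pev (pD w (pD v (P_ j))) z * (pev (P_ j) z)^-1 -
    pev (pD v (P_ j)) z * pev (pD w (P_ j)) z * ((pev (P_ j) z)^-1 * (pev (P_ j) z)^-1)).
    have c2 := cM _ _ (cp (pD w (pD v (P_ j)))) ci.
    have c3 := cM _ _ (cM _ _ (cp (pD v (P_ j))) (cp (pD w (P_ j)))) (cM _ _ ci ci).
    exact: (cvgB c2 c3).
  by apply/funext => x; rewrite /L2 expr2 invfM.
exact: Re_continuous.
Qed.

(** This is what the last clause of [good_eps] is for. *)
Lemma D_step j v w z : O_ j z ->
  `|D1 j.+1 v z - D1 j v z| <= enorm v * 2 ^- j.+1 /\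
  `|D2 j.+1 v w z - D2 j v w z| <= enorm v * enorm w * 2 ^- j.+1.
Proof.
move=> [/ltW zj /ltW hP].
have [_ _ _ /(_ z zj)[_ /(_ hP v w)]] := eps_good R i0 j.
rewrite -P_S => -[h1 h2].
have red (x y : Cx R) : 2 ^- j.+1 * complex.Re x - 2 ^- j * complex.Re y =
    2 ^- j.+1 * complex.Re (x - 2 * y).
  have -> : x - 2 * y = x - (y + y) by ring.
  rewrite ReB ReD (exp2VS R j); ring.
have p0 := exp2V_gt0 R j.+1; have p1 := exp2V_le1 R j.
have v0 := enorm_ge0 v; have w0 := enorm_ge0 w.
have vw0 : 0 <= enorm v * enorm w by rewrite mulr_ge0.
rewrite /D1 /D2 !red !normrM gtr0_norm//; split; rewrite mulrC ler_pM2r//.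
  by apply: le_trans (cmod_Re _) _; apply: le_trans h1 _; rewrite ler_piMl.
by apply: le_trans (cmod_Re _) _; apply: le_trans h2 _; rewrite ler_piMl.
Qed.

(** Limits of the derivatives of the [l_ j]; that they are the derivatives of the
    potential is shown in [is_derive_phi] and [is_derive_dphi]. *)
Definition dphi v z : R :=
  xget 0 [set L | forall j, O_ j z -> `|L - D1 j v z| <= enorm v * 2 ^- j].
Definition ddphi v w z : R :=
  xget 0 [set L | forall j, O_ j z -> `|L - D2 j v w z| <= enorm v * enorm w * 2 ^- j].

(** The estimates hold from the first [O_ m] that contains [z] on. *)
Lemma limit_O (a : nat -> R) (A : R) z : 0 <= A -> (forall j, O_ j z ->
    `|a j.+1 - a j| <= A * 2 ^- j.+1) ->
  exists L, forall j, O_ j z -> `|L - a j| <= A * 2 ^- j.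
Proof.
move=> A0 ha; have [[k Ok]|H] := pselect (exists k, O_ k z); last first.
  by exists 0 => j Oj; exfalso; apply: H; exists j.
have ex : exists k, `[< O_ k z >] by exists k; exact/asboolP.
case: (ex_minnP ex) => m /asboolP Om hm.
have [L hL] : exists L, forall j, `|L - a (m + j)%N| <= (A * 2 ^- m) * 2 ^- j.
  apply: (@geometric_limit _ (fun j => a (m + j)%N)) => j.
  rewrite addnS -mulrA -invfM -exprD addnS; apply: ha; apply: O_sub Om; exact: leq_addr.
exists L => j Oj; have mj : (m <= j)%N by apply: hm; exact/asboolP.
by have := hL (j - m)%N; rewrite subnKC// -mulrA -invfM -exprD subnKC.
Qed.

Lemma dphi_rate v z j : O_ j z -> `|dphi v z - D1 j v z| <= enorm v * 2 ^- j.
Proof.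
move=> Oj; have [L hL] := @limit_O (fun j => D1 j v z) (enorm v) z (enorm_ge0 v)
  (fun j Oj => (D_step v v Oj).1).
by have /(_ j Oj) := @xgetPex _ 0 [set L | forall j, O_ j z -> `|L - D1 j v z| <= enorm v * 2 ^- j]
  (ex_intro _ L hL).
Qed.

Lemma ddphi_rate v w z j : O_ j z ->
  `|ddphi v w z - D2 j v w z| <= enorm v * enorm w * 2 ^- j.
Proof.
move=> Oj; have [L hL] := @limit_O (fun j => D2 j v w z) (enorm v * enorm w) z
  (mulr_ge0 (enorm_ge0 v) (enorm_ge0 w)) (fun j Oj => (D_step v w Oj).2).
by have /(_ j Oj) := @xgetPex _ 0 [set L | forall j, O_ j z ->
  `|L - D2 j v w z| <= enorm v * enorm w * 2 ^- j] (ex_intro _ L hL).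
Qed.

Lemma exp2V_addl k j : 2 ^- (k + j) <= 2 ^- j :> R.
Proof.
by rewrite exprD invfM ler_piMl ?exp2V_le1// ltW// exp2V_gt0.
Qed.

Lemma is_derive_phi v z s : ~ wset (path z v s) ->
  is_derive s 1 (fun t => fine (phi (path z v t))) (dphi v (path z v s)).
Proof.
move=> /not_wset[k Ok]; have [r r0 hr] := path_near Ok.
apply: (@is_derive_lim R (fun j t => l_ (k + j) (path z v t))
  (fun j t => D1 (k + j) v (path z v t)) _ (fun t => dphi v (path z v t)) s r (enorm v) 1) => //.
- exact: enorm_ge0.
- by move=> j t tr; apply: is_derive_l; apply: O_sub (hr t tr); exact: leq_addr.
- move=> j t tr; apply: le_trans (dphi_rate v _) _.
    by apply: O_sub (hr t tr); exact: (leq_addr j).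
  by rewrite ler_wpM2l ?enorm_ge0// exp2V_addl.
- move=> j t tr; rewrite mul1r; apply: le_trans (exp2V_addl k j).
  by apply: phi_l; apply: O_sub (hr t tr); exact: leq_addr.
Qed.

Lemma is_derive_dphi v w z s : ~ wset (path z w s) ->
  is_derive s 1 (fun t => dphi v (path z w t)) (ddphi v w (path z w s)).
Proof.
move=> /not_wset[k Ok]; have [r r0 hr] := path_near Ok.
apply: (@is_derive_lim R (fun j t => D1 (k + j) v (path z w t))
  (fun j t => D2 (k + j) v w (path z w t)) _ (fun t => ddphi v w (path z w t)) s r
  (enorm v * enorm w) (enorm v)) => //.
- by rewrite mulr_ge0 ?enorm_ge0.
- by move=> j t tr; apply: is_derive_D1; apply: O_sub (hr t tr); exact: leq_addr.
- move=> j t tr; apply: le_trans (ddphi_rate v w _) _.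
    by apply: O_sub (hr t tr); exact: (leq_addr j).
  by rewrite ler_wpM2l ?mulr_ge0 ?enorm_ge0// exp2V_addl.
- move=> j t tr; apply: le_trans (dphi_rate v _) _.
    by apply: O_sub (hr t tr); exact: (leq_addr j).
  by rewrite ler_wpM2l ?enorm_ge0// exp2V_addl.
Qed.

Lemma dphi_continuous v z : ~ wset z -> {for z, continuous (dphi v)}.
Proof.
move=> Ez; apply: (@continuous_rate R n i0 _ (fun j => D1 j v) (enorm v)) => //.
- exact: enorm_ge0.
- by move=> j w; exact: dphi_rate.
- by move=> j Oz; case: (L_continuous v v Oz).
Qed.

Lemma ddphi_continuous v w z : ~ wset z -> {for z, continuous (ddphi v w)}.
Proof.
move=> Ez; apply: (@continuous_rate R n i0 _ (fun j => D2 j v w) (enorm v * enorm w)) => //.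
- by rewrite mulr_ge0 ?enorm_ge0.
- by move=> j x; exact: ddphi_rate.
- by move=> j Oz; case: (L_continuous v w Oz).
Qed.

End Smooth.

(** * Pluriharmonicity and the exhaustion function *)

Section Pluriharmonic.
Variables (R : realType) (n : nat) (i0 : 'I_n).
Local Notation C := (complex R).
Local Notation P_ := (@P_ R n i0).
Local Notation O_ := (@O_ R n i0).
Local Notation wset := (@wset R n i0).
Local Notation phi := (@phi R n i0).
Local Notation dphi := (@dphi R n i0).
Local Notation ddphi := (@ddphi R n i0).
Implicit Types (z v w a b : Cn R n) (k j m : nat) (s t r : R).

Lemma rderiv_path (u : Cn R n -> R) v z d :
  is_derive (0 : R) (1 : R) (fun t => u (path z v t)) d ->
  rderivable u v z /\ rderive u v z = d.
Proof. by move=> [h1 h2]; split; [exact: h1|rewrite /rderive derive1E]. Qed.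

Lemma open_compl : open (~` wset).
Proof. by rewrite openC; exact: closed_wset. Qed.

Lemma near_compl z : ~ wset z -> \forall w \near z, ~ wset w.
Proof. by move=> Ez; exact: open_nbhs_nbhs (conj open_compl Ez). Qed.

Lemma continuous_near (f g : Cn R n -> R) z : ~ wset z ->
  (forall w, ~ wset w -> f w = g w) -> {for z, continuous f} -> {for z, continuous g}.
Proof.
move=> Ez fg cf A; rewrite -(fg _ Ez) => /cf /nbhs_Cn[d1 d10 h1].
have /nbhs_Cn[d2 d20 h2] := near_compl Ez.
apply/nbhs_Cn; exists (Num.min d1 d2); first by rewrite lt_min d10 d20.
move=> w; rewrite lt_min => /andP[/h1 Aw /h2 Ew].
by rewrite /= -(fg _ Ew).
Qed.

Lemma rderive_phi v z : ~ wset z ->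
  rderivable (fine \o phi) v z /\ rderive (fine \o phi) v z = dphi v z.
Proof.
by move=> Ez; apply: rderiv_path; have := @is_derive_phi R n i0 v z 0; rewrite path0; apply.
Qed.

Lemma rderive_dphi v w z : ~ wset z ->
  rderivable (rderive (fine \o phi) v) w z /\
  rderive (rderive (fine \o phi) v) w z = ddphi v w z.
Proof.
move=> Ez; apply: rderiv_path.
have [k Ok] := (not_wset i0 z).1 Ez.
have [r r0 hr] : exists2 r, 0 < r & forall t, `|t - 0| < r -> O_ k (path z w t).
  by apply: path_near; rewrite path0.
apply: (is_derive_near (f := fun t => dphi v (path z w t)) r0).
  move=> t tr; apply/esym/(rderive_phi v _).2.
  by apply/not_wset; exists k; exact: hr.
by have := @is_derive_dphi R n i0 v w z 0; rewrite path0; apply.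
Qed.

Lemma C2_phi : C2_on (~` wset) (fine \o phi).
Proof.
split=> [v z Ez|v w z Ez].
  split; first by have [] := rderive_phi v Ez.
  apply: (continuous_near (f := dphi v)) => //; last exact: dphi_continuous.
  by move=> x Ex; have [_ ->] := rderive_phi v Ex.
split; first by have [] := rderive_dphi v w Ez.
apply: (continuous_near (f := ddphi v w)) => //; last exact: ddphi_continuous.
by move=> x Ex; have [_ ->] := rderive_dphi v w Ex.
Qed.

Lemma path_line a b (x v : Cx R) t :
  line a b (x + (ofreal t : C) *: v) = path (line a b x) (v *: b) t.
Proof.
by rewrite /line /path scalerDl addrA scalerA.
Qed.

Lemma rderive_line (u : Cn R n -> R) a b (v : Cx R) :
  rderive (u \o line a b) v = rderive u (v *: b) \o line a b.
Proof.
apply/funext => x; rewrite /rderive.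
rewrite (_ : (fun t : R => (u \o line a b) (x + (ofreal t : C) *: v)) =
  fun t : R => u (line a b x + (ofreal t : C) *: (v *: b)))//.
by apply/funext => t /=; rewrite path_line.
Qed.

Lemma rderivable_line (u : Cn R n -> R) a b (v : Cx R) x :
  rderivable u (v *: b) (line a b x) -> rderivable (u \o line a b) v x.
Proof.
rewrite /rderivable (_ : (fun t : R => (u \o line a b) _) =
  fun t : R => u (line a b x + (ofreal t : C) *: (v *: b)))//.
by apply/funext => t /=; rewrite path_line.
Qed.

Lemma line_continuous a b : continuous (line a b).
Proof. by rewrite line_pdisc; exact: pdisc_continuous i0 _. Qed.

Lemma C1_line (D : set (Cn R n)) (u : Cn R n -> R) a b :
  C1_on D u -> C1_on (line a b @^-1` D) (u \o line a b).
Proof.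
move=> hu v x Dx; have [h1 h2] := hu (v *: b) _ Dx; split.
  exact: rderivable_line h1.
rewrite rderive_line.
exact: (@continuous_comp _ _ _ (line a b) (rderive u (v *: b)) x
  (@line_continuous a b x) h2).
Qed.

Lemma pev_pDZ (q : pexp R n) (c : C) v z : pev (pD (c *: v) q) z = c * pev (pD v q) z.
Proof.
elim: q => [x|i|p IHp q IHq|p IHp q IHq] /=.
- by rewrite mulr0.
- by rewrite mxE.
- by rewrite IHp IHq mulrDr.
- by rewrite IHp IHq; ring.
Qed.

Lemma pev_pDZr (q : pexp R n) (c : C) v w z :
  pev (pD w (pD (c *: v) q)) z = c * pev (pD w (pD v q)) z.
Proof.
elim: q => [x|i|p IHp q IHq|p IHp q IHq] /=.
- by rewrite mulr0.
- by rewrite mulr0.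
- by rewrite IHp IHq mulrDr.
- by rewrite IHp IHq !pev_pDZ; ring.
Qed.

(** The second derivative of a branch of [log (P_ j)] is complex bilinear in the two
    directions: multiplying both by the imaginary unit changes its sign. *)
Lemma ddphi_laplace b z : ~ wset z ->
  ddphi b b z + ddphi ((Complex 0 1 : C) *: b) ((Complex 0 1 : C) *: b) z = 0.
Proof.
move=> /not_wset[k Ok]; set ib := _ *: b.
have D2N j : D2 i0 j ib ib z = - D2 i0 j b b z.
  have -> : D2 i0 j ib ib z = 2 ^- j * complex.Re (- L2 (P_ j) b b z).
    have ii : (Complex 0 1 : C) * Complex 0 1 = -1.
      by apply/eqP; rewrite eq_complex /=; apply/andP; split; apply/eqP; ring.
    rewrite /D2 /L2 /ib pev_pDZ pev_pDZr !pev_pDZ.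
    congr (_ * complex.Re _); move: (Complex 0 1 : Cx R) ii => I ii.
    by rewrite -[RHS]mulN1r -ii; ring.
  by rewrite /D2 -mulrN; congr (_ * _); case: (L2 _ _ _ _).
apply/eqP; rewrite -normr_eq0; apply/eqP/le_anti; rewrite normr_ge0 andbT.
apply/ler_addgt0Pr => e e0; rewrite add0r.
pose A := enorm b * enorm b + enorm ib * enorm ib.
have A0 : 0 <= A by rewrite addr_ge0 ?mulr_ge0 ?enorm_ge0.
have [j hj] := @exp2V_small R A e A0 e0.
have Oj : O_ (k + j) z by apply: O_sub Ok; exact: leq_addr.
have h1 := ddphi_rate b b Oj; have h2 := ddphi_rate ib ib Oj.
rewrite D2N opprK in h2.
have h3 := hj (k + j)%N (leq_addl k j).
set x := ddphi b b z in h1 *; set y := ddphi ib ib z in h2 *; set d := D2 _ _ _ _ _ in h1 h2.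
have -> : x + y = (x - d) + (y + d) by ring.
apply: le_trans (ler_normD _ _) _; rewrite /A mulrDl in h3; lra.
Qed.

Lemma phi_pluriharmonic : pluriharmonic (~` wset) (fine \o phi).
Proof.
split=> [|a b]; first exact: C2_phi.
have [h1 h2] := C2_phi; split.
  split; first exact: C1_line.
  by move=> v; rewrite (rderive_line (fine \o phi) a b v); exact: C1_line.
have e (v : Cx R) x : rderive (rderive ((fine \o phi) \o line a b) v) v x =
    rderive (rderive (fine \o phi) (v *: b)) (v *: b) (line a b x).
  by rewrite (rderive_line (fine \o phi) a b v)
    (rderive_line (rderive (fine \o phi) (v *: b)) a b v).
move=> x Dx.
refine (eq_trans (congr2 +%R (e (Complex 1 0) x) (e (Complex 0 1) x)) _).
have [_ h10] := rderive_dphi ((Complex 1 0 : C) *: b) ((Complex 1 0 : C) *: b) Dx.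
have [_ h01] := rderive_dphi ((Complex 0 1 : C) *: b) ((Complex 0 1 : C) *: b) Dx.
refine (eq_trans (congr2 +%R h10 h01) _).
have -> : (Complex 1 0 : C) *: b = b by exact: scale1r.
exact: ddphi_laplace.
Qed.

(** [- phi] tends to [+oo] at the limit set, the logarithm at infinity. *)
Definition exhaustion z : R := Num.max (- fine (phi z)) (ln (1 + enorm z)).

Lemma pos_1norm z : 0 < 1 + enorm z.
Proof. by rewrite ltr_wpDr ?enorm_ge0. Qed.

Lemma ln_norm_continuous : continuous (fun z => ln (1 + enorm z)).
Proof.
move=> z; have c1 : {for z, continuous (fun z => 1 + enorm z)}.
  rewrite (_ : (fun z => 1 + enorm z) = fun z => enorm z + 1).
    exact: continuous_addc (@enorm_continuous R n z).
  by apply/funext => w; rewrite addrC.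
exact: continuous_ln_comp c1 (pos_1norm z).
Qed.

Lemma exhaustion_continuous z : ~ wset z -> {for z, continuous exhaustion}.
Proof.
move=> Ez.
have c1 : {for z, continuous (fun z => - fine (phi z))}.
  rewrite (_ : (fun z => - fine (phi z)) = fun z => -1 * (fine \o phi) z).
    exact: continuous_mulc (phi_continuous Ez).
  by apply/funext => w; rewrite mulN1r.
apply: continuous_CnP => e e0.
have h1 := c1 _ (nbhsx_ballx (- fine (phi z)) _ e0).
have h2 := ln_norm_continuous (nbhsx_ballx (ln (1 + enorm z)) _ e0).
move: h1 h2 => /nbhs_Cn[d1 d10 hd1] /nbhs_Cn[d2 d20 hd2].
exists (Num.min d1 d2); first by rewrite lt_min d10 d20.
move=> w; rewrite lt_min => /andP[/hd1 + /hd2]; rewrite -!ball_normE /= !ltr_norml.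
rewrite /exhaustion => /andP[a1 a2] /andP[b1 b2].
by case: (ltP (- fine (phi z))) => q1; case: (ltP (- fine (phi w))) => q2;
  apply/andP; split; lra.
Qed.

Local Notation T := (pi *+ 2 : R).

(** [1 + enorm z] is the maximum of [cmod (1 + dot y z)] over [enorm y <= 1]: Jensen's
    inequality applies to the affine function that attains it at the center. *)
Lemma ln_norm_mean a b (c : Cx R) r : 0 < r ->
  T * ln (1 + enorm (line a b c)) <= J (fun t => ln (1 + enorm (line a b (circle_point c r t)))) 0 T.
Proof.
move=> r0; set x := line a b c.
pose y : Cn R n := (ofreal (enorm x)^-1 : Cx R) *: cconj x.
have y1 : enorm y <= 1.
  rewrite /y enormZ cmod_ofreal enorm_cconj ger0_norm ?invr_ge0 ?enorm_ge0//.
  have [->|x0] := eqVneq (enorm x) 0; first by rewrite mulr0.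
  by rewrite mulVf.
have yx : dot y x = ofreal (enorm x).
  rewrite /y dotZl dot_cconj.
  have [->|x0] := eqVneq (enorm x) 0.
    by rewrite expr0n /= -[ofreal 0]/(0 : C) mulr0.
  rewrite -[ofreal (_ ^-1) * _]/(real_complex R _ * real_complex R _) -rmorphM /=.
  by rewrite expr2 mulrA mulVf// mul1r.
pose h : {poly C} := (1 + dot y a : C)%:P + (dot y b : C) *: 'X.
have hE (w : C) : h.[w] = 1 + dot y (line a b w).
  by rewrite !hornerE /line dotDr dotZr [_ * w]mulrC addrA.
have hc : cmod h.[c] = 1 + enorm x.
  rewrite hE -/x yx (_ : 1 + ofreal (enorm x) = ofreal (1 + enorm x)).
    by rewrite cmod_ofreal gtr0_norm// pos_1norm.
  by apply/eqP; rewrite eq_complex /= addr0 !eqxx.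
have hn0 : h.[c] != 0 by rewrite -cmod_gt0 hc pos_1norm.
have hJ := @Jensen_le R h c r (fun t => 1 + enorm (line a b (circle_point c r t))) r0 hn0.
rewrite hc in hJ; apply: hJ.
- move=> t.
  have c1 : {for t, continuous (fun t => enorm (line a b (circle_point c r t)))}.
    apply: (@continuous_comp _ _ _ (fun t => line a b (circle_point c r t)) (@enorm R n)).
      by rewrite line_pdisc; exact: circle_continuous i0 _ _ _ _.
    exact: enorm_continuous.
  rewrite (_ : (fun t => 1 + enorm (line a b (circle_point c r t))) =
    fun t => enorm (line a b (circle_point c r t)) + 1).
    exact: continuous_addc c1.
  by apply/funext => s; rewrite addrC.
- by move=> t; exact: pos_1norm.
- move=> t; rewrite hE; apply: le_trans (cmodD _ _) _; rewrite cmod1 lerD2l.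
  apply: le_trans (cmod_dot _ _) _; by rewrite ler_piMl ?enorm_ge0.
Qed.

Lemma exhaustion_psh : plurisubharmonic (~` wset) (EFin \o exhaustion).
Proof.
have T0 := T_gt0 R.
have usc : usc_on (~` wset) (EFin \o exhaustion).
  move=> z Ez c /=; rewrite lte_fin => zc.
  have := exhaustion_continuous Ez (lt_nbhsl zc) => /nbhs_Cn[e e0 he].
  by apply/nbhs_Cn; exists e => // w /he; rewrite lte_fin.
split=> // [z _|a b]; first exact: ltry.
split=> [z _|z Ez c zc|c r r0 hD]; first exact: ltry.
  by have := usc _ Ez _ zc; exact: (@line_continuous a b z).
pose f t := exhaustion (line a b (circle_point c r t)).
have Dt t : ~ wset (line a b (circle_point c r t)).
  by apply: hD => /=; rewrite cmod_circle_point.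
have lc : continuous (fun t => line a b (circle_point c r t)).
  by rewrite line_pdisc; exact: circle_continuous i0 _ _ _.
have cf : continuous f.
  move=> t; apply: (@continuous_comp _ _ _ (fun t => line a b (circle_point c r t)) exhaustion).
    exact: lc.
  exact: exhaustion_continuous.
have key : T * exhaustion (line a b c) <= J f 0 T.
  have m1 : T * - fine (phi (line a b c)) <= J f 0 T.
    have h := @phi_mean_eq R n i0 (gline a b) c r r0; rewrite -line_pdisc in h.
    have {}h := h (fun x xr => hD x xr).
    rewrite mulrN -h -mulN1r /J -RintegralZl//; last first.
      apply: continuous_integrable => t.
      apply: (@continuous_comp _ _ _ (fun t => line a b (circle_point c r t)) (fine \o phi)).
        exact: lc.
      exact: phi_continuous.
    apply: le_Rintegral => //.
    - apply: continuous_integrable => t.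
      apply: (@continuous_mulc R _ (fun t => fine (phi (line a b (circle_point c r t))))).
      apply: (@continuous_comp _ _ _ (fun t => line a b (circle_point c r t)) (fine \o phi)).
        exact: lc.
      exact: phi_continuous.
    - exact: continuous_integrable.
    - by move=> t _; rewrite /f /exhaustion mulN1r le_max lexx.
  have m2 : T * ln (1 + enorm (line a b c)) <= J f 0 T.
    apply: le_trans (ln_norm_mean _ _ _ r0) _; apply: le_J => //.
      move=> t; apply: (@continuous_comp _ _ _ (fun t => line a b (circle_point c r t))
        (fun z => ln (1 + enorm z))); first exact: lc.
      exact: ln_norm_continuous.
    by move=> t; rewrite /f /exhaustion le_max lexx orbT.
  rewrite /exhaustion; by case: (ltP (- fine (phi (line a b c)))).
rewrite /circle_mean.
have E2 : 2 * pi = T :> R by rewrite mulr_natl.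
have fin : (\int[@lebesgue_measure R]_(t in `[0%R, T]) (EFin \o exhaustion \o line a b)
   (circle_point c r t) = (J f 0 T)%:E)%E.
  rewrite /J /Rintegral fineK//; exact: integrable_fin_num (continuous_integrable 0 T cf).
rewrite E2 fin -EFinM lee_fin /=.
have Tn : T != 0 by rewrite gt_eqF.
by rewrite -[leLHS]mul1r -(mulVf Tn) -mulrA ler_pM2l ?invr_gt0.
Qed.

End Pluriharmonic.

(** * Connectedness and pseudoconvexity of the complement *)

Section FewRoots.
Variable R : realType.
Local Notation C := (complex R).

Definition height (x s : R) : C := Complex x s.

(** A polynomial of degree [d] is small, compared with its value at the origin,
    only near its roots, hence on at most [d] among well separated heights. *)
Lemma good_height (h : {poly C}) (d : nat) (rho : R) :
  (0 < d)%N -> (size h <= d.+1)%N -> h.[0] != 0 -> 0 < rho < 1 / 2 ->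
  9 * rho * d%:R <= 1 ->
  exists2 j, (j <= d)%N & forall x : R, 0 <= x <= 1 ->
    rho ^+ d * cmod h.[0] < cmod h.[height x (9 * rho * j%:R)].
Proof.
move=> d0 hd h0 /andP[rho0 rho1] rd; apply: contrapT => H.
have [a [s hs]] := poly_split h.
have a0 : a != 0 by apply: contraNneq h0 => a0; rewrite hs a0 scale0r horner0.
have size_s : (size s <= d)%N.
  by move: hd; rewrite hs size_scale// size_prod_XsubC ltnS.
have hE (w : C) : cmod h.[w] = cmod a * \prod_(z <- s) cmod (w - z).
  rewrite hs hornerZ cmodM; congr (_ * _).
  elim: (s) => [|y l IH]; first by rewrite !big_nil hornerE cmod1.
  by rewrite !big_cons hornerM cmodM IH !hornerE.
have ac : 0 < cmod a by rewrite cmod_gt0.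
have zn0 z : z \in s -> 0 < cmod z.
  move=> zs; rewrite cmod_gt0; apply: contraNneq h0 => z0.
  have : root (\prod_(z <- s) ('X - z%:P)) 0 by rewrite root_prod_XsubC -z0.
  by rewrite hs hornerZ => /eqP ->; rewrite mulr0.
(* otherwise every factor of h at w would exceed rho times the one at 0 *)
have near_root (w : C) : cmod w <= 2 -> cmod h.[w] <= rho ^+ d * cmod h.[0] ->
    exists2 z, z \in s & cmod (w - z) <= 4 * rho.
  move=> w2 hw.
  have [z zs hz] : exists2 z, z \in s & cmod (w - z) <= rho * cmod z.
    apply: contrapT => Hz.
    have Hz' z : z \in s -> rho * cmod z < cmod (w - z).
      by move=> zs; rewrite ltNge; apply/negP => hz; apply: Hz; exists z.
    move: hw; rewrite leNgt => /negP; apply.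
    rewrite !hE mulrCA ltr_pM2l//.
    have p1 : rho ^+ d * \prod_(z <- s) cmod (0 - z) <=
        rho ^+ size s * \prod_(z <- s) cmod (0 - z).
      rewrite ler_wpM2r//; first by apply: prodr_ge0 => z _; exact: cmod_ge0.
      by apply: ler_wiXn2l => //; lra.
    case: {+}s p1 Hz' zn0 => [|y l] p1 Hl l0.
      by rewrite !big_nil mulr1 exprn_ilt1 -?lt0n ?(ltW rho0)//; lra.
    apply: le_lt_trans p1 _.
    have -> : rho ^+ size (y :: l) * \prod_(z <- y :: l) cmod (0 - z) =
        \prod_(z <- y :: l) (rho * cmod z).
      elim: (y :: l) => [|x m IH]; first by rewrite !big_nil mulr1.
      by rewrite !big_cons -IH /= exprS sub0r cmodN; ring.
    rewrite !big_cons.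
    have tl : \prod_(z <- l) (rho * cmod z) <= \prod_(z <- l) cmod (w - z).
      rewrite !big_seq; apply: ler_prod => z zl.
      by rewrite mulr_ge0 ?cmod_ge0 ?(ltW rho0)//= ltW// Hl// inE zl orbT.
    have tp : 0 < \prod_(z <- l) cmod (w - z).
      rewrite big_seq; apply: prodr_gt0 => z zl.
      have zyl : z \in y :: l by rewrite inE zl orbT.
      by apply: lt_trans (Hl _ zyl); rewrite mulr_gt0// l0.
    have yl : y \in y :: l by rewrite inE eqxx.
    apply: (@le_lt_trans _ _ (rho * cmod y * \prod_(z <- l) cmod (w - z))).
      by rewrite ler_wpM2l// mulr_ge0 ?cmod_ge0// ltW.
    by rewrite ltr_pM2r// Hl.
  exists z => //.
  have z1 : rho * cmod z <= 1 / 2 * cmod z by rewrite ler_wpM2r ?cmod_ge0// ltW.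
  have := cmodB_ge z w; rewrite cmod_sub_sym => z2.
  have hz2 := le_trans hz z1.
  have z4 : cmod z <= 4 by lra.
  by apply: le_trans hz _; rewrite [rho * _]mulrC; apply: ler_wpM2r => //; exact: ltW.
have bad (j : 'I_d.+1) : exists z, z \in s /\
    exists x : R, cmod (height x (9 * rho * j%:R) - z) <= 4 * rho.
  apply: contrapT => Hj; apply: H; exists (val j); first exact: (ltn_ord j).
  move=> x /andP[x0 x1]; rewrite ltNge; apply/negP => hx.
  have w2 : cmod (height x (9 * rho * j%:R)) <= 2.
    apply: le_trans (cmod_le_ReIm _) _ => /=.
    have jd : 9 * rho * j%:R <= 9 * rho * d%:R.
      by rewrite ler_wpM2l ?mulr_ge0 ?(ltW rho0)// ler_nat; exact: (ltn_ord j).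
    rewrite !ger0_norm//; first by lra.
    by rewrite !mulr_ge0// ltW.
  by have [z zs hz] := near_root _ w2 hx; apply: Hj; exists z; split=> //; exists x.
have [f hf] := choice bad.
have finj : injective f.
  move=> j j' ff; have [_ [x hx]] := hf j; have [_ [x' hx']] := hf j'.
  rewrite -ff in hx'.
  have h1 := le_trans (cmod_Im _) hx; have h2 := le_trans (cmod_Im _) hx'.
  move: h1 h2; case: (f j) => p q /=; rewrite !ler_norml => /andP[a1 a2] /andP[b1 b2].
  apply: val_inj; apply/eqP; rewrite eqn_leq; apply/andP.
  have gap (u v : nat) : (u < v)%N -> 9 * rho * u%:R + 9 * rho <= 9 * rho * v%:R.
    move=> uv; rewrite -[X in _ + X]mulr1 -mulrDr natr1 ler_pM2l ?ler_nat//.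
    by rewrite mulr_gt0.
  by split; rewrite leqNgt; apply/negP => /gap; lra.
have un : uniq (map f (enum 'I_d.+1)) by rewrite map_inj_uniq// enum_uniq.
have := @uniq_leq_size _ _ s un; rewrite size_map size_enum_ord => le.
suff : (d.+1 <= d)%N by rewrite ltnn.
apply: leq_trans size_s; apply: le => _ /mapP[j _ ->]; by have [] := hf j.
Qed.

End FewRoots.

Section Connected.
Variables (R : realType) (n : nat) (i0 : 'I_n).
Local Notation C := (complex R).
Local Notation P_ := (@P_ R n i0).
Local Notation eta_ := (@eta_ R n i0).
Local Notation O_ := (@O_ R n i0).
Local Notation wset := (@wset R n i0).
Local Notation l_ := (@l_ R n i0).
Implicit Types (z v w a b : Cn R n) (k j m : nat) (s t r : R).

Lemma expR2_ge4 : 4 <= expR (2 : R).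
Proof.
have -> : (2 : R) = 1 + 1 by ring.
rewrite expRD; have := expR_ge1Dx (1 : R) => h.
have -> : (4 : R) = (1 + 1) * (1 + 1) by ring.
by apply: ler_pM => //; rewrite addr_ge0.
Qed.

(** On the set [P_ k] is at most [eta_ k], while its value at [a] is at least
    [expR (- c * 2 ^+ k)] with [c] fixed. As the degree is at most [2 ^ k],
    [good_height] applies with an arbitrarily small [rho]. *)
Lemma horizontal_path a b (e : R) : ~ wset a -> 0 < e ->
  exists2 s, 0 <= s < e & forall x : R, 0 <= x <= 1 -> ~ wset (line a b (height x s)).
Proof.
move=> /not_wset[k0 Ok0] e0.
pose c := Num.max 0 (2 ^- k0 - l_ k0 a).
have c0 : 0 <= c by rewrite le_max lexx.
have lk k : (k0 <= k)%N -> - c <= l_ k a.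
  move=> kk; have := l_cauchy Ok0 kk; rewrite ler_norml => /andP[h _].
  have h2 : 2 ^- k0 - l_ k0 a <= c by rewrite le_max lexx orbT.
  have := exp2V_gt0 R k; lra.
have ec0 := expR_gt0 c.
pose M := 9 * expR c; have M0 : 0 <= M by rewrite mulr_ge0// ltW.
pose e1 := Num.min (1 / 3) e.
have e10 : 0 < e1 by rewrite lt_min e0 divr_gt0.
have [k1 hk1] := exp2V_small M0 e10.
have [k2 hk2] := norm_lt_nat a; have [k3 hk3] := norm_lt_nat b.
pose k := (k0 + k1 + (k2 + k3 + k3))%N.
have kk0 : (k0 <= k)%N by rewrite /k -addnA leq_addr.
have kk1 : (k1 <= k)%N by rewrite /k addnAC leq_addl.
pose rho := expR (c - 2 * k%:R).
have rho0 : 0 < rho by exact: expR_gt0.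
have rhoE : 2 ^+ k * rho <= expR c * 2 ^- k.
  rewrite /rho expRD expRN mulrCA ler_pM2l//.
  rewrite ler_pdivrMr ?expR_gt0// ler_pdivlMl ?exprn_gt0//.
  rewrite [2 * k%:R]mulrC expRM_natl -exprMn.
  apply: lerXn2r; rewrite ?nnegrE ?mulr_ge0 ?expR_ge0//.
  by have := expR2_ge4; lra.
have rho9 : 9 * rho * 2 ^+ k < e1.
  by apply: le_lt_trans (hk1 k kk1); rewrite /M -!mulrA ler_pM2l// mulrC.
have p2 : 1 <= 2 ^+ k :> R by rewrite exprn_ege1// ler1n.
have e13 : e1 <= 1 / 3 by rewrite ge_min lexx.
have e1e : e1 <= e by rewrite ge_min lexx orbT.
have rho2 : 0 < rho < 1 / 2.
  rewrite rho0 /=; have : rho <= rho * 2 ^+ k by rewrite ler_peMr// ltW.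
  lra.
pose h := pcomp (gline a b) (P_ k).
have hE (w : C) : h.[w] = pev (P_ k) (line a b w) by rewrite line_pdisc pev_pdisc.
have h0E : h.[0] = pev (P_ k) a by rewrite hE /line scale0r addr0.
have Ok : O_ k a by exact: O_sub Ok0.
have h00 : h.[0] != 0 by rewrite h0E P_neq0.
have hs : (size h <= (2 ^ k).+1)%N.
  apply: leq_trans (size_pcomp _ _) _; first exact: size_gline.
  by rewrite ltnS pdeg_P.
have d1 : 9 * rho * (2 ^ k)%N%:R <= 1 by rewrite natrX; lra.
have d2 : (0 < 2 ^ k)%N by rewrite expn_gt0.
have [j jd hj] := good_height d2 hs h00 rho2 d1.
exists (9 * rho * j%:R).
  rewrite !mulr_ge0 ?(ltW rho0)//=; apply: lt_le_trans e1e.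
  apply: le_lt_trans rho9; rewrite ler_pM2l ?mulr_gt0//.
  by rewrite -natrX ler_nat.
move=> x /andP[x0 x1] Ex; have := hj x; rewrite x0 x1 => /(_ isT).
rewrite ltNge => /negP; apply; rewrite hE.
have nk : enorm (line a b (height x (9 * rho * j%:R))) <= k%:R.
  apply: le_trans (enormD _ _) _; rewrite enormZ.
  have cw : cmod (height x (9 * rho * j%:R)) <= 2.
    apply: le_trans (cmod_le_ReIm _) _ => /=.
    have jd' : 9 * rho * j%:R <= 9 * rho * (2 ^ k)%N%:R.
      by rewrite ler_wpM2l ?mulr_ge0 ?(ltW rho0)// ler_nat.
    rewrite !ger0_norm//; first by lra.
    by rewrite !mulr_ge0// ltW.
  have := ler_wpM2r (enorm_ge0 b) cw.
  have : (k2 + k3 + k3)%N%:R <= k%:R :> R by rewrite ler_nat leq_addl.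
  rewrite !natrD; lra.
apply: le_trans (Ex k nk) _; rewrite h0E.
have P0 : 0 < cmod (pev (P_ k) a) by rewrite cmod_gt0 P_neq0.
rewrite -ler_ln ?posrE ?eta_gt0 ?mulr_gt0 ?exprn_gt0//.
rewrite lnM ?posrE ?exprn_gt0// lnXn// /rho expRK -[_ *+ (2 ^ k)]mulr_natr natrX.
rewrite -(ler_pM2l (exp2V_gt0 R k)) mulrDr.
have -> : 2 ^- k * ((c - 2 * k%:R) * 2 ^+ k) = c - 2 * k%:R.
  by field; rewrite expf_neq0.
have := lk k kk0; have := ln_eta_le R i0 k; rewrite /l_; lra.
Qed.

Lemma connected_image_segment (X : topologicalType) (f : R -> X) :
  continuous f -> connected (f @` `[0, 1]%classic).
Proof.
move=> cf; apply: connected_continuous_connected; last exact: continuous_subspaceT.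
exact: segment_connected.
Qed.

Lemma height_continuous (f g : R -> R) : continuous f -> continuous g ->
  continuous (fun t => height (f t) (g t) : Cx R).
Proof. by move=> cf cg t; exact: continuous_Complex (cf t) (cg t). Qed.

(** Two points are joined in the complex line through them, by a short vertical
    segment at either end and a horizontal one in between. *)
Lemma compl_connected : connected (~` wset).
Proof.
have [->|/set0P[a Ea]] := eqVneq (~` wset) set0; first exact: connected0.
suff <- : connected_component (~` wset) a = ~` wset by exact: component_connected.
apply/seteqP; split; first exact: connected_component_sub.
move=> z Ez; pose b := z - a.
have L0 : line a b 0 = a by rewrite /line scale0r addr0.
have L1 : line a b 1 = z by rewrite /line scale1r addrC subrK.
have cL := @line_continuous R n i0 a b.
have /nbhs_Cx[d1 d10 hd1] : nbhs (0 : Cx R) (line a b @^-1` (~` wset)).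
  by apply: cL; rewrite L0; exact: near_compl Ea.
have /nbhs_Cx[d2 d20 hd2] : nbhs (1 : Cx R) (line a b @^-1` (~` wset)).
  by apply: cL; rewrite L1; exact: near_compl Ez.
have d0 : 0 < Num.min d1 d2 by rewrite lt_min d10 d20.
have [s /andP[s0 sd] hs] := horizontal_path b Ea d0.
move: sd; rewrite lt_min => /andP[sd1 sd2].
pose f1 t := line a b (height 0 (t * s)).
pose f2 t := line a b (height t s).
pose f3 t := line a b (height 1 (t * s)).
have cM : continuous (fun t : R => t * s).
  by move=> t; apply: cvgM; [exact: cvg_id|exact: cvg_cst].
have cid : continuous (fun t : R => t) by move=> t; exact: cvg_id.
have ccst (x : R) : continuous (fun _ : R => x) by exact: cst_continuous.
have cf (f g : R -> R) : continuous f -> continuous g ->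
    continuous (fun t => line a b (height (f t) (g t))).
  move=> cf cg t.
  have h1 := @height_continuous f g cf cg t.
  have h2 := @cL (height (f t) (g t)).
  have h3 := @continuous_comp _ _ _ (fun t => height (f t) (g t) : Cx R) (line a b) t h1 h2.
  exact: h3.
have c1 : connected (f1 @` `[0, 1]%classic).
  exact: connected_image_segment (cf _ _ (ccst 0) cM).
have c2 : connected (f2 @` `[0, 1]%classic).
  exact: connected_image_segment (cf _ _ cid (ccst s)).
have c3 : connected (f3 @` `[0, 1]%classic).
  exact: connected_image_segment (cf _ _ (ccst 1) cM).
have i1 : `[0, 1]%classic (1 : R) by rewrite /= in_itv /= ler01 lexx.
have i0' : `[0, 1]%classic (0 : R) by rewrite /= in_itv /= ler01 lexx.
have n12 : (f1 @` `[0, 1]%classic `&` f2 @` `[0, 1]%classic) !=set0.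
  exists (line a b (height 0 s)).
  split; [exists 1; [exact: i1|by rewrite /f1 mul1r]|].
  by exists 0; [exact: i0'|rewrite /f2].
have c12 := connectedU n12 c1 c2.
have n123 : ((f1 @` `[0, 1]%classic `|` f2 @` `[0, 1]%classic)
    `&` f3 @` `[0, 1]%classic) !=set0.
  exists (line a b (height 1 s)).
  split; [|exists 1; [exact: i1|by rewrite /f3 mul1r]].
  by right; exists 1; [exact: i1|rewrite /f2].
have c123 := connectedU n123 c12 c3.
apply: (connected_component_max (x := a) _ _ c123).
- by left; left; exists 0; [exact: i0'|rewrite /f1 mul0r -[height 0 0]/(0 : C)].
- have small t : 0 <= t <= 1 -> cmod (height 0 (t * s)) <= s.
    move=> /andP[t0 t1]; apply: le_trans (cmod_le_ReIm _) _ => /=.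
    by rewrite normr0 add0r ger0_norm ?mulr_ge0// ler_piMl.
  move=> _ [[] |] [t /= t01 <-]; rewrite in_itv /= in t01.
  + by apply: hd1; rewrite subr0; apply: le_lt_trans (small t t01) _.
  + exact: hs.
  + apply: hd2; rewrite (_ : height 1 (t * s) - 1 = height 0 (t * s)).
      by apply: le_lt_trans (small t t01) _.
    by apply/eqP; rewrite eq_complex /= subrr subr0 !eqxx.
- by right; exists 0; [exact: i0'|rewrite /f3 mul0r -[height 1 0]/(1 : C)].
Qed.

Lemma compl_pseudoconvex : pseudoconvex_domain (~` wset).
Proof.
split; [exact: open_compl|exact: compl_connected|].
exists (exhaustion i0); split; [|exact: exhaustion_psh|].
  apply: continuous_in_subspaceT => z; rewrite inE => Ez; exact: exhaustion_continuous.
move=> c S.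
have cS : closure S `<=` [set z | enorm z <= expR c].
  rewrite closureE => z; apply; split; first exact: closed_cball.
  move=> w [_ /= wc]; have : ln (1 + enorm w) < c.
    by apply: le_lt_trans wc; rewrite le_max lexx orbT.
  rewrite -ltr_expR lnK ?posrE ?pos_1norm//; lra.
split.
  apply: subclosed_compact cS; [exact: closed_closure|exact: compact_cball].
move=> z zS Ez.
have pz : (phi i0 z < (- c)%:E)%E by rewrite phi_wset// ltNyr.
have [w [[Ew wc] pw]] := zS _ (phi_usc I pz).
have : - fine (phi i0 w) < c by apply: le_lt_trans wc; rewrite le_max lexx.
have [k Ok] := (not_wset i0 w).1 Ew.
by move: pw; rewrite -(fineK (phi_fin Ok)) lte_fin; lra.
Qed.

End Connected.

(** * Absence of analytic structure *)

Section NoSquareRoot.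
Variable R : realType.
Local Notation T := (pi *+ 2 : R).

Lemma cisN (t : R) : cis (- t) * cis t = 1.
Proof.
by rewrite -cis_add addNr /cis cos0 sin0.
Qed.

(** Turning [f t] back by half of the angle [t] gives a curve whose squares have a
    positive real part. Its own real part thus keeps its sign, but over the whole
    period half a turn reverses it. *)
Lemma no_circle_sqrt (f : R -> Cx R) : continuous f -> f T = f 0 ->
  ~ (forall t, cmod (f t ^+ 2 - cis t) < 1).
Proof.
move=> cf fT H.
pose s t : Cx R := f t * cis (- (t / 2)).
have s2 t : s t ^+ 2 = 1 + (f t ^+ 2 - cis t) * cis (- t).
  rewrite /s exprMn [cis _ ^+ 2]expr2 -cis_add (_ : - (t / 2) + - (t / 2) = - t); last by field.
  by rewrite mulrBl [cis t * _]mulrC cisN; ring.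
have Re_s t : complex.Re (s t) != 0.
  apply/eqP => s0.
  have h1 : complex.Re (s t ^+ 2) <= 0.
    rewrite expr2; case: (s t) s0 => x y /= ->; rewrite mul0r sub0r oppr_le0 -expr2.
    exact: sqr_ge0.
  have h2 : cmod ((f t ^+ 2 - cis t) * cis (- t)) < 1 by rewrite cmodM cmod_cis mulr1.
  move: h1; rewrite s2 ReD.
  have := Re_geN_cmod ((f t ^+ 2 - cis t) * cis (- t)).
  rewrite (_ : complex.Re (1 : Cx R) = 1)//; lra.
have sT : s T = - s 0.
  rewrite /s fT mul0r oppr0 (_ : T / 2 = pi); last by rewrite -mulr_natr; field.
  have h := cis_pi (- pi : R); rewrite addNr in h.
  by rewrite h mulrN opprK.
have cs : continuous (fun t => complex.Re (s t)).
  move=> t; apply: (@continuous_comp _ _ _ s (fun z : Cx R => complex.Re z)); last exact: Re_continuous.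
  apply: (@cvgM (Cx R) R _ _ f (fun t => cis (- (t / 2)))); first exact: cf.
  apply: (@continuous_comp _ _ _ (fun t : R => - (t / 2)) (@cis R)); last exact: cis_continuous.
  by apply: cvgN; apply: cvgMr_tmp; exact: cvg_id.
have [t _ t0] : exists2 t, t \in `[0, T] & complex.Re (s t) = 0.
  apply: (@IVT R (fun t => complex.Re (s t)) 0 T 0); first exact: ltW (T_gt0 R).
    exact: continuous_subspaceT.
  rewrite sT (_ : complex.Re (- s 0) = - complex.Re (s 0)); last by case: (s 0).
  move: (complex.Re (s 0)) => x; rewrite ge_min le_max; apply/andP; split; apply/orP; case: (lerP 0 x); lra.
by move: (Re_s t); rewrite t0 eqxx.
Qed.

Lemma cratr_dense (y : Cx R) (d : R) : 0 < d -> exists a, cmod (y - cratr R a) < d.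
Proof.
move=> d0; case: y => y1 y2.
have hh (x : R) : x - d / 2 < x + d / 2 by lra.
have [a1] := rat_in_itvoo (hh y1); have [a2] := rat_in_itvoo (hh y2).
rewrite !in_itv/= => /andP[h1 h2] /andP[h3 h4].
exists (a1, a2); apply: le_lt_trans (cmod_le_ReIm _) _ => /=.
have : `|y1 - ratr a1| < d / 2 by rewrite ltr_norml; apply/andP; split; lra.
have : `|y2 - ratr a2| < d / 2 by rewrite ltr_norml; apply/andP; split; lra.
lra.
Qed.

End NoSquareRoot.

Section NoCurve.
Variables (R : realType) (n : nat) (i0 : 'I_n).
Local Notation wset := (@wset R n i0).
Local Notation P_ := (@P_ R n i0).
Local Notation eta_ := (@eta_ R n i0).
Local Notation eps_ := (@eps_ R n i0).

Lemma pev_qexp i j a (z : Cn R n) :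
  pev (qexp R ((i, j), a)) z = z 0 i * (z 0 j - cratr R a).
Proof. by []. Qed.

Lemma rel_error (X Y : Cx R) : cmod X <= 1 / 8 -> cmod Y <= 1 / 4 ->
  cmod ((1 + X) * (1 + Y) - 1) < 1 / 2.
Proof.
move=> hX hY; rewrite (_ : _ - 1 = X + Y + X * Y); last by ring.
have := cmodD (X + Y) (X * Y); have := cmodD X Y; rewrite cmodM.
have := ler_pM (cmod_ge0 _) (cmod_ge0 _) hX hY; lra.
Qed.

(** With [v] the derivative at the base point, choose coordinates with [v 0 j] and
    [g 0 0 i] nonzero: along the curve, [z_i * (z_j - a)] is close to a multiple of
    the parameter on a small circle, if [a] is close to the base point. For a late
    [k] with this [q_ k], [P_ k ^+ 2] is close to [eps_ k * q_ k] on the set, since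
    [P_ k.+1] is at most [eps_ k * 2 ^- k]; so [P_ k] yields a square root that
    [no_circle_sqrt] excludes. *)
Lemma wset_no_curve (g : Cx R -> Cn R n) (v : Cn R n) (rho : R) : 0 < rho ->
  (forall x, cmod x < rho -> wset (g x) /\ {for x, continuous g}) ->
  (forall e : R, 0 < e -> exists2 d : R, 0 < d &
    forall x, cmod x < d -> enorm (g x - g 0 - x *: v) <= e * cmod x) ->
  v != 0 -> g 0 != 0 -> False.
Proof.
move=> rho0 Hg Hd /rV0Pn[j c0] /rV0Pn[i b0].
set c : Cx R := v 0 j in c0; set b : Cx R := g 0 0 i in b0.
have cp : 0 < cmod c by rewrite cmod_gt0.
have bp : 0 < cmod b by rewrite cmod_gt0.
(* the relative errors will be at most 1 / 8 for z_j - a and 1 / 4 for z_i *)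
pose e : R := cmod c / 16; have e0 : 0 < e by rewrite divr_gt0.
have [d d0 hd] := Hd e e0.
have v0 := enorm_ge0 v.
pose r := Num.min (rho / 2) (Num.min (d / 2) (cmod b / (4 * (enorm v + e)))).
have ve : 0 < enorm v + e by lra.
have r0 : 0 < r by rewrite !lt_min !divr_gt0// mulr_gt0.
have r1 : r <= rho / 2 by rewrite ge_min lexx.
have r2 : r <= d / 2 by rewrite /r !ge_min lexx orbT.
have r3 : r * (enorm v + e) <= cmod b / 4.
  have -> : cmod b / 4 = cmod b / (4 * (enorm v + e)) * (enorm v + e).
    by field; rewrite gt_eqF.
  by rewrite ler_pM2r// /r !ge_min lexx !orbT.
have [a ha] := cratr_dense (g 0 0 j) (mulr_gt0 e0 r0).
have bc0 : 0 < cmod b * cmod c * r by rewrite !mulr_gt0.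
have ib0 : 0 < (cmod b * cmod c * r)^-1 by rewrite invr_gt0.
have [m1 hm1] := @exp2V_small R _ (1 / 2) (ltW ib0) ltac:(lra).
have [m2 hm2] : exists m, enorm (g 0) + (enorm v + e) * r < m%:R 
  by exists (Num.bound (enorm (g 0) + (enorm v + e) * r)); apply: archi_boundP; rewrite addr_ge0 ?enorm_ge0// mulr_ge0// ltW.
have [k km qk] := qidx_frequent i0 (i, j, a) (maxn m1 m2).
pose zt t : Cx R := ofreal r * cis t.
have zr t : cmod (zt t) = r by rewrite /zt cmodM cmod_cis mulr1 cmod_ofreal gtr0_norm.
have zrho t : cmod (zt t) < rho by rewrite zr; lra.
have err t : enorm (g (zt t) - g 0 - zt t *: v) <= e * r.
  by rewrite -[X in e * X](zr t); apply: hd; rewrite zr; lra.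
have coordj t : exists2 X : Cx R, cmod X <= 1 / 8 &
    g (zt t) 0 j - cratr R a = c * zt t * (1 + X).
  pose x : Cx R := (g (zt t) - g 0 - zt t *: v) 0 j + (g 0 0 j - cratr R a).
  exists (x / (c * zt t)).
    rewrite cmodM cmodV cmodM zr ler_pdivrMr ?mulr_gt0//.
    have h1 : cmod ((g (zt t) - g 0 - zt t *: v) 0 j) <= e * r.
      exact: le_trans (cmod_enorm _ _) (err t).
    apply: le_trans (cmodD _ _) _; move: h1 ha; rewrite /e; lra.
  have z0 : zt t != 0 by rewrite -cmod_gt0 zr.
  rewrite mulrDr mulr1 [_ * (x / _)]mulrC divfK ?(mulf_neq0 c0 z0)// /x !mxE -/c; ring.
have coordi t : exists2 Y : Cx R, cmod Y <= 1 / 4 & g (zt t) 0 i = b * (1 + Y).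
  exists ((g (zt t) - g 0) 0 i / b).
    rewrite cmodM cmodV ler_pdivrMr//; apply: le_trans (cmod_enorm _ _) _.
    have -> : g (zt t) - g 0 = (g (zt t) - g 0 - zt t *: v) + zt t *: v by rewrite subrK.
    apply: le_trans (enormD _ _) _; rewrite enormZ zr; have := err t; lra.
  rewrite mulrDr mulr1 [b * (_ / _)]mulrC divfK// !mxE -/b; ring.
have gk t : enorm (g (zt t)) <= k.+1%:R.
  have -> : g (zt t) = g 0 + ((g (zt t) - g 0 - zt t *: v) + zt t *: v).
    by rewrite subrK addrC subrK.
  have := enormD (g 0) ((g (zt t) - g 0 - zt t *: v) + zt t *: v).
  have := enormD (g (zt t) - g 0 - zt t *: v) (zt t *: v).
  rewrite enormZ zr.
  have : m2%:R <= k.+1%:R :> R.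
    by rewrite ler_nat ltnW// ltnS (leq_trans _ km)// leq_maxr.
  have := err t; lra.
have ek : 0 < eps_ k by exact: eps_gt0.
pose D : Cx R := ofreal (eps_ k) * ofreal r * (b * c).
have D0 : cmod D = eps_ k * (cmod b * cmod c * r).
  by rewrite /D !cmodM !cmod_ofreal !gtr0_norm//; ring.
have Dn0 : D != 0 by rewrite -cmod_gt0 D0 mulr_gt0.
have [K K2] : exists K : Cx R, K ^+ 2 = D by exists (sqrtc D); exact: sqr_sqrtc.
have Kn0 : K != 0 by apply: contraNneq Dn0 => K0; rewrite -K2 K0 expr0n.
pose f t : Cx R := pev (P_ k) (g (zt t)) / K.
apply: (@no_circle_sqrt R f).
- move=> t; rewrite /f.
  apply: (@cvgM (Cx R) R _ _ (fun t => pev (P_ k) (g (zt t))) (fun=> K^-1)); last exact: cvg_cst.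
  apply: (@continuous_comp _ _ _ (fun t : R => g (zt t)) (pev (P_ k))); last exact: pev_continuous.
  apply: (@continuous_comp _ _ _ zt g); last by have [] := Hg _ (zrho t).
  apply: (@cvgM (Cx R) R _ _ (fun=> ofreal r) (@cis R)); first exact: cvg_cst.
  exact: cis_continuous.
- by rewrite /f /zt -{1}[pi *+ 2]add0r cis_2pi.
- move=> t; have [X hX eX] := coordj t; have [Y hY eY] := coordi t.
  have -> : f t ^+ 2 - cis t =
      pev (P_ k.+1) (g (zt t)) / D + cis t * ((1 + X) * (1 + Y) - 1).
    rewrite /f expr_div_n K2 pev_P_S /q_ qk pev_qexp eX eY.
    have Dn0' : ofreal (eps_ k) * ofreal r * (b * c) != 0 by [].
    rewrite /D /zt; field; move: Dn0'.
    by rewrite !mulf_eq0 !negb_or => /andP[/andP[-> ->] /andP[-> ->]].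
  apply: le_lt_trans (cmodD _ _) _.
  have h1 := rel_error hX hY.
  rewrite [cmod (cis t * _)]cmodM cmod_cis mul1r.
  have [Ew _] := Hg _ (zrho t); have := Ew k.+1 (gk t).
  rewrite eta_S => h2.
  have : cmod (pev (P_ k.+1) (g (zt t)) / D) < 1 / 2.
    rewrite cmodM cmodV D0 ltr_pdivrMr ?mulr_gt0//.
    apply: le_lt_trans h2 _.
    have k1 : (m1 <= k)%N by rewrite (leq_trans _ km)// leq_maxl.
    have := hm1 k k1; rewrite mulrC ltr_pdivrMr// => h3.
    rewrite [ltRHS](_ : _ = eps_ k * (1 / 2 * (cmod b * cmod c * r))); last by ring.
    by rewrite ltr_pM2l.
  lra.
Qed.

(** The affine case, which shows that the set has no interior. *)
Lemma wset_no_line (x v : Cn R n) (rho : R) : 0 < rho -> v != 0 -> x != 0 ->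
  ~ (forall s : Cx R, cmod s < rho -> wset (x + s *: v)).
Proof.
move=> rho0 v0 x0 H.
apply: (@wset_no_curve (fun s : Cx R => x + s *: v) v rho rho0 _ _ v0 _).
- by move=> s hs; split; first exact: H;
  have := @pdisc_continuous R n i0 (gline x v) s; rewrite -line_pdisc; exact: id.
- move=> e e0; exists 1 => // s _.
  rewrite scale0r addr0 [x + _]addrC addrK subrr enorm0 mulr_ge0 ?cmod_ge0//; exact: ltW.
- by rewrite scale0r addr0.
Qed.

End NoCurve.

Section NoVariety.
Variables (R : realType) (n : nat) (i0 : 'I_n).
Local Notation C := (complex R).
Local Notation wset := (@wset R n i0).

Lemma derive_estimate (G : Cn R n -> Cn R n) (w e1 : Cn R n) : differentiable G w ->
  forall e : R, 0 < e -> exists2 d : R, 0 < d & forall s : C, cmod s < d ->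
    enorm (G (w + s *: e1) - G w - s *: 'D_e1 G w) <= e * cmod s.
Proof.
move=> dG e e0.
have h : derivable G w e1 by exact: (@diff_derivable _ _ _ G w e1 dG).
have : nbhs ('D_e1 G w) [set y | enorm (y - 'D_e1 G w) < e].
  by apply/nbhs_Cn; exists e => // y; rewrite subrr.
move=> /h /= /nbhs_Cx[d d0 hd]; exists d => // s sd.
have [->|s0] := eqVneq s 0.
  by rewrite !scale0r addr0 subrr subr0 enorm0 cmod0 mulr0.
have := hd s; rewrite subr0 => /(_ sd s0) /=; rewrite [s *: e1 + w]addrC => /ltW h1.
have -> : G (w + s *: e1) - G w - s *: 'D_e1 G w =
    s *: (s^-1 *: (G (w + s *: e1) - G w) - 'D_e1 G w).
  by rewrite scalerBr scalerA divff// scale1r.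
rewrite enormZ mulrC; apply: ler_wpM2r; [exact: cmod_ge0|exact: h1].
Qed.

(** The inverse chart of a regular point gives a curve in the set, with a nonzero
    derivative since the chart is invertible. Should the curve start at the origin,
    it is moved to another starting point, which differs from the origin as the
    inverse chart is injective. *)
Lemma no_variety : ~ contains_positive_dim_variety wset.
Proof.
move=> [U [A [_ _ [d [a [d0 [Aa [dn [V [W [F [G [[oV Va oW] [hF hG FV GF FA]]]]]]]]]]]] AE]].
have n0 : (0 < n)%N by exact: leq_trans d0 dn.
pose e1 : Cn R n := delta_mx 0 (Ordinal n0).
have ne1 : enorm e1 = 1 by exact: enorm_delta.
have FG w : W w -> F (G w) = w by rewrite -FV => -[z Vz <-]; rewrite GF.
have GV w : W w -> V (G w) by rewrite -FV => -[z Vz <-]; rewrite GF.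
pose S := [set w : Cn R n | forall i : 'I_n, (d <= i)%N -> w 0 i = 0].
have GE w : W w -> S w -> wset (G w).
  move=> Ww Sw; have : (W `&` S) w by [].
  by rewrite -FA => -[z [Az Vz] <-]; rewrite GF//; exact: AE.
have SD w s : S w -> S (w + s *: e1).
  move=> Sw i di; rewrite !mxE Sw// add0r /=.
  by case: eqP => [ii|_]; rewrite ?mulr0//; move: di; rewrite ii /= leqNgt d0.
have Wrho w : W w -> exists2 rho : R, 0 < rho & forall s, cmod s < rho -> W (w + s *: e1).
  move=> Ww; have /nbhs_Cn[rho r0 hr] : nbhs w W by exact: open_nbhs_nbhs.
  by exists rho => // s hs; apply: hr; rewrite addrC addKr enormZ ne1 mulr1.
have [w0 Ww0 Sw0] : exists2 w, W w & S w.
  have : (F @` (A `&` V)) (F a) by exists a.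
  by rewrite FA => -[]; exists (F a).
have [w [Ww Sw Gw]] : exists w, [/\ W w, S w & G w != 0].
  have [G0|G0] := eqVneq (G w0) 0; last by exists w0.
  have [rho r0 hr] := Wrho _ Ww0.
  exists (w0 + ofreal (rho / 2) *: e1).
  have hW : W (w0 + ofreal (rho / 2) *: e1).
    by apply: hr; rewrite cmod_ofreal ger0_norm; lra.
  split; [by []|exact: SD|].
  rewrite -G0; apply/eqP => /(congr1 F); rewrite !FG// => /eqP.
  rewrite -subr_eq0 addrC addKr => /eqP /(congr1 (@enorm R n)).
  by rewrite enormZ ne1 enorm0 mulr1 cmod_ofreal ger0_norm; lra.
have [rho r0 hr] := Wrho _ Ww.
have hwe s : w + s *: e1 = line w e1 s by [].
have dG := hG _ Ww; have dF := hF _ (GV _ Ww).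
apply: (@wset_no_curve R n i0 (fun s => G (w + s *: e1)) ('D_e1 G w) rho r0).
- move=> s hs; split; first by apply: GE; [exact: hr|exact: SD].
  apply: (@continuous_comp _ _ _ (line w e1) G).
    by rewrite line_pdisc; exact: (@pdisc_continuous R n i0).
  exact: differentiable_continuous (hG _ (hr _ hs)).
- move=> e e0; have [dd dd0 hdd] := derive_estimate e1 dG e0.
  by exists dd => // s hs; rewrite scale0r addr0; exact: hdd.
- apply/eqP => D0.
  have h1 : 'D_e1 (F \o G) w = 0.
    have hc : 'd (F \o G) w e1 = 'd F (G w) ('d G w e1).
      have E := @diff_comp C _ _ _ G F w dG dF.
      exact: (congr1 (fun L : Cn R n -> Cn R n => L e1) E).
    have hd := @differentiable_comp C _ _ _ G F w dG dF.
    apply: etrans (@deriveE C _ _ _ w e1 hd) _; apply: etrans hc _.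
    have E0 := esym (@deriveE C _ _ _ w e1 dG).
    apply: etrans (congr1 (fun y => 'd F (G w) y) (etrans E0 D0)) _.
    exact: linear0.
  have : 'D_e1 (F \o G) w = e1.
    rewrite -[RHS](derive_id w e1); apply: near_eq_derive.
    by apply: filterS (open_nbhs_nbhs (conj oW Ww)) => y /FG.
  rewrite h1 => /(congr1 (@enorm R n)); rewrite ne1 enorm0; lra.
- by rewrite scale0r addr0.
Qed.

End NoVariety.

(** * Quadratic polynomials *)

Section Quadratic.
Variables (R : realType) (n : nat).
Implicit Types (a h k u v : Cn R n) (S : 'M[Cx R]_n).

Lemma cconjZ (c : Cx R) h : cconj (c *: h) = (conjc c : Cx R) *: cconj h.
Proof. by apply/rowP => i; rewrite !mxE; exact: (rmorphM (@conjc R)). Qed.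

Lemma cconjK h : cconj (cconj h) = h.
Proof. by apply/rowP => i; rewrite !mxE; case: (h 0 i) => x y /=; rewrite opprK. Qed.

Lemma orthogonal_ex a : (2 <= n)%N -> exists2 v, v != 0 & dot a v = 0.
Proof.
move=> n2; have [->|/rV0Pn[j aj]] := eqVneq a 0.
  exists (delta_mx 0 (Ordinal n2)); last by rewrite dot0l.
  by rewrite -enorm_gt0 enorm_delta.
have [i ij] : exists i : 'I_n, i != j.
  have [j0|j0] := eqVneq (nat_of_ord j) 0%N.
    by exists (Ordinal n2); rewrite -val_eqE /= j0.
  exists (Ordinal (ltn_trans (ltnSn 0) n2)); rewrite -val_eqE /= eq_sym //.
exists (a 0 j *: delta_mx 0 i - a 0 i *: delta_mx 0 j).
  apply/rV0Pn; exists i; rewrite !mxE !eqxx/= (negPf ij) mulr1 mulr0 subr0//.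
rewrite dotDr dotNr !dotZr.
have dd (l : 'I_n) : dot a (delta_mx 0 l) = a 0 l.
  rewrite /dot (bigD1 l)//= big1 ?addr0 ?mxE ?eqxx ?mulr1//.
  by move=> m ml; rewrite mxE (negPf ml) andbF mulr0.
by rewrite !dd mulrC subrr.
Qed.

Lemma quad_expand S u v (x y : Cx R) :
  dot ((x *: v + y *: u) *m S) (x *: v + y *: u) =
  x ^+ 2 * dot (v *m S) v + x * y * (dot (v *m S) u + dot (u *m S) v)
  + y ^+ 2 * dot (u *m S) u.
Proof. rewrite mulmxDl -!scalemxAl dotDl !dotZl 2!dotDr !dotZr.
move: (dot _ _) (dot _ _) (dot _ _) (dot _ _) => p q r s; ring. Qed.

Lemma quad_continuous a S : continuous (fun h => complex.Re (dot a h + dot (h *m S) h)).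
Proof.
have [K K0 hK] := bilinear_bound S.
move=> h; apply/continuous_CnP => e e0.
pose M := enorm a + K * enorm h + K * (enorm h + 1) + 1.
have eh := enorm_ge0 h; have ea := enorm_ge0 a.
have K1 : 0 <= K * enorm h by rewrite mulr_ge0.
have K2 : 0 <= K * (enorm h + 1) by rewrite mulr_ge0//; lra.
have M0 : 0 < M by rewrite /M; lra.
exists (Num.min 1 (e / M)); first by rewrite lt_min ltr01 divr_gt0.
move=> w; rewrite lt_min => /andP[w1 we].
rewrite distrC -ReB; apply: le_lt_trans (cmod_Re _) _.
have -> : dot a w + dot (w *m S) w - (dot a h + dot (h *m S) h) =
    dot a (w - h) + dot ((w - h) *m S) w + dot (h *m S) (w - h).
  rewrite mulmxBl dotDl dotNl 2!dotDr 2!dotNr.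
  move: (dot a w) (dot a h) (dot (w *m S) w) (dot (h *m S) h) (dot (h *m S) w) => *; ring.
have wh : enorm w <= enorm h + 1 by have := enormB_ge w h; lra.
have d0 := enorm_ge0 (w - h).
have h1 := cmod_dot a (w - h).
have h2 : cmod (dot ((w - h) *m S) w) <= K * (enorm h + 1) * enorm (w - h).
  apply: le_trans (cmod_dot _ _) _; rewrite mulrAC.
  by apply: ler_pM => //; exact: enorm_ge0.
have h3 : cmod (dot (h *m S) (w - h)) <= K * enorm h * enorm (w - h).
  by apply: le_trans (cmod_dot _ _) _; apply: ler_wpM2r.
have := cmodD (dot a (w - h) + dot ((w - h) *m S) w) (dot (h *m S) (w - h)).
have := cmodD (dot a (w - h)) (dot ((w - h) *m S) w).
move: we; rewrite ltr_pdivlMr// /M => we; nra.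
Qed.

Lemma quad_norm_continuous a S (c : R) :
  continuous (fun h => complex.Re (dot a h + dot (h *m S) h) + c * enorm h ^+ 2).
Proof.
move=> h; have c1 := @quad_continuous a S h.
suff c2 : {for h, continuous (fun h : Cn R n => c * enorm h ^+ 2)} by exact: (cvgD c1 c2).
apply: (@continuous_mulc R _ (fun h : Cn R n => enorm h ^+ 2)).
apply: (@continuous_comp _ _ _ (@enorm R n) (fun x : R => x ^+ 2)).
  exact: enorm_continuous.
exact: exprn_continuous.
Qed.

Lemma dotE h k : dot h k = (h *m k^T) 0 0.
Proof. by rewrite mxE; apply: eq_bigr => i _; rewrite [k^T _ _]mxE. Qed.

Lemma dot_trmx S h k : dot (h *m S^T) k = dot (k *m S) h.
Proof.
by rewrite !dotE -mulmxA -(trmxK (h *m _)) mxE !trmx_mul !trmxK -mulmxA.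
Qed.

Lemma Re_dot_cconj_sym h k : complex.Re (dot (cconj h) k) = complex.Re (dot (cconj k) h).
Proof. have := enorm_sqrD h k; have := enorm_sqrD k h; rewrite [k + h]addrC; lra. Qed.

Lemma cconjB h k : cconj (h - k) = cconj h - cconj k.
Proof. by apply/rowP => i; rewrite !mxE; exact: (rmorphB (@conjc R)). Qed.

End Quadratic.

(** * Local maxima on the set and polynomial hulls *)

Section Touch.
Variables (R : realType) (n : nat) (i0 : 'I_n).
Hypothesis n2 : (2 <= n)%N.
Local Notation C := (complex R).
Local Notation wset := (@wset R n i0).
Local Notation P_ := (@P_ R n i0).
Local Notation eta_ := (@eta_ R n i0).
Local Notation O_ := (@O_ R n i0).
Local Notation l_ := (@l_ R n i0).
Local Notation phi := (@phi R n i0).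
Implicit Types (a h k u v : Cn R n) (S : 'M[Cx R]_n).

(** For late [k] the polynomial [P_ k] has no zeros on the disc, so that the lower
    bound on the circle holds at the center too; the constant [2] covers the
    differences of [l_ k0], [l_ k] and [phi]. *)
Lemma disc_bound (k0 : nat) (g : 'I_n -> {poly C}) (r : R) : 0 < r ->
  (forall c, cmod c <= r -> ~ wset (pdisc g c)) ->
  (forall c, cmod c = r -> O_ k0 (pdisc g c)) ->
  ((2 ^- k0 * ln (eta_ k0) - 2)%:E <= phi (pdisc g (0%R : Cx R)))%E.
Proof.
move=> r0 hd hc.
have : compact (pdisc g @` [set c | cmod c <= r]).
  apply: continuous_compact; last exact: compact_disc.
  by apply: continuous_subspaceT; exact: (@pdisc_continuous R n i0).
move=> /(@compact_O R n i0)[|k1 hk1]; first by move=> _ [c /= cr <-]; exact: hd.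
pose k := maxn k0 k1.
have Ok c : cmod c <= r -> O_ k (pdisc g c).
  by move=> cr; apply: (@O_sub R n i0 k1); [exact: leq_maxr|apply: hk1; exists c].
have h0 : O_ k (pdisc g (0%R : Cx R)) by apply: Ok; rewrite cmod0; exact: ltW.
have /andP[+ _] := phi_l_bounds h0; apply: le_trans; rewrite lee_fin.
have p0 : 0 < 2 ^- k :> R by exact: exp2V_gt0.
have p1 : 2 ^- k <= 1 :> R by exact: exp2V_le1.
suff : 2 ^- k0 * ln (eta_ k0) - 1 <= l_ k (pdisc g (0%R : Cx R)) by lra.
rewrite -(ler_pM2l (exprn_gt0 k (ltr0n R 2))) /l_ mulrA divff ?mul1r ?gt_eqF ?exprn_gt0//.
rewrite pev_pdisc; apply: (ln_poly_ge r0).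
  move=> c; rewrite subr0 => /Ok[_ hP]; rewrite -cmod_gt0 -pev_pdisc.
  by apply: lt_trans hP; exact: eta_gt0.
move=> c; rewrite subr0 => /hc Oc.
have := l_cauchy Oc (leq_maxl k0 k1); rewrite -/k ler_norml => /andP[h1 _].
have [_ hP] := Oc.
have h2 : 2 ^- k0 * ln (eta_ k0) <= l_ k0 (pdisc g c).
  by rewrite /l_ ler_pM2l ?exp2V_gt0// ler_ln ?posrE ?eta_gt0//; [exact: ltW|apply: lt_trans hP; exact: eta_gt0].
have q1 : 2 ^- k0 <= 1 :> R by exact: exp2V_le1.
have -> : ln (cmod (pcomp g (P_ k)).[c]) = 2 ^+ k * l_ k (pdisc g c).
  by rewrite /l_ mulrA divff ?mul1r ?gt_eqF ?exprn_gt0// pev_pdisc.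
rewrite ler_pM2l ?exprn_gt0//; lra.
Qed.

Lemma translation_continuous (x : Cn R n) : continuous (fun h => x + h).
Proof.
move=> h A /nbhs_Cn[e e0 he]; apply/nbhs_Cn; exists e => // w wh; apply: he.
by rewrite opprD addrACA subrr add0r.
Qed.

Lemma closed_le_cont (f : Cn R n -> R) (c : R) : continuous f -> closed [set h | c <= f h].
Proof.
move=> cf; apply: (@preimage_closed _ _ f [set x | c <= x]); last exact: closed_ge.
by move=> x _; exact: cf.
Qed.

(** [de] and [Z] stand for the height and the radius in the family of discs of
    [touch], and [s] for the modulus of the displacement along the normal. *)
Lemma disc_estimate (de Z s q D b c t ka V : R) : 0 <= de <= t -> 0 <= Z <= t ->
  0 <= s <= de + q * Z ^+ 2 -> 0 <= q -> 0 <= b -> 0 <= c -> 0 < t <= 1 ->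
  D = b + (1 + q) * c -> t * D <= 1 / 2 -> q * (t * D) <= ka * V ^+ 2 / 2 ->
  [/\ s <= t * (1 + q) & s * (Z * b + s * c) <= de / 2 + ka * V ^+ 2 / 2 * Z ^+ 2].
Proof.
move=> /andP[de0 det] /andP[Z0 Zt] /andP[s0 sb] q0 b0 c0 /andP[t0 t1] DE tD qtD.
have ZZ : Z ^+ 2 <= t.
  by rewrite expr2; apply: le_trans (ler_pM Z0 Z0 Zt (le_trans Zt t1)) _; rewrite mulr1.
have sA : s <= t * (1 + q).
  by apply: le_trans sb _; have := ler_wpM2l q0 ZZ; rewrite mulrDr mulr1 [t * q]mulrC; lra.
split=> //.
have h1 : Z * b + s * c <= t * D.
  rewrite DE; have := ler_wpM2r b0 Zt; have := ler_wpM2r c0 sA; lra.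
have D0 : 0 <= t * D.
  by rewrite DE mulr_ge0 ?(ltW t0)// addr_ge0// mulr_ge0// addr_ge0.
have h2 := ler_wpM2l s0 h1.
have h3 := ler_wpM2r D0 sb.
have h4 := ler_wpM2l de0 tD.
have h5 := ler_wpM2r (sqr_ge0 Z) qtD.
lra.
Qed.

(** A family of holomorphic discs descends to [x0] from outside, with boundaries that
    stay in a compact subset of the complement. Then [disc_bound] bounds [phi] from
    below along the centers, which tend to [x0], where [phi] is [-oo]: this
    contradicts upper semicontinuity. *)
Lemma touch (x0 a : Cn R n) S (ka rho : R) : a != 0 -> 0 < ka -> 0 < rho -> wset x0 ->
  ~ (forall h, enorm h < rho -> wset (x0 + h) ->
      complex.Re (dot a h + dot (h *m S) h) <= - ka * enorm h ^+ 2).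
Proof.
move=> a0 ka0 rho0 Ex0 HE.
have ea : 0 < enorm a by rewrite enorm_gt0.
pose A2 : Cx R := ofreal (enorm a ^+ 2).
have A20 : A2 != 0 by rewrite -cmod_gt0 cmod_ofreal gtr0_norm exprn_gt0.
(* v spans a direction in the kernel of the linear part, u is orthogonal to it *)
pose u : Cn R n := A2^-1 *: cconj a.
have au : dot a u = 1 by rewrite /u dotZr dotC dot_cconj mulVf.
have [v v0 av] := orthogonal_ex a n2.
pose V := enorm v; pose U := enorm u.
have V0 : 0 < V by rewrite enorm_gt0.
have U0 : 0 <= U by exact: enorm_ge0.
have ortho (x y : Cx R) : enorm (x *: v + y *: u) ^+ 2 =
    cmod x ^+ 2 * V ^+ 2 + cmod y ^+ 2 * U ^+ 2.
  have o : dot (cconj (y *: u)) (x *: v) = 0.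
    by rewrite /u scalerA cconjZ cconjK dotZl dotZr av !mulr0.
  by rewrite [x *: v + _]addrC enorm_sqrD o (enormZ y u) (enormZ x v) !exprMn -/V -/U /=; ring.
pose q : Cx R := dot (v *m S) v; pose c : Cx R := dot (u *m S) u.
pose b : Cx R := dot (v *m S) u + dot (u *m S) v.
pose D := cmod b + (1 + cmod q) * cmod c.
have q0 := cmod_ge0 q; have b0 := cmod_ge0 b; have c0 := cmod_ge0 c.
have D0 : 0 <= D by rewrite addr_ge0// mulr_ge0// addr_ge0.
have A0 : 0 <= V + (1 + cmod q) * U.
  by apply: addr_ge0; [exact: ltW|apply: mulr_ge0 => //; exact: addr_ge0].
have kV : 0 < ka * V ^+ 2 by rewrite mulr_gt0// exprn_gt0.
have [t [/andP[t0 t1] tD qtD trho]] : exists t : R, [/\ 0 < t <= 1, t * D <= 1 / 2,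
    cmod q * (t * D) <= ka * V ^+ 2 / 2 & t * (V + (1 + cmod q) * U) <= rho / 2].
  have y0 : 0 <= cmod q * D by rewrite mulr_ge0.
  pose d1 := 1 / (2 * D + 1); pose d2 := ka * V ^+ 2 / (2 * (cmod q * D) + 1).
  pose d3 := rho / (2 * (V + (1 + cmod q) * U) + 1).
  pose t := Num.min (Num.min 1 d1) (Num.min d2 d3).
  have t0 : 0 < t by rewrite !lt_min ltr01 !divr_gt0//; lra.
  have td1 : t <= d1 by rewrite /t !ge_min lexx !orbT.
  have td2 : t <= d2 by rewrite /t !ge_min lexx !orbT.
  have td3 : t <= d3 by rewrite /t !ge_min lexx !orbT.
  move: td1 td2 td3; rewrite !ler_pdivlMr; [|lra..] => td1 td2 td3.
  exists t; split; first by rewrite t0 /t !ge_min lexx.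
  - lra.
  - by rewrite mulrCA; lra.
  - lra.
(* the parabolic term cancels the quadratic part along v *)
pose hh (de : R) (x : Cx R) : Cn R n := x *: v + (ofreal de - q * x ^+ 2) *: u.
have key (de : R) (x : Cx R) : 0 <= de <= t -> cmod x <= t ->
    [/\ enorm (hh de x) <= rho / 2, cmod x * V <= enorm (hh de x) &
     de / 2 - ka / 2 * enorm (hh de x) ^+ 2 <=
       complex.Re (dot a (hh de x) + dot (hh de x *m S) (hh de x))].
  move=> de0 xt; pose s := ofreal de - q * x ^+ 2.
  have de00 : 0 <= de by case/andP: de0.
  have sle : cmod s <= de + cmod q * cmod x ^+ 2.
    by apply: le_trans (cmodB_le _ _) _; rewrite cmod_ofreal ger0_norm// cmodM cmodX.
  have [sA est] := @disc_estimate de (cmod x) (cmod s) (cmod q) D (cmod b) (cmod c)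
     t ka V de0 ltac:(by rewrite cmod_ge0) ltac:(by rewrite cmod_ge0) q0 b0 c0
     ltac:(by rewrite t0) erefl tD qtD.
  have xV : cmod x * V <= enorm (hh de x).
    rewrite -[leLHS]ger0_norm; last by rewrite mulr_ge0 ?cmod_ge0// ltW.
    rewrite -[leRHS]ger0_norm ?enorm_ge0// -ler_sqr ?nnegrE ?normr_ge0//.
    by rewrite !real_normK ?num_real// ortho exprMn lerDl mulr_ge0 ?sqr_ge0.
  split=> //.
    apply: le_trans (enormD _ _) _; rewrite (enormZ x v) (enormZ _ u) -/s -/V -/U; apply: le_trans trho.
    have := ler_wpM2r (ltW V0) xt; have := ler_wpM2r U0 sA; lra.
  have -> : dot a (hh de x) = s by rewrite dotDr (dotZr a _ v) (dotZr a _ u) av au mulr0 add0r mulr1.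
  rewrite quad_expand -/s -/q -/b -/c.
  have -> : s + (x ^+ 2 * q + x * s * b + s ^+ 2 * c) = ofreal de + s * (x * b + s * c).
    by rewrite /s; ring.
  rewrite ReD (_ : complex.Re (ofreal de) = de)//.
  have h1 := Re_geN_cmod (s * (x * b + s * c)).
  have h2 : cmod (s * (x * b + s * c)) <= cmod s * (cmod x * cmod b + cmod s * cmod c).
    rewrite cmodM; apply: ler_wpM2l; first exact: cmod_ge0.
    by apply: le_trans (cmodD _ _) _; rewrite !cmodM.
  have h3 : (cmod x * V) ^+ 2 <= enorm (hh de x) ^+ 2.
    by apply: lerXn2r; rewrite ?nnegrE ?enorm_ge0// mulr_ge0 ?cmod_ge0// ltW.
  have h4 := ler_wpM2l (ltW ka0) h3; rewrite exprMn in h4.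
  lra.
have Dh0 h : enorm h < rho -> h != 0 -> wset (x0 + h) ->
    complex.Re (dot a h + dot (h *m S) h) < - (ka / 2) * enorm h ^+ 2.
  move=> hr h0 Eh; have := HE _ hr Eh.
  have : 0 < ka * enorm h ^+ 2 by rewrite mulr_gt0// exprn_gt0// enorm_gt0.
  lra.
have lo (de : R) (x : Cx R) : 0 <= de <= t -> cmod x <= t ->
    - (ka / 2) * enorm (hh de x) ^+ 2 <=
       complex.Re (dot a (hh de x) + dot (hh de x *m S) (hh de x)).
  move=> det xt; have [_ _] := key _ _ det xt.
  by case/andP: det => + _; lra.
have rho2 : rho / 2 < rho by lra.
pose g (de : R) (i : 'I_n) : {poly C} :=
  ((x0 0 i + ofreal de * u 0 i : C))%:P + ((v 0 i : C))%:P * 'X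
   - ((q * u 0 i : C))%:P * 'X ^+ 2.
have gE de x : pdisc (g de) x = x0 + hh de x.
  rewrite /g /hh; move: (u) (v) (q) => u' v' q'.
  by apply/rowP => i; rewrite !mxE !(hornerD, hornerN, hornerM, hornerC, hornerX, hornerXn); ring.
(* on the bounding circles the displacement from x0 is at least t * V: for all
   heights together, they lie in one compact set off the limit set *)
have [k0 hk0] : exists k0 : nat, forall (de : R) (x : Cx R), 0 <= de <= t -> cmod x = t ->
    O_ k0 (pdisc (g de) x).
  pose Lf h := complex.Re (dot a h + dot (h *m S) h) + ka / 2 * enorm h ^+ 2.
  have cL : continuous Lf.
    exact: quad_norm_continuous.
  pose K1 := [set h : Cn R n | enorm h <= rho / 2] `&`
     ([set h | t * V <= enorm h] `&` [set h | 0 <= Lf h]).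
  have cK1 : compact K1.
    apply: compact_closedI; first exact: compact_cball.
    by apply: closedI; apply: closed_le_cont => //; exact: enorm_continuous.
  have cK : compact ((fun h => x0 + h) @` K1).
    apply: continuous_compact => //; apply: continuous_subspaceT.
    exact: translation_continuous.
  have hK : (fun h => x0 + h) @` K1 `<=` ~` wset.
    move=> _ [h [h1 [h2 h3]] <-] Eh.
    have h0 : h != 0 by rewrite -enorm_gt0; apply: lt_le_trans h2; rewrite mulr_gt0.
    have := Dh0 h (le_lt_trans h1 rho2) h0 Eh; move: h3; rewrite /= /Lf; lra.
  have [k0 hk0] := compact_O cK hK.
  exists k0 => de x det xt; apply: hk0; exists (hh de x); last by rewrite gE.
  have xt' : cmod x <= t by rewrite xt.
  have [h1 h2 h3] := key _ _ det xt'; split=> //; split; first by rewrite -xt.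
  by have := lo _ _ det xt'; rewrite /= /Lf; lra.
have bnd (de : R) : 0 < de <= t -> ((2 ^- k0 * ln (eta_ k0) - 2)%:E <= phi (x0 + ofreal de *: u))%E.
  move=> /andP[de0 det]; have det' : 0 <= de <= t by rewrite (ltW de0).
  have := @disc_bound k0 (g de) t t0; rewrite gE.
  rewrite (_ : hh de 0 = ofreal de *: u); last first.
    by rewrite /hh scale0r add0r expr0n mulr0 subr0.
  apply=> x xt; last exact: hk0.
  rewrite gE => Eh; have [h1 _ h3] := key _ _ det' xt.
  have := lo _ _ det' xt.
  have [hz|hz] := eqVneq (hh de x) 0.
    move: h3; rewrite hz dot0r mul0mx dot0l addr0 enorm0 expr0n mulr0 subr0 /=; lra.
  by have := Dh0 _ (le_lt_trans h1 rho2) hz Eh; lra.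
have : (phi x0 < (2 ^- k0 * ln (eta_ k0) - 3)%:E)%E.
  by rewrite phi_wset// ltNyr.
move=> /(phi_usc I)/nbhs_Cn[e e0 he].
pose de := Num.min t (e / (2 * (U + 1))).
have de0 : 0 < de by rewrite lt_min t0 divr_gt0// mulr_gt0//; lra.
have de1 : de <= t by rewrite ge_min lexx.
have de2 : de <= e / (2 * (U + 1)) by rewrite /de ge_min lexx orbT.
have de3 : de * U < e by move: de2; rewrite ler_pdivlMr; lra.
have h1 := bnd de ltac:(by rewrite de0).
have h2 := he (x0 + ofreal de *: u).
rewrite addrC addKr (enormZ _ u) cmod_ofreal gtr0_norm// in h2.
by have := le_lt_trans h1 (h2 de3); rewrite lte_fin; lra.
Qed.

Lemma wset_no_interior (x : Cn R n) (d : R) : 0 < d ->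
  exists2 y, enorm y < d & ~ wset (x + y).
Proof.
move=> d0; apply: contrapT => H.
have H' y : enorm y < d -> wset (x + y) by move=> yd; apply: contrapT => h; apply: H; exists y.
pose e : Cn R n := delta_mx 0 i0.
have e1 : enorm e = 1 by exact: enorm_delta.
have e0 : e != 0 by rewrite -enorm_gt0 e1.
have [s [sd xs]] : exists s : Cx R, cmod s < d / 2 /\ x + s *: e != 0.
  have [x0|x0] := eqVneq x 0; last first.
    by exists 0; rewrite cmod0 scale0r addr0 divr_gt0.
  exists (ofreal (d / 4)); rewrite cmod_ofreal ger0_norm; last lra.
  split; first lra.
  by rewrite x0 add0r -enorm_gt0 enormZ e1 cmod_ofreal gtr0_norm; lra.
have d2 : 0 < d / 2 by lra.
apply: (@wset_no_line R n i0 (x + s *: e) e _ d2 e0 xs) => s' hs.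
rewrite -addrA -scalerDl; apply: H'; rewrite enormZ e1 mulr1.
by have := cmodD s s'; lra.
Qed.

(** The vectors on the left hand side of the inequality are, up to a real duality, the
    gradients of a real quadratic form: they depend on [h] through a symmetric real
    linear map. If it is injective, its value at a small [y] with [x0 + y] off the set,
    which exists as the set has no interior, is not attained on the set; otherwise the
    conjugate of a vector of the kernel is orthogonal to the image. *)
Lemma missed_gradient (x0 : Cn R n) S (ka : R) : S^T = S -> 0 < ka ->
  forall et : R, 0 < et -> exists2 l : Cn R n, enorm l < et &
    forall h, wset (x0 + h) -> (2 : Cx R) *: (h *m S) + ofreal ka *: cconj h != l.
Proof.
move=> ST ka0 et et0.
pose Lf h : Cn R n := (2 : Cx R) *: (h *m S) + ofreal ka *: cconj h.
have LB h y : Lf (h - y) = Lf h - Lf y.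
  by rewrite /Lf mulmxBl cconjB !scalerBr opprD addrACA.
have [[h0 [h00 Lh0]]|inj] := pselect (exists h0, h0 != 0 /\ Lf h0 = 0); last first.
  have [K K0 hK] := bilinear_bound S.
  pose M := 2 * K + ka + 1.
  have M0 : 0 < M by rewrite /M; lra.
  have [y yd Ey] := wset_no_interior x0 (divr_gt0 et0 M0).
  have y0 := enorm_ge0 y.
  have c2 : cmod (2 : Cx R) = 2.
    have -> : (2 : Cx R) = ofreal 2 by rewrite -[ofreal 2]/(real_complex R 2) rmorph_nat.
    by rewrite cmod_ofreal ger0_norm.
  exists (Lf y).
    apply: le_lt_trans (enormD _ _) _; rewrite !enormZ enorm_cconj c2 cmod_ofreal gtr0_norm//.
    have := hK y; move: yd; rewrite ltr_pdivlMr// /M; lra.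
  move=> h Eh; apply/eqP => hl; apply: Ey; suff <- : h = y by [].
  apply/eqP; rewrite -subr_eq0; apply/negPn/negP => hy; apply: inj; exists (h - y).
  split; first exact: hy.
  have hl' : Lf h = Lf y := hl.
  rewrite LB hl'.
  exact: subrr.
have n0 : 0 < enorm h0 by rewrite enorm_gt0.
exists (ofreal (et / 2 / enorm h0) *: cconj h0).
  rewrite enormZ enorm_cconj cmod_ofreal ger0_norm ?divfK ?gt_eqF//; first lra.
  by rewrite divr_ge0//; lra.
move=> h _; apply/eqP => hl.
have sym k : complex.Re (dot (Lf h) k) = complex.Re (dot (Lf k) h).
  have rs (t : R) (z : Cx R) : complex.Re (ofreal t * z) = t * complex.Re z.
    by case: z => z1 z2 /=; rewrite mul0r subr0.
  have eL x y : complex.Re (dot (Lf x) y) =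
      complex.Re (2 * dot (x *m S) y) + ka * complex.Re (dot (cconj x) y).
    by rewrite /Lf dotDl 2!dotZl ReD rs.
  by rewrite !eL Re_dot_cconj_sym -[in LHS]ST dot_trmx.
have pos : 0 < et / 2 / enorm h0 * enorm h0 ^+ 2.
  by rewrite mulr_gt0 ?exprn_gt0// divr_gt0//; lra.
have := sym h0; rewrite Lh0 dot0l /Lf hl dotZl dot_cconj.
rewrite [complex.Re (_ * _)](_ : _ = et / 2 / enorm h0 * enorm h0 ^+ 2).
  by rewrite [complex.Re _](_ : _ = 0)//; lra.
by rewrite /= mulr0 subr0.
Qed.

(** Where the differential vanishes, a small linear form is subtracted, which moves
    the maximum to a nearby point; by [missed_gradient] the form can be chosen so
    that the differential at that point does not vanish, and [touch] applies there. *)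
Lemma wset_no_max_sym (x0 a : Cn R n) S (ka rho : R) : S^T = S -> 0 < ka -> 0 < rho ->
  wset x0 ->
  ~ (forall h, enorm h < rho -> wset (x0 + h) ->
      complex.Re (dot a h + dot (h *m S) h) <= - ka * enorm h ^+ 2).
Proof.
move=> ST ka0 rho0 Ex0; have [->|a0] := eqVneq a 0; last exact: touch.
move=> HE.
have et0 : 0 < ka * rho / 8 by rewrite !mulr_gt0// invr_gt0.
have [l lsmall lmiss] := missed_gradient x0 ST ka0 et0.
pose F h := complex.Re (dot (- l) h + dot (h *m S) h) + ka / 2 * enorm h ^+ 2.
pose X := [set h : Cn R n | enorm h <= rho / 2] `&` (fun h => x0 + h) @^-1` wset.
have cX : compact X.
  apply: compact_closedI; first exact: compact_cball.
  apply: preimage_closed; last exact: closed_wset.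
  by move=> h _; exact: translation_continuous.
have X0 : X 0 by split; [rewrite /= enorm0; lra|rewrite /= addr0].
have cF : {within X, continuous F}.
  by apply: continuous_subspaceT; exact: quad_norm_continuous.
have [h1 /set_mem[hr Eh1] hmax] := compact_EVT_max (ex_intro _ _ X0) cX cF.
have rho2 : rho / 2 < rho by lra.
have e1 := enorm_ge0 h1.
have h1s : enorm h1 < rho / 4.
  have := hmax 0 (mem_set X0); rewrite /F dot0r mul0mx dot0l addr0 enorm0 expr0n mulr0 addr0.
  rewrite [complex.Re 0](_ : _ = 0)// => h2.
  have := HE h1 (le_lt_trans hr rho2) Eh1; rewrite dot0l add0r => h3.
  have h4 := Re_le_cmod (dot (- l) h1); have h5 := cmod_dot (- l) h1.
  rewrite enormN in h5; rewrite ReD in h2.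
  have h6 : enorm l * enorm h1 <= ka * rho / 8 * enorm h1 by apply: ler_wpM2r => //; exact: ltW.
  have h7 : ka / 2 * enorm h1 ^+ 2 <= ka * rho / 8 * enorm h1 by lra.
  rewrite ltNge; apply/negP => h8.
  have h9 : 0 < enorm h1 by apply: lt_le_trans h8; rewrite divr_gt0.
  have : enorm l * enorm h1 < ka * rho / 8 * enorm h1 by rewrite ltr_pM2r.
  have : ka / 2 * enorm h1 * (rho / 4) <= ka / 2 * enorm h1 * enorm h1.
    by apply: ler_wpM2l => //; rewrite mulr_ge0//; lra.
  rewrite expr2 in h2 h3 h7 *; lra.
have rho4 : 0 < rho / 4 by rewrite divr_gt0.
have ka2 : 0 < ka / 2 by rewrite divr_gt0.
pose b : Cn R n := (2 : Cx R) *: (h1 *m S) + ofreal ka *: cconj h1 - l.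
have b0 : b != 0 by rewrite subr_eq0; exact: lmiss.
apply: (@touch (x0 + h1) b S (ka / 2) (rho / 4) b0 ka2 rho4 Eh1) => k kr Ek.
have Xk : X (h1 + k).
  split; last by rewrite /= addrA.
  by rewrite /=; have := enormD h1 k; lra.
have := hmax _ (mem_set Xk); rewrite /F enorm_sqrD.
have rs (t : R) (z : Cx R) : complex.Re (ofreal t * z) = t * complex.Re z.
  by case: z => z1 z2 /=; rewrite mul0r subr0.
have -> : dot (- l) (h1 + k) + dot ((h1 + k) *m S) (h1 + k) =
    (dot (- l) h1 + dot (h1 *m S) h1) +
    (dot (- l) k + 2 * dot (h1 *m S) k + dot (k *m S) k).
  rewrite dotDr mulmxDl dotDl 2!dotDr (_ : dot (k *m S) h1 = dot (h1 *m S) k).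
    by move: (dot _ _) (dot _ _) (dot _ _) (dot _ _) (dot _ _) => *; ring.
  by rewrite -[in LHS]ST dot_trmx.
have -> : dot b k + dot (k *m S) k =
   (dot (- l) k + 2 * dot (h1 *m S) k + dot (k *m S) k) + ofreal ka * dot (cconj h1) k.
  rewrite /b dotDl dotDl 2!dotZl.
  by move: (dot _ _) (dot _ _) (dot _ _) (dot _ _) => *; ring.
rewrite ![complex.Re (_ + _)]ReD rs; lra.
Qed.

Lemma wset_no_max (x0 a : Cn R n) S (ka rho : R) : 0 < ka -> 0 < rho -> wset x0 ->
  ~ (forall h, enorm h < rho -> wset (x0 + h) ->
      complex.Re (dot a h + dot (h *m S) h) <= - ka * enorm h ^+ 2).
Proof.
move=> ka0 rho0 Ex0 HE.
pose S' : 'M[Cx R]_n := (2^-1 : Cx R) *: (S + S^T).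
have S'T : S'^T = S' by rewrite /S' linearZ /= linearD /= trmxK addrC.
apply: (@wset_no_max_sym x0 a S' ka rho S'T ka0 rho0 Ex0) => h hr Eh.
rewrite (_ : dot (h *m S') h = dot (h *m S) h); first exact: HE.
rewrite /S' -scalemxAr mulmxDr dotZl dotDl dot_trmx.
by move: (dot _ _) => x; field.
Qed.

Lemma pev_linear (a : Cn R n) : exists t : pexp R n, forall z, pev t z = dot a z.
Proof.
exists (\big[@PA R n/@PC R n 0]_i PM (@PC R n (a 0 i)) (@PX R n i)) => z.
by rewrite (big_morph (fun t => pev t z) (id1 := 0) (op1 := +%R)).
Qed.

Lemma hull_le (K : set (Cn R n)) (x : Cn R n) (t : pexp R n) (B : R) :
  polynomial_hull K x -> (forall z, K z -> cmod (pev t z) <= B) -> cmod (pev t x) <= B.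
Proof.
move=> /(_ (mpoly_of t)) hx hB; rewrite -lee_fin.
have pm z : poly_mod (mpoly_of t) z = (cmod (pev t z))%:E by rewrite /poly_mod meval_mpoly_of.
rewrite -pm; apply: le_trans hx _; apply: ge_ereal_sup => _ [z Kz <-].
by rewrite pm lee_fin; exact: hB.
Qed.

(** The points off the ball are separated by a linear form, those off the set by
    a late [P_ k], which is at most [eta_ k] on the set. *)
Lemma hull_sub_ball (r : R) : 0 < r ->
  polynomial_hull (boundary (eball r) `&` wset) `<=` closure (eball r) `&` wset.
Proof.
move=> r0 x; rewrite boundary_eball// closure_eball// => hx.
have x0 := enorm_ge0 x; split.
  have [t ht] := pev_linear (cconj x).
  have : cmod (pev t x) <= enorm x * r.
    apply: (hull_le hx) => z [/= zr _]; rewrite ht -zr.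
    by apply: le_trans (cmod_dot _ _) _; rewrite enorm_cconj.
  rewrite ht dot_cconj cmod_ofreal ger0_norm ?sqr_ge0// expr2 /= => h.
  have [//|rx] := leP (enorm x) r.
  by move: h; rewrite ler_pM2l ?leNgt ?rx//; exact: lt_trans rx.
apply: contrapT => /not_wset[k Ok].
have [m rm] : exists m, r < m%:R.
  by exists (Num.bound r); apply: archi_boundP; exact: ltW.
have [_] := @O_sub R n i0 k (maxn k m) (leq_maxl _ _) x Ok.
rewrite ltNge => /negP; apply; apply: (hull_le hx) => z [/= zr Ez]; apply: Ez.
rewrite zr; apply: le_trans (ltW rm) _; rewrite ler_nat; exact: leq_maxr.
Qed.

Lemma phase (y : Cx R) : exists2 w : Cx R, cmod w = 1 & complex.Re (w * y) = cmod y.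
Proof.
have [->|y0] := eqVneq y 0; first by exists 1; rewrite ?cmod1// mulr0 cmod0.
have yp : 0 < cmod y by rewrite cmod_gt0.
exists (ofreal (cmod y)^-1 * conjc y).
  by rewrite cmodM cmod_conj cmod_ofreal gtr0_norm ?invr_gt0// mulVf ?gt_eqF.
rewrite (_ : complex.Re _ = (cmod y)^-1 * cmod y ^+ 2).
  by rewrite expr2 mulKf// gt_eqF.
rewrite cmod_sqr; move: (cmod y)^-1 => c; case: y {y0 yp} => y1 y2 /=; ring.
Qed.

(** A polynomial that is larger at a point of the set in the ball than on the trace
    of the sphere has, after a rotation and the addition of a small multiple of the
    squared norm to its real part, a maximum on the set inside the ball. Its Taylor
    expansion there contradicts [wset_no_max]. *)
Lemma ball_sub_hull (r : R) : 0 < r ->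
  closure (eball r) `&` wset `<=` polynomial_hull (boundary (eball r) `&` wset).
Proof.
move=> r0 x; rewrite boundary_eball// closure_eball// => -[/= xr Ex] p.
rewrite leNgt; apply/negP => hp.
have [t ht] := pexp_of_mpoly p.
have pm z : poly_mod p z = (cmod (pev t z))%:E by rewrite /poly_mod ht.
have [th th1 th2] : exists2 th : R, th < cmod (pev t x) &
    forall z, enorm z = r -> wset z -> cmod (pev t z) <= th.
  have ub z : enorm z = r -> wset z -> ((cmod (pev t z))%:E <=
      ereal_sup [set poly_mod p z | z in [set z | enorm z = r] `&` wset])%E.
    by move=> zr Ez; apply: ereal_sup_ubound; exists z.
  move: ub hp; rewrite pm; case: (ereal_sup _) => [s| |] ub hp.
  - by exists s => // z zr Ez; have := ub z zr Ez; rewrite lee_fin.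
  - by [].
  - by exists (cmod (pev t x) - 1); [lra|move=> z zr Ez; have := ub z zr Ez].
have [w w1 wx] := phase (pev t x).
pose t' := PM (@PC R n w) t.
pose ep := (cmod (pev t x) - th) / (2 * (r ^+ 2 + 1)).
have r2 : 0 < r ^+ 2 by rewrite exprn_gt0.
have ep0 : 0 < ep by rewrite divr_gt0//; lra.
have epr : ep * r ^+ 2 < cmod (pev t x) - th.
  have : ep * (2 * (r ^+ 2 + 1)) = cmod (pev t x) - th by rewrite divfK// gt_eqF//; lra.
  have : 0 < ep * r ^+ 2 by rewrite mulr_gt0.
  lra.
pose F z := complex.Re (pev t' z) + ep * enorm z ^+ 2.
pose X := [set z : Cn R n | enorm z <= r] `&` wset.
have cX : compact X.
  by apply: compact_closedI; [exact: compact_cball|exact: closed_wset].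
have cF : {within X, continuous F}.
  apply: continuous_subspaceT => z.
  have c1 : {for z, continuous (fun z => complex.Re (pev t' z))}.
    apply: (@continuous_comp _ _ _ (pev t') (fun y : Cx R => complex.Re y)).
      exact: pev_continuous.
    exact: Re_continuous.
  have c2 := @quad_norm_continuous R n 0 0 ep z.
  have c3 := cvgD c1 c2.
  have -> : F = (fun z => complex.Re (pev t' z) +
      (complex.Re (dot 0 z + dot (z *m 0) z) + ep * enorm z ^+ 2)).
    by apply/funext => y; rewrite /F dot0l mulmx0 dot0l addr0 [complex.Re 0](_ : _ = 0)// add0r.
  exact: c3.
have [x0 /set_mem[x0r Ex0] hmax] := compact_EVT_max (ex_intro _ x (conj xr Ex)) cX cF.
have x0r' : enorm x0 < r.
  rewrite lt_neqAle x0r andbT; apply/eqP => xE.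
  have := hmax x (mem_set (conj xr Ex)); rewrite /F [pev t' x]/= wx xE.
  have := th2 _ xE Ex0; have := Re_le_cmod (pev t' x0); rewrite [pev t' x0]/= cmodM w1.
  have := mulr_ge0 (ltW ep0) (sqr_ge0 (enorm x)); lra.
have [a [S [M [M0 hM]]]] := pev_taylor t' x0.
pose rho := Num.min (r - enorm x0) (Num.min 1 (ep / (2 * (M + 1)))).
have rho0 : 0 < rho by rewrite !lt_min ltr01 divr_gt0//; lra.
have ep2 : 0 < ep / 2 by rewrite divr_gt0.
apply: (@wset_no_max x0 (a + ofreal (2 * ep) *: cconj x0) S (ep / 2) rho) => // h.
rewrite !lt_min => /and3P[h1 h2 h3] Eh.
have Xh : X (x0 + h) by split=> //=; have := enormD x0 h; lra.
have := hmax _ (mem_set Xh); rewrite /F enorm_sqrD => h4.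
have e0 := enorm_ge0 h.
have h5 := hM h (ltW h2).
have h6 : M * enorm h ^+ 3 <= ep / 2 * enorm h ^+ 2.
  rewrite exprS mulrA; apply: ler_wpM2r; first exact: sqr_ge0.
  move: h3; rewrite ltr_pdivlMr; lra.
set D : Cx R := _ - _ in h5.
have DE : pev t' (x0 + h) = pev t' x0 + (dot a h + dot (h *m S) h) + D.
  by rewrite /D; move: (pev t' (x0 + h)) (pev t' x0) => *; ring.
have h7 := Re_geN_cmod D.
have rs (s : R) (z : Cx R) : complex.Re (ofreal s * z) = s * complex.Re z.
  by case: z => z1 z2 /=; rewrite mul0r subr0.
rewrite DE 2!ReD in h4.
have -> : dot (a + ofreal (2 * ep) *: cconj x0) h + dot (h *m S) h =
    (dot a h + dot (h *m S) h) + ofreal (2 * ep) * dot (cconj x0) h.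
  by rewrite dotDl dotZl addrAC.
rewrite ReD rs; lra.
Qed.

End Touch.

Theorem theorem1 (R : realType) (n : nat) (hn : (2 <= n)%N) :
  exists (E : set (Cn R n)) (phi : Cn R n -> \bar R),
    [/\ closed E, E !=set0, ~ contains_positive_dim_variety E &
        plurisubharmonic setT phi] /\
    [/\ E = [set z | phi z = -oo%E],
        pluriharmonic (~` E) (fine \o phi),
        pseudoconvex_domain (~` E) &
        forall r : R, 0 < r ->
          polynomial_hull (boundary (eball r) `&` E) =
          closure (eball r) `&` E].
Proof.
pose i0 : 'I_n := Ordinal (ltnW hn).
exists (@wset R n i0), (@phi R n i0); split; split.
- exact: closed_wset.
- by exists 0; exact: wset_0.
- exact: no_variety.
- exact: phi_psh.
- exact: wset_phi.
- exact: phi_pluriharmonic.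
- exact: compl_pseudoconvex.
- move=> r r0; apply/seteqP; split; first exact: hull_sub_ball.
  exact: ball_sub_hull.
Qed.
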